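(* Let $n\ge1$ and $k\ge1$ be integers. For planar simply connected domains with $n$-rotational symmetry, the Hersch–Payne–Schiffer inequality $\overline\sigma_k\le2\pi k$ is sharp only when $k\equiv0$ or $k\equiv1\pmod n$; that is, if the remainder $(k\bmod n)\in\{0,\dots,n-1\}$ does not belong to $\{0,1\}$, then $$\mathfrak{S}_k(\mathbb{D}^2;\mathbb{Z}_n)<2\pi k.$$
   Context: $\mathbb{D}^2$ is the closed unit disk with Euclidean metric $g_{\mathbb{R}^2}$, and $\mathbb{Z}_n\subset SO(\mathbb{R}^2)$ is the group generated by a rotation of order $n$, acting on $\mathbb{D}^2$. For a Riemannian metric $\tilde g$ on $\mathbb{D}^2$, $0=\sigma_0(\tilde g)<\sigma_1(\tilde g)\le\cdots$ are the Steklov eigenvalues with multiplicity ($\Delta_{\tilde g}\phi=0$ in $\mathbb{D}^2$, $\partial_\nu\phi=\sigma\phi$ on $\partial\mathbb{D}^2$), $\overline\sigma_k(\tilde g)=\sigma_k(\tilde g)\operatorname{Length}_{\tilde g}(\partial\mathbb{D}^2)$, and $$\mathfrak{S}_k(\mathbb{D}^2;\mathbb{Z}_n)=\sup\{\overline\sigma_k(\tilde g):\tilde g\in[g_{\mathbb{R}^2}],\ \tilde g\text{ is }\mathbb{Z}_n\text{-invariant}\}.$$ A planar simply connected domain with $n$-rotational symmetry is identified with $\mathbb{D}^2$ equipped with a $\mathbb{Z}_n$-invariant metric in $[g_{\mathbb{R}^2}]$ via uniformization. The precise content of the assertion is the displayed strict inequality. *)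

(* Defs.v *)
From HB Require Import structures.
From mathcomp Require Import all_boot all_order all_algebra.
From mathcomp Require Import all_classical all_reals all_analysis.
Set Implicit Arguments.
Unset Strict Implicit.
Unset Printing Implicit Defensive.
Import Order.TTheory GRing.Theory Num.Theory.
Import numFieldNormedType.Exports.
Local Open Scope classical_set_scope.
Local Open Scope ring_scope.

(* Points and tangent vectors of the plane are row vectors; linear maps and
   bilinear forms act as v *m A and v *m G *m w^T.  The library norm on
   'rV[R]_2 is the sup norm, so the Euclidean disk is written with dot. *)
Notation plane R := 'rV[R]_2.

Definition dot (R : realType) (v w : plane R) : R := (v *m w^T) 0 0.

Definition disk (R : realType) : set (plane R) := [set p | dot p p <= 1].
Definition open_disk (R : realType) : set (plane R) := [set p | dot p p < 1].
Definition circle (R : realType) : set (plane R) := [set p | dot p p = 1].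

Definition partial (R : realType) (i : 'I_2) (f : plane R -> R) : plane R -> R :=
  fun p => 'D_(delta_mx 0 i) f p.

(* C^oo on the whole plane.  Functions and metrics that are smooth up to the
   boundary of the closed disk are represented by smooth extensions to the
   plane; all other conditions are imposed on the disk only, and derivatives at
   boundary points do not depend on the extension. *)
Definition smooth (R : realType) (f : plane R -> R) : Prop :=
  forall (s : seq 'I_2) (p : plane R), differentiable (foldr (@partial R) f s) p.

Definition metric_field (R : realType) := plane R -> 'M[R]_2.

Definition inner (R : realType) (g : metric_field R) (p v w : plane R) : R :=
  (v *m g p *m w^T) 0 0.

Definition riemannian_metric (R : realType) (g : metric_field R) : Prop :=
  [/\ forall i j, smooth (fun p => g p i j),
      forall p, disk p -> (g p)^T = g p
    & forall p v, disk p -> v != 0 -> 0 < inner g p v v].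

Definition euclidean_metric (R : realType) : metric_field R := fun=> 1%:M.

Definition conformal_class (R : realType) (g0 : metric_field R) :
    set (metric_field R) :=
  [set g | exists2 w : plane R -> R, smooth w &
     forall p, disk p -> g p = expR (2 * w p) *: g0 p].

(* p |-> p *m rotation t turns p counterclockwise by the angle t. *)
Definition rotation (R : realType) (t : R) : 'M[R]_2 :=
  \matrix_(i < 2, j < 2)
    (if i == j then cos t else if (i < j)%N then sin t else - sin t).

Definition rotation_group (R : realType) (n : nat) : set 'M[R]_2 :=
  [set A | exists m : nat, A = rotation (2 * pi / n%:R) ^+ m].

Definition invariant_metric (R : realType) (G : set 'M[R]_2)
    (g : metric_field R) : Prop :=
  forall A, G A -> forall p v w, disk p ->
    inner g (p *m A) (v *m A) (w *m A) = inner g p v w.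

(* Delta_g f = (det g)^(-1/2) d_i ((det g)^(1/2) g^(ij) d_j f) *)
Definition laplace_beltrami (R : realType) (g : metric_field R)
    (f : plane R -> R) (p : plane R) : R :=
  (Num.sqrt (\det (g p)))^-1 *
  \sum_(i < 2) partial i (fun q => Num.sqrt (\det (g q)) *
                 \sum_(j < 2) invmx (g q) i j * partial j f q) p.

Definition tangent (R : realType) (p : plane R) : plane R :=
  p *m rotation (pi / 2).

Definition outward_unit_normal (R : realType) (g : metric_field R)
    (p v : plane R) : Prop :=
  [/\ inner g p v (tangent p) = 0, inner g p v v = 1 & 0 < dot v p].

Definition steklov_eigenspace (R : realType) (g : metric_field R) (sigma : R) :
    set (plane R -> R) :=
  [set phi | [/\ smooth phi,
     forall p, open_disk p -> laplace_beltrami g phi p = 0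
   & forall p v, circle p -> outward_unit_normal g p v ->
       'D_v phi p = sigma * phi p]].

Definition independent_on_disk (R : realType) (m : nat)
    (phi : 'I_m -> plane R -> R) : Prop :=
  forall c : 'I_m -> R,
    (forall p, disk p -> \sum_(i < m) c i * phi i p = 0) -> forall i, c i = 0.

(* sigma_k, indexed from 0 and counted with multiplicity: the least s such that
   the eigenspaces of the eigenvalues <= s have total dimension > k. *)
Definition steklov_eigenvalue (R : realType) (g : metric_field R) (k : nat) :
    \bar R :=
  ereal_inf [set s%:E | s in [set s : R |
    exists2 phi : 'I_k.+1 -> plane R -> R, independent_on_disk phi &
      forall i, exists2 sigma : R,
        sigma <= s & steklov_eigenspace g sigma (phi i)]].

Definition boundary_length (R : realType) (g : metric_field R) : R :=
  let gamma t : plane R := delta_mx 0 0 *m rotation t in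
  \int[lebesgue_measure]_(t in `[0, 2 * pi])
    Num.sqrt (inner g (gamma t) (tangent (gamma t)) (tangent (gamma t))).

Definition normalized_steklov_eigenvalue (R : realType) (g : metric_field R)
    (k : nat) : \bar R :=
  (steklov_eigenvalue g k * (boundary_length g)%:E)%E.

Definition sup_steklov_disk (R : realType) (n k : nat) : \bar R :=
  ereal_sup [set normalized_steklov_eigenvalue g k | g in
    [set g : metric_field R | [/\ riemannian_metric g,
       conformal_class (@euclidean_metric R) g
     & invariant_metric (@rotation_group R n) g]]].

(* Main.v *)
Require Import Defs.
From HB Require Import structures.
From mathcomp Require Import all_boot all_order all_algebra.
From mathcomp Require Import all_classical all_reals all_analysis.
From mathcomp Require Import ring lra zify.
Set Implicit Arguments.
Unset Strict Implicit.
Unset Printing Implicit Defensive.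
Import Order.TTheory GRing.Theory Num.Theory.
Import numFieldNormedType.Exports.
Local Open Scope classical_set_scope.
Local Open Scope ring_scope.

(* For the metric exp(2w)(dx^2 + dy^2) the Steklov problem reads: phi harmonic with
   d_r phi = sigma rho phi on the circle, where rho = exp(w) is invariant under the
   rotation of angle tau = 2 pi / n.  Reparametrising the circle by arc length x(t),
   Hersch, Payne and Schiffer use as trial functions combinations v of cos(j x(t)),
   sin(j x(t)): the product of the Rayleigh quotients of v and of its harmonic
   conjugate is at most (2 pi j / L)^2, so one of the two is at most 2 pi j / L.

   Functions split into those with rotation character exp(+-i tau) ("resonant") and
   the others.  On the resonant part the complex structure
   J = (shift_tau - shift_{-tau}) / (2 sin tau) commutes with the problem, so
   eigenvectors come in pairs u, J u.  With m = k - 1 the condition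
   0 < m mod n < n - 1 makes the number of frequencies 1 <= j <= m with
   j = +-1 (mod n) odd, and the trial space, which by itself yields an odd number of
   resonant eigenvalues below any c > 2 pi m / L, yields one more by parity.
   Hence sigma_k <= c, and c L can be taken equal to 2 pi (k - 1/2).

   The spectral theory is replaced by Galerkin approximation in the Fourier basis: the
   finite-dimensional eigenvectors decay rapidly, uniformly in the truncation, and a
   cluster point is a system of Fourier series solving the equation on the circle.
   Multiplying each z^j by a cutoff extends their harmonic extensions smoothly to the
   plane. *)

(** * Fourier analysis on the circle *)

(** The count behind the parity argument: a trial vector has to be orthogonal to the constants and
    to the [d] eigenvectors already found, and its conjugate to the same [d] eigenvectors. These are
    [2 d + 1] linear conditions, so [2 r] trial functions with a common behaviour under rotation
    yield [r] eigenvectors. The conjugate is made orthogonal to the constants for free, since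
    constants carry no energy. With [q = m %/ n], the resonant part has [r = 2 q + 1], which pairing
    raises to [2 q + 2]; the other part gives [m - r], and the constant is one more. The total
    [m + 2] is what an eigenvalue of index [m + 1 = k] requires, although only frequencies up to
    [k - 1] occur. The inequality [2 pi m < c L] has to be strict because its slack pays for
    truncating the trial functions; a value of [c L] that does not depend on the metric survives the
    supremum. In the limit the eigenvectors must neither lose independence nor satisfy the equation
    only approximately; bounds free of the truncation turn convergence of coefficients into uniform
    convergence of the series. *)

Section Derivation.
Variable R : realType.
Implicit Types f g : R -> R.

(** A relation rather than an operator: one hypothesis supplies both differentiability everywhere
    and a formula for the derivative. *)
Definition der f f' := forall t : R, is_derive t 1 f (f' t).

Lemma der_ext f f' g g' : der f f' -> f =1 g -> f' =1 g' -> der g g'.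
Proof. by move=> df /funext <- /funext <-. Qed.

Lemma der_cst (a : R) : der (fun=> a) (fun=> 0).
Proof. by move=> t; exact: is_derive_cst. Qed.

Lemma der_id : der id (fun=> 1).
Proof. by move=> t; exact: is_derive_id. Qed.

Lemma derD f f' g g' : der f f' -> der g g' ->
  der (fun t => f t + g t) (fun t => f' t + g' t).
Proof. by move=> df dg t; exact: (@is_deriveD _ _ _ f g _ _ _ _ (df t) (dg t)). Qed.

Lemma derM f f' g g' : der f f' -> der g g' ->
  der (fun t => f t * g t) (fun t => f' t * g t + f t * g' t).
Proof.
move=> df dg t; apply: is_derive_eq.
  exact: (@is_deriveM _ _ f g _ _ _ _ (df t) (dg t)).
by rewrite /GRing.scale/=; ring.
Qed.

Lemma derZ (a : R) f f' : der f f' -> der (fun t => a * f t) (fun t => a * f' t).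
Proof.
move=> df; apply: (der_ext (derM (der_cst a) df)) => // t.
by rewrite mul0r add0r.
Qed.

Lemma der_comp f f' g g' : der f f' -> der g g' ->
  der (fun t => f (g t)) (fun t => f' (g t) * g' t).
Proof.
move=> df dg t; exact: (@is_derive1_comp _ f g t _ _ (df (g t)) (dg t)).
Qed.

Lemma der_sum (I : Type) (r : seq I) (P : pred I) (F F' : I -> R -> R) :
  (forall i, der (F i) (F' i)) ->
  der (fun t => \sum_(i <- r | P i) F i t) (fun t => \sum_(i <- r | P i) F' i t).
Proof.
move=> dF; elim: r => [|i r IH].
  by apply: (der_ext (der_cst 0)) => t; rewrite big_nil.
case Pi : (P i).
  by apply: (der_ext (derD (dF i) IH)) => t; rewrite big_cons Pi.
by apply: (der_ext IH) => t; rewrite big_cons Pi.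
Qed.

Lemma der_affine (a b : R) : der (fun t => a * t - b) (fun=> a).
Proof.
by apply: (der_ext (derD (derZ a der_id) (der_cst (- b)))) => t; ring.
Qed.

Lemma der_sin : der sin cos. Proof. by move=> t; exact: is_derive_sin. Qed.

Lemma der_cos : der cos (fun t => - sin t).
Proof. by move=> t; exact: is_derive_cos. Qed.

Lemma der_exp : der expR expR. Proof. by move=> t; exact: is_derive_expR. Qed.

Lemma der_cont f f' : der f f' -> continuous f.
Proof.
by move=> df t; apply/differentiable_continuous/derivable1_diffP; case: (df t).
Qed.

Lemma der0_cst f a b : der f (fun=> 0) -> f a = f b.
Proof. by move=> df; exact: is_derive_0_is_cst. Qed.

Lemma der_mvt f f' a b : a <= b -> der f f' ->
  exists2 c, a <= c <= b & f b - f a = f' c * (b - a).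
Proof.
move=> ab df; have [||c] := @MVT_segment R f f' a b ab.
- by move=> x _; exact: df.
- by apply: continuous_subspaceT; exact: (der_cont df).
by rewrite in_itv/= => cab e; exists c.
Qed.

Lemma der_uniq f f' g' : der f f' -> der f g' -> f' =1 g'.
Proof.
by move=> df dg t; rewrite -(@derive_val _ _ _ _ _ _ _ (df t)) (@derive_val _ _ _ _ _ _ _ (dg t)).
Qed.

End Derivation.

Section Continuity.
Variables (R : realType) (T : topologicalType).
Implicit Types f g : T -> R.

Lemma cont_cst (a : R) : continuous (fun _ : T => a).
Proof. by move=> t; exact: cvg_cst. Qed.

Lemma contD f g : continuous f -> continuous g -> continuous (fun t => f t + g t).
Proof. by move=> cf cg t; apply: cvgD; [exact: cf|exact: cg]. Qed.

Lemma contM f g : continuous f -> continuous g -> continuous (fun t => f t * g t).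
Proof. by move=> cf cg t; apply: cvgM; [exact: cf|exact: cg]. Qed.

Lemma contZ a f : continuous f -> continuous (fun t => a * f t).
Proof. by move=> cf; apply: contM => //; exact: cont_cst. Qed.

Lemma cont_sum (I : Type) (r : seq I) (P : pred I) (F : I -> T -> R) :
  (forall i, continuous (F i)) ->
  continuous (fun t => \sum_(i <- r | P i) F i t).
Proof.
move=> cF; elim: r => [|i r IH].
  have -> : (fun t => \sum_(i <- [::] | P i) F i t) = fun=> 0.
    by apply/funext => t; rewrite big_nil.
  exact: cont_cst.
have -> : (fun t => \sum_(j <- i :: r | P j) F j t) =
    if P i then fun t => F i t + \sum_(j <- r | P j) F j t
    else fun t => \sum_(j <- r | P j) F j t.
  by apply/funext => t; rewrite big_cons; case: ifP.
by case: ifP => // _; exact: contD.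
Qed.

Lemma cont_comp (f : T -> R) (h : R -> R) : continuous f -> continuous h ->
  continuous (fun t => h (f t)).
Proof. by move=> cf ch t; apply: continuous_comp; [exact: cf|exact: ch]. Qed.

End Continuity.

(** * Integration over one period *)

Section CircleIntegral.
Variable R : realType.
Implicit Types f g : R -> R.

Definition cint f : R := \int[lebesgue_measure]_(t in `[0, 2 * pi]) f t.

Lemma twopi_gt0 : 0 < 2 * pi :> R.
Proof. by rewrite mulr_gt0// pi_gt0. Qed.

Lemma cont_integrable f (a b : R) : continuous f ->
  lebesgue_measure.-integrable `[a, b] (EFin \o f).
Proof.
move=> cf; apply: continuous_compact_integrable; first exact: segment_compact.
exact: continuous_subspaceT.
Qed.

Lemma cintD f g : continuous f -> continuous g ->
  cint (fun t => f t + g t) = cint f + cint g.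
Proof.
by move=> cf cg; rewrite /cint RintegralD//; exact: cont_integrable.
Qed.

Lemma cintZ a f : continuous f -> cint (fun t => a * f t) = a * cint f.
Proof. by move=> cf; rewrite /cint RintegralZl//; exact: cont_integrable. Qed.

Lemma cint_le f g : continuous f -> continuous g ->
  (forall t, 0 <= t <= 2 * pi -> f t <= g t) -> cint f <= cint g.
Proof.
by move=> cf cg fg; apply: le_Rintegral => //; exact: cont_integrable.
Qed.

Lemma eq_cint f g : f =1 g -> cint f = cint g.
Proof. by move=> /funext ->. Qed.

Lemma cint_FTC f f' : der f f' -> continuous f' ->
  cint f' = f (2 * pi) - f 0.
Proof.
move=> df cf'; rewrite /cint /Rintegral (@continuous_FTC2 _ f' f) //.
- exact: twopi_gt0.
- exact: continuous_subspaceT.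
- have cf := der_cont df.
  split; first by move=> x _; case: (df x).
    by apply: cvg_at_right_filter; exact: cf.
  by apply: cvg_at_left_filter; exact: cf.
- by move=> x _; rewrite derive1E (@derive_val _ _ _ _ _ _ _ (df x)).
Qed.

Lemma cint_cst a : cint (fun=> a) = 2 * pi * a.
Proof.
rewrite (@cint_FTC (fun t => a * t - 0) (fun=> a)); first by ring.
- exact: der_affine.
- exact: (der_cont (der_cst a)).
Qed.

Lemma cint0 : cint (fun=> 0) = 0.
Proof. by rewrite cint_cst mulr0. Qed.

Lemma cint_sum (I : Type) (r : seq I) (P : pred I) (F : I -> R -> R) :
  (forall i, continuous (F i)) ->
  cint (fun t => \sum_(i <- r | P i) F i t) = \sum_(i <- r | P i) cint (F i).
Proof.
move=> cF; elim: r => [|i r IH].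
  by rewrite big_nil -[RHS]cint0; apply: eq_cint => t; rewrite big_nil.
rewrite big_cons -IH; case Pi : (P i).
  rewrite -cintD //; last exact: cont_sum.
  by apply: eq_cint => t; rewrite big_cons Pi.
by apply: eq_cint => t; rewrite big_cons Pi.
Qed.

Lemma cont_primitive f : continuous f -> exists F, der F f.
Proof.
move=> cf.
pose G (a x : R) := \int[lebesgue_measure]_(t in `[a, x]) f t.
have dG (a x : R) : a < x -> is_derive x 1 (G a) (f x).
  move=> ax; have [//||||d1 d2] := @continuous_FTC1_closed R f a x (x + 1).
  - by rewrite ltrDl.
  - exact: cont_integrable.
  - by [].
  - exact: cf.
  by split; [exact: d1|rewrite -derive1E d2].
have shiftG (a b x : R) : a <= b -> b <= x -> G a x = G a b + G b x.
  move=> ab bx; rewrite /G.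
  have := @Rintegral_itvB R f (BLeft a) (BRight x) b.
  rewrite (@Rintegral_itv_obnd_cbnd R b (BRight x)); last first.
    apply: (integrableS _ _ _ (cont_integrable b x cf)) => //.
    by apply: subset_itvr; rewrite bnd_simp.
  move=> <- //; first by rewrite addrC subrK.
  exact: cont_integrable.
(* The integral [G a x] differentiates to [f x] only for [a < x], so the base point moves with [x];
   subtracting the value at 0 makes the result independent of it. Near a given point the base point
   can be frozen, which is [FE]. *)
pose F x := G (- (`|x| + 1)) x - G (- (`|x| + 1)) 0.
exists F => x.
have FE (b y : R) : b < 0 -> b < y -> F y = G b y - G b 0.
  move=> b0 yb; rewrite /F; set a := - (`|y| + 1).
  have ay : a <= y by rewrite /a lerNl; have := ler_norm (- y); rewrite normrN; lra.
  have a0 : a <= 0 by rewrite /a; have := normr_ge0 y; lra.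
  have [ab|/ltW ba] := leP a b.
    by rewrite (@shiftG a b y)// ?(@shiftG a b 0)//; [ring|exact: ltW|exact: ltW].
  by rewrite (@shiftG b a y)// ?(@shiftG b a 0)//; ring.
pose b := - (`|x| + 2).
have b0 : b < 0 by rewrite /b; have := normr_ge0 x; lra.
have bx : b < x by rewrite /b; have := ler_norm (- x); rewrite normrN; lra.
have dFb : is_derive x 1 (fun y => G b y + - G b 0) (f x).
  apply: is_derive_eq.
    exact: (@is_deriveD _ _ _ _ (fun=> - G b 0) _ _ _ _ (dG b x bx) (is_derive_cst _ _ _)).
  by rewrite addr0.
apply: near_eq_is_derive dFb; near=> y.
rewrite (FE b) //; near: y.
exact: lt_nbhsr.
Unshelve. all: by end_near. Qed.

Definition per f := forall t, f (t + 2 * pi) = f t.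

Lemma cint_shift f a : continuous f -> per f -> cint (fun t => f (t + a)) = cint f.
Proof.
move=> cf pf; have [F dF] := cont_primitive cf.
have dFs (b : R) : der (fun t => F (t + b)) (fun t => f (t + b)).
  apply: (der_ext (der_comp dF (derD (@der_id R) (der_cst b)))) => // t.
  by rewrite addr0 mulr1.
have cfs : continuous (fun t => f (t + a)).
  by apply: cont_comp => //; exact: (der_cont (derD (@der_id R) (der_cst a))).
rewrite (cint_FTC dF cf) (cint_FTC (dFs a) cfs) !add0r.
have dD : der (fun t => F (t + 2 * pi) - F t) (fun=> 0).
  apply: (der_ext (derD (dFs (2 * pi)) (derZ (-1) dF))) => t; first by ring.
  by rewrite pf; ring.
have := der0_cst a 0 dD.
by rewrite add0r [2 * pi + a]addrC.
Qed.

(** A primitive is monotone on the period; if the integral vanished it would be constant there,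
    against the mean value theorem on a short interval with end point [t0], taken to the left when
    [t0] is the right end of the period. *)
Lemma cint_gt0 f t0 : continuous f -> (forall t, 0 <= t <= 2 * pi -> 0 <= f t) ->
  0 <= t0 <= 2 * pi -> 0 < f t0 -> 0 < cint f.
Proof.
move=> cf f0 ht0 ft0; have [F dF] := cont_primitive cf.
rewrite (cint_FTC dF cf) subr_gt0.
have mono a b : 0 <= a -> a <= b -> b <= 2 * pi -> F a <= F b.
  move=> a0 ab bp; rewrite -subr_ge0.
  have [c /andP[ac cb] ->] := der_mvt ab dF.
  by rewrite mulr_ge0 ?subr_ge0// f0// (le_trans a0 ac) (le_trans cb bp).
have p0 := twopi_gt0.
have le02 := mono 0 (2 * pi) (lexx _) (ltW p0) (lexx _).
rewrite lt_neqAle le02 andbT; apply/eqP => F02.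
have cst a : 0 <= a <= 2 * pi -> F a = F 0.
  move=> /andP[a0 ap]; apply/eqP.
  by rewrite eq_le (mono 0 a (lexx _) a0 ap) andbT F02 mono.
have [e /= e0 he] : \forall t \near t0, 0 < f t.
  by have := cf t0; move/cvgr_gt; apply.
have [a [b [ab0 a0 bp nab]]] : exists a b, [/\ a < b, 0 <= a, b <= 2 * pi &
    forall t, a <= t <= b -> `|t0 - t| < e].
  case/andP: ht0 => h1 h2.
  have [t0p|pt0] := ltP t0 (2 * pi).
    exists t0, (Num.min (t0 + e / 2) (2 * pi)); split => //.
    - by rewrite lt_min t0p ltrDl divr_gt0.
    - by rewrite ge_min lexx orbT.
    - move=> t /andP[ta]; rewrite le_min => /andP[te _].
      by rewrite distrC ger0_norm ?subr_ge0//; lra.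
  exists (Num.max 0 (t0 - e / 2)), t0; split => //.
  - by rewrite gt_max; apply/andP; split; lra.
  - by rewrite le_max lexx.
  - move=> t /andP[]; rewrite ge_max => /andP[_ ta] te.
    by rewrite ger0_norm ?subr_ge0//; lra.
have [c /andP[ac cb] h] := der_mvt (ltW ab0) dF.
have : 0 < f c * (b - a).
  by rewrite mulr_gt0 ?subr_gt0//; apply: he => /=; apply: nab; rewrite ac cb.
rewrite -h !cst ?subrr ?ltxx// ?(ltW (le_lt_trans a0 ab0)) ?bp ?a0//=.
exact: le_trans (ltW ab0) bp.
Qed.

Lemma cint_abs f B : continuous f -> (forall t, `|f t| <= B) ->
  `|cint f| <= 2 * pi * B.
Proof.
move=> cf fB; rewrite ler_norml -mulrN -(cint_cst (- B)) -(cint_cst B).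
apply/andP; split; apply: cint_le => //; try exact: cont_cst; move=> t _.
  by have := fB t; rewrite ler_norml => /andP[].
by have := fB t; rewrite ler_norml => /andP[].
Qed.

Lemma per_bounded f : continuous f -> per f -> exists B, forall t, `|f t| <= B.
Proof.
move=> cf pf.
have cnf : continuous (fun t => `|f t|) by move=> t; apply: cvg_norm; exact: cf.
have [c _ fc] := @EVT_max R (fun t => `|f t|) 0 (2 * pi) (ltW twopi_gt0)
  (continuous_subspaceT cnf).
have pn (n : nat) t : f (t + n%:R * (2 * pi)) = f t.
  elim: n => [|n IH]; first by rewrite mul0r addr0.
  by rewrite -natr1 mulrDl mul1r addrA pf.
exists `|f c| => t.
pose q := Num.floor (t / (2 * pi)).
have p0 := twopi_gt0.
have h1 : q%:~R * (2 * pi) <= t by rewrite -ler_pdivlMr// floor_le.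
have h2 : t < (q + 1)%:~R * (2 * pi) by rewrite -ltr_pdivrMr// floorD1_gt.
have -> : f t = f (t - q%:~R * (2 * pi)).
  case: q {h1 h2} => m; first by rewrite -[in RHS](pn m) subrK.
  by rewrite -(pn m.+1 t) NegzE mulrNz mulNr opprK.
apply: fc; rewrite in_itv/=; apply/andP; split; first by rewrite subr_ge0.
by move: h2; rewrite intrD mulrDl mul1r; lra.
Qed.
End CircleIntegral.

(** * Oscillations and the Fourier basis *)

Section Oscillations.
Variable R : realType.
Implicit Types (q b t : R) (f g : R -> R).

(** Phase form, so that cosine and sine are treated together: differentiation multiplies by [q] and
    turns the phase by a quarter period. *)
Definition osc q b t : R := cos (q * t - b).

Lemma cos_shift_int (z : int) (y : R) : cos (y + z%:~R * (2 * pi)) = cos y.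
Proof.
have pn (n : nat) (x : R) : cos (x + n%:R * (2 * pi)) = cos x.
  elim: n => [|n IH]; first by rewrite mul0r addr0.
  by rewrite -natr1 mulrDl mul1r addrA -[RHS]IH -[RHS]cosD2pi -[pi *+ 2]mulr_natl.
case: z => m; first exact: pn.
by rewrite -(pn m.+1 (y + _)) NegzE mulrNz mulNr subrK.
Qed.

Lemma osc_le1 q b t : `|osc q b t| <= 1.
Proof. exact: cos_max. Qed.

Lemma oscN q b : osc (- q) b = osc q (- b).
Proof. by apply/funext => t; rewrite /osc -[RHS]cosN; congr cos; ring. Qed.

Lemma osc0 b t : osc 0 b t = cos b.
Proof. by rewrite /osc mul0r sub0r cosN. Qed.

Lemma der_osc q b : der (osc q b) (fun t => q * osc q (b - pi / 2) t).
Proof.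
apply: (der_ext (der_comp (@der_cos R) (der_affine q b))) => // t.
have -> : osc q (b - pi / 2) t = cos ((q * t - b) + pi / 2).
  by rewrite /osc; congr cos; ring.
by rewrite cosDpihalf mulrC.
Qed.

Lemma cont_osc q b : continuous (osc q b).
Proof. exact: der_cont (der_osc q b). Qed.

Lemma osc_per (z : int) b : per (osc z%:~R b).
Proof.
by move=> t; rewrite /osc mulrDr addrAC cos_shift_int.
Qed.

Lemma oscM q b q' b' t :
  osc q b t * osc q' b' t = (osc (q - q') (b - b') t + osc (q + q') (b + b') t) / 2.
Proof.
rewrite /osc.
have -> : (q - q') * t - (b - b') = (q * t - b) - (q' * t - b') by ring.
have -> : (q + q') * t - (b + b') = (q * t - b) + (q' * t - b') by ring.
move: (q * t - b) (q' * t - b') => X Y.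
by rewrite cosB cosD; field.
Qed.

(** The substitution [y = x t] along a map of degree one, carried out on an explicit primitive. It
    makes the oscillations in the variable [x] orthogonal for the weight [x']. *)
Lemma cint_weight_osc (x x' : R -> R) (z : int) b : der x x' -> continuous x' ->
  x (2 * pi) = x 0 + 2 * pi ->
  cint (fun t => x' t * osc z%:~R b (x t)) = if z == 0 then 2 * pi * cos b else 0.
Proof.
move=> dx cx' x2.
have [->|z0] := eqVneq z 0.
  rewrite (@eq_cint _ _ (fun t => cos b * x' t)); last first.
    by move=> t; rewrite osc0 mulrC.
  by rewrite cintZ// (cint_FTC dx cx') x2 addrC addKr mulrC.
have zR : z%:~R != 0 :> R by rewrite intr_eq0.
have dF : der (fun t => z%:~R^-1 * osc z%:~R (b + pi / 2) (x t))
    (fun t => x' t * osc z%:~R b (x t)).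
  apply: (der_ext (derZ z%:~R^-1 (der_comp (der_osc z%:~R (b + pi / 2)) dx))) => // t.
  by rewrite addrK -!mulrA mulKf// mulrC.
rewrite (cint_FTC dF).
  by rewrite x2 osc_per subrr.
apply: contM => //; apply: cont_comp; last exact: cont_osc.
exact: der_cont dx.
Qed.

Lemma osc_orth (x x' : R -> R) (m m' : nat) b b' : der x x' -> continuous x' ->
  x (2 * pi) = x 0 + 2 * pi -> (0 < m)%N ->
  cint (fun t => x' t * (osc m%:R b (x t) * osc m'%:R b' (x t))) =
    if m == m' then pi * cos (b - b') else 0.
Proof.
move=> dx cx' x2 m0.
pose z1 : int := m%:Z - m'%:Z; pose z2 : int := m%:Z + m'%:Z.
have co z c : continuous (fun t => 2^-1 * (x' t * osc z c (x t))).
  apply: contZ; apply: contM => //; apply: cont_comp; last exact: cont_osc.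
  exact: der_cont dx.
have co' z c : continuous (fun t => x' t * osc z c (x t)).
  apply: contM => //; apply: cont_comp; last exact: cont_osc.
  exact: der_cont dx.
rewrite (@eq_cint _ _ (fun t => 2^-1 * (x' t * osc z1%:~R (b - b') (x t)) +
    2^-1 * (x' t * osc z2%:~R (b + b') (x t)))); last first.
  by move=> t; rewrite oscM /z1 /z2 intrB intrD -!pmulrn; field.
rewrite cintD// !cintZ// !(@cint_weight_osc x x')//.
have -> : (z2 == 0) = false by rewrite /z2; lia.
rewrite mulr0 addr0 /z1 subr_eq0 eqz_nat.
by case: eqP => _; [field|rewrite mulr0].
Qed.

Lemma cint_parts f f' (m : nat) b : der f f' -> continuous f' -> per f ->
  (0 < m)%N ->
  cint (fun t => f t * osc m%:R b t) =
  - (m%:R^-1) * cint (fun t => f' t * osc m%:R (b + pi / 2) t).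
Proof.
move=> df cf' pf m0.
have cf := der_cont df.
have c1 : continuous (fun t => f' t * osc m%:R (b + pi / 2) t).
  by apply: contM => //; exact: cont_osc.
have c2 : continuous (fun t => f t * osc m%:R b t).
  by apply: contM => //; exact: cont_osc.
have mR : m%:R != 0 :> R by rewrite pnatr_eq0 -lt0n.
have dF := derM df (der_osc m%:R (b + pi / 2)).
have e : (fun t => f' t * osc m%:R (b + pi / 2) t +
      f t * (m%:R * osc m%:R (b + pi / 2 - pi / 2) t)) =
    (fun t => f' t * osc m%:R (b + pi / 2) t + m%:R * (f t * osc m%:R b t)).
  by apply/funext => t; rewrite addrK; ring.
have := cint_FTC dF; rewrite e => h.
have {}h : _ = _ := h ltac:(apply: contD => //; exact: contZ).
move: h; rewrite cintD//; last exact: contZ.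
rewrite cintZ// -[X in f X](add0r (2 * pi)) pf.
have -> : osc m%:R (b + pi / 2) (2 * pi) = osc m%:R (b + pi / 2) 0.
  by rewrite -[X in osc _ _ X](add0r (2 * pi)) (osc_per m).
rewrite subrr => /eqP; rewrite addr_eq0 => /eqP ->.
by rewrite mulNr mulrN opprK mulKf.
Qed.

(** A smooth periodic function [F 0] presented together with all its derivatives. *)
Definition ptower (F : nat -> R -> R) :=
  (forall s, der (F s) (F s.+1)) /\ (forall s, per (F s)).

(** Each integration by parts gains a factor [1 / m] and turns the phase, so the bound has to be
    uniform in [b] for the induction; the frequency 0 is bounded separately. *)
Lemma ptower_decay F s : ptower F -> exists C, forall (m : nat) b,
  `|cint (fun t => F 0%N t * osc m%:R b t)| * (1 + m%:R) ^+ s <= C.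
Proof.
move=> [dF pF].
have cF k : continuous (F k) by exact: der_cont (dF k).
have cFo k q b : continuous (fun t => F k t * osc q b t).
  by apply: contM => //; exact: cont_osc.
have bd k : exists B, forall (m : nat) b, (0 < m)%N ->
    `|cint (fun t => F 0%N t * osc m%:R b t)| * m%:R ^+ k <= B.
  have [B FB] := per_bounded (cF k) (pF k).
  exists (2 * pi * B) => m b m0.
  have -> : `|cint (fun t => F 0%N t * osc m%:R b t)| * m%:R ^+ k =
      `|cint (fun t => F k t * osc m%:R (b + k%:R * (pi / 2)) t)|.
    elim: k b {B FB} => [|k IH] b; first by rewrite mulr1 mul0r addr0.
    rewrite exprSr mulrA IH (cint_parts _ (dF k))// normrM normrN normfV.
    have mR : m%:R != 0 :> R by rewrite pnatr_eq0 -lt0n.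
    rewrite (@ger0_norm _ (m%:R : R))// [_ * m%:R]mulrC mulVKf// -natr1.
    by congr `|cint _|; apply/funext => t; congr (_ * osc _ _ _); ring.
  apply: cint_abs => // t; rewrite normrM -[leRHS]mulr1.
  by apply: ler_pM => //; exact: osc_le1.
have [B hB] := bd s.
have [B0 hB0] := per_bounded (cF 0%N) (pF 0%N).
have B00 : 0 <= B0 by exact: le_trans (normr_ge0 _) (hB0 0).
have Bp : 0 <= `|B| by [].
exists (2 * pi * B0 + 2 ^+ s * `|B|) => m b.
have [->|m0] := posnP m.
  rewrite addr0 expr1n mulr1; apply: (@le_trans _ _ (2 * pi * B0)).
    apply: cint_abs => // t; rewrite normrM -[leRHS]mulr1.
    by apply: ler_pM => //; exact: osc_le1.
  by rewrite lerDl mulr_ge0// exprn_ge0.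
apply: (@le_trans _ _ (2 ^+ s * `|B|)); last first.
  by rewrite lerDr mulr_ge0// ltW// twopi_gt0.
apply: (@le_trans _ _ (2 ^+ s * (`|cint (fun t => F 0%N t * osc m%:R b t)| * m%:R ^+ s))).
  rewrite mulrCA ler_wpM2l// -exprMn.
  apply: lerXn2r; rewrite ?nnegrE ?addr_ge0 ?mulr_ge0//.
  by rewrite -[2]/(1 + 1) mulrDl mul1r lerD2r ler1n.
by rewrite ler_wpM2l ?exprn_ge0// (le_trans (hB m b m0))// ler_norm.
Qed.

End Oscillations.

Section FourierBasis.
Variable R : realType.
Implicit Types (i j : nat) (t : R) (f : R -> R).

(** The basis is enumerated as 1, sin t, cos t, sin 2t, cos 2t, and so on: an odd index is a sine, a
    positive even index a cosine. *)
Definition freq i : nat := uphalf i.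
Definition phase i : R := if odd i then pi / 2 else 0.
Definition fcos i t : R := osc (freq i)%:R (phase i) t.
(** The boundary value of the harmonic conjugate of the extension of [fcos i]; it is 0 for
    [i = 0]. *)
Definition fsin i t : R := osc (freq i)%:R (phase i + pi / 2) t.

Lemma freq_gt0 i : (0 < freq i)%N = (0 < i)%N.
Proof. by case: i => [|[|i]]. Qed.

Lemma fcos0 t : fcos 0 t = 1.
Proof. by rewrite /fcos osc0 cos0. Qed.

Lemma fcos_le1 i t : `|fcos i t| <= 1. Proof. exact: osc_le1. Qed.
Lemma cont_fcos i : continuous (fcos i). Proof. exact: cont_osc. Qed.
Lemma cont_fsin i : continuous (fsin i). Proof. exact: cont_osc. Qed.
Lemma per_fcos i : per (fcos i).
Proof. exact: (osc_per (freq i)). Qed.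

Lemma der_fcos i : der (fcos i) (fun t => - (freq i)%:R * fsin i t).
Proof.
apply: (der_ext (der_osc _ _)) => // t; rewrite /fsin /osc.
have -> : (freq i)%:R * t - (phase i - pi / 2) = ((freq i)%:R * t - (phase i + pi / 2)) + pi by field.
by rewrite cosDpi; ring.
Qed.

Lemma der_fsin i : der (fsin i) (fun t => (freq i)%:R * fcos i t).
Proof. by apply: (der_ext (der_osc _ _)) => // t; rewrite addrK. Qed.

Lemma phase_orth i j : freq i = freq j -> cos (phase i - phase j) = (i == j)%:R.
Proof.
rewrite /freq /phase => h; have [->|ij] := eqVneq i j; first by rewrite subrr cos0.
have : odd i != odd j.
  apply: contra ij => /eqP oij; apply/eqP.
  by move: h; rewrite !uphalf_half oij => /addnI h; rewrite -(odd_double_half i) -(odd_double_half j) oij h.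
by case: (odd i); case: (odd j) => // _; rewrite ?subr0 ?sub0r ?cosN cos_pihalf.
Qed.

Section Orthogonality.
Variables x x' : R -> R.
Hypotheses (dx : der x x') (cx' : continuous x') (x2 : x (2 * pi) = x 0 + 2 * pi).

Lemma fcos_orth i j : (0 < i)%N ->
  cint (fun t => x' t * (fcos i (x t) * fcos j (x t))) = pi * (i == j)%:R.
Proof.
move=> i0; rewrite (@osc_orth R x x')// ?freq_gt0//.
have [h|h] := eqVneq (freq i) (freq j); first by rewrite phase_orth.
by have [ij|_] := eqVneq i j; [rewrite ij eqxx in h|rewrite mulr0].
Qed.

Lemma fsin_orth i j : (0 < i)%N ->
  cint (fun t => x' t * (fsin i (x t) * fsin j (x t))) = pi * (i == j)%:R.
Proof.
move=> i0; rewrite (@osc_orth R x x')// ?freq_gt0//.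
have [h|h] := eqVneq (freq i) (freq j).
  by rewrite opprD addrACA subrr addr0 phase_orth.
by have [ij|_] := eqVneq i j; [rewrite ij eqxx in h|rewrite mulr0].
Qed.

End Orthogonality.

Definition fnorm i : R := if i == 0%N then 2 * pi else pi.

Lemma fnorm_gt0 i : 0 < fnorm i.
Proof. by rewrite /fnorm; case: ifP; rewrite ?twopi_gt0 ?pi_gt0. Qed.

Lemma cint_fcosM i j : cint (fun t => fcos i t * fcos j t) = fnorm i * (i == j)%:R.
Proof.
have h k l : (0 < k)%N -> cint (fun t => fcos k t * fcos l t) = pi * (k == l)%:R.
  move=> k0; rewrite -(@fcos_orth id (fun=> 1) (@der_id R) (@cont_cst _ _ 1) _ k l k0).
    by apply: eq_cint => t; rewrite mul1r.
  by rewrite add0r.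
case: i => [|i]; last by rewrite h.
case: j => [|j].
  rewrite (@eq_cint _ _ (fun=> 1)); first by rewrite cint_cst.
  by move=> t; rewrite fcos0 mulr1.
rewrite mulr0 -[RHS](mulr0 pi) -(h j.+1 0%N isT).
by apply: eq_cint => t; rewrite mulrC.
Qed.

Lemma osc_fcos (m : nat) b : exists a1 a2 : R, forall t,
  osc m%:R b t = a1 * fcos m.*2 t + a2 * fcos m.*2.-1 t.
Proof.
have E t : osc m%:R b t = cos b * cos (m%:R * t) + sin b * sin (m%:R * t).
  by rewrite /osc cosB mulrC [sin _ * _]mulrC.
have E1 t : fcos m.*2 t = cos (m%:R * t).
  by rewrite /fcos /freq /phase odd_double uphalf_double /osc subr0.
exists (cos b); case: m E E1 => [|m] E E1.
  by exists 0 => t; rewrite E E1 !mul0r sin0 mulr0.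
exists (sin b) => t; rewrite E E1; congr (_ + _ * _).
by rewrite /fcos /freq /phase doubleS /= odd_double /= doubleK /osc cosBpihalf.
Qed.

Lemma fourier_osc f : continuous f -> (forall i, cint (fun t => f t * fcos i t) = 0) ->
  forall (z : int) b, cint (fun t => f t * osc z%:~R b t) = 0.
Proof.
move=> cf f0.
have h (m : nat) b : cint (fun t => f t * osc m%:R b t) = 0.
  have [a1 [a2 E]] := osc_fcos m b.
  rewrite (@eq_cint _ _ (fun t => a1 * (f t * fcos m.*2 t) + a2 * (f t * fcos m.*2.-1 t))).
    rewrite cintD ?cintZ ?f0 ?mulr0 ?addr0//;
      repeat first [apply: contZ|apply: contM => //|exact: cont_fcos].
  by move=> t; rewrite E; ring.
case=> m b; first exact: h.
by rewrite NegzE mulrNz oscN; exact: h.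
Qed.

(* The polynomial kernel [(c + cos (t - pi)) ^+ N] exceeds 1 only near [pi],
   where it grows exponentially in [N]. *)
Lemma osc_complete f : continuous f -> per f ->
  (forall (z : int) b, cint (fun t => f t * osc z%:~R b t) = 0) -> f pi <= 0.
Proof.
move=> cf pf f0; rewrite leNgt; apply/negP => fpi.
have [dl /= dl0 hdl] : \forall t \near (pi : R), f pi / 2 < f t.
  by have := cf pi; move/cvgr_gt; apply; rewrite ltr_pdivrMr// ltr_pMr// ltr1n.
pose d := Num.min (dl / 2) pi.
have d0 : 0 < d by rewrite lt_min divr_gt0 ?pi_gt0.
have dpi : d <= pi by rewrite ge_min lexx orbT.
have ddl : d < dl by rewrite gt_min ltr_pdivrMr// ltr_pMr// ltr1n.
pose c := 1 - cos d; pose q t := c + osc 1 pi t.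
have cd1 : cos d < 1.
  rewrite -(@cos0 R) ltr_cos//; rewrite in_itv/= ?lexx ?pi_ge0// (ltW d0).
  by rewrite dpi.
have cq : continuous q by apply: contD; [exact: cont_cst|exact: cont_osc].
have cqN N : continuous (fun t => q t ^+ N).
  by apply: (cont_comp cq (h := fun y => y ^+ N)); exact: exprn_continuous.
have z0 N : forall (z : int) b, cint (fun t => f t * q t ^+ N * osc z%:~R b t) = 0.
  elim: N => [|N IH] z b.
    by rewrite -[RHS](f0 z b); apply: eq_cint => t; rewrite mulr1.
  have cc z' b' : continuous (fun t => f t * q t ^+ N * osc z' b' t).
    by apply: contM; [apply: contM|exact: cont_osc].
  rewrite (@eq_cint _ _ (fun t => c * (f t * q t ^+ N * osc z%:~R b t) +
     (2^-1 * (f t * q t ^+ N * osc (1 - z)%:~R (pi - b) t) +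
     2^-1 * (f t * q t ^+ N * osc (1 + z)%:~R (pi + b) t)))); last first.
    move=> t; rewrite exprSr {2}/q !mulrDr !mulrDl -!mulrA oscM !intrD mulrNz.
    by field.
  rewrite cintD ?cintD ?cintZ ?IH ?mulr0 ?addr0//;
    repeat first [exact: cc|apply: contZ|apply: contD].
have [S fS] := per_bounded cf pf.
have S0 : 0 <= S := le_trans (normr_ge0 _) (fS 0).
(* The positive part of [q - 1]. By Bernoulli's inequality [q ^+ N] is at least [N * h] where
   [q >= 1], so linear growth in [N] already contradicts the vanishing integrals. *)
pose h t := 2^-1 * (`|q t - 1| + (q t - 1)).
have ch : continuous h.
  have cq1 : continuous (fun t => q t - 1) by apply: contD => //; exact: cont_cst.
  by apply/contZ/contD => //; apply: (cont_comp cq1) => y; exact: norm_continuous.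
have key N t : 0 <= t <= 2 * pi -> f pi / 2 * N%:R * h t - S <= f t * q t ^+ N.
  move=> /andP[t0 tp].
  have q_ge : -1 <= q t.
    rewrite /q /c /osc; have := @cos_geN1 R (1 * t - pi); lra.
  have [q1|q1] := ltP (q t) 1.
    have -> : h t = 0 by rewrite /h ltr0_norm ?subr_lt0//; lra.
    have : `|f t * q t ^+ N| <= S.
      rewrite normrM normrX -[leRHS]mulr1 ler_pM// exprn_ile1//.
      by rewrite ler_norml q_ge ltW.
    by rewrite ler_norml => /andP[+ _]; lra.
  have -> : h t = q t - 1 by rewrite /h ger0_norm ?subr_ge0//; lra.
  have tdl : `|pi - t| < dl.
    apply: le_lt_trans ddl; rewrite leNgt; apply/negP => dt.
    suff : cos (t - pi) < cos d by move: q1; rewrite /q /c /osc mul1r; lra.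
    have pt : `|pi - t| \in `[0, pi] by rewrite in_itv/= normr_ge0 ler_norml; lra.
    have dI : d \in `[0, pi] by rewrite in_itv/= dpi ltW.
    by rewrite -[cos (t - pi)]cosN opprB -cos_norm ltr_cos.
  have ft : f pi / 2 <= f t by apply: ltW; exact: hdl.
  have bern : N%:R * (q t - 1) <= q t ^+ N - 1.
    elim: N => [|N IH]; first by rewrite mul0r expr0 subrr.
    have : 0 <= (q t - 1) * (q t ^+ N - 1).
      by rewrite mulr_ge0 ?subr_ge0// exprn_ege1.
    by rewrite -natr1 exprSr; move: IH; lra.
  have qN0 : 0 <= q t ^+ N by rewrite exprn_ge0// (le_trans ler01).
  have : f pi / 2 * (N%:R * (q t - 1)) <= f pi / 2 * q t ^+ N.
    by rewrite ler_wpM2l ?divr_ge0 ?ltW//; lra.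
  have : f pi / 2 * q t ^+ N <= f t * q t ^+ N by rewrite ler_wpM2r.
  by rewrite -mulrA; lra.
have Ih : 0 < cint h.
  apply: (@cint_gt0 _ _ pi) => //.
  - by move=> t _; rewrite /h; have := ler_norm (1 - q t); rewrite distrC; lra.
  - by rewrite pi_ge0 ler_peMl ?pi_ge0// ler1n.
  - rewrite /h /q /osc mul1r subrr cos0 /c ger0_norm; lra.
have bound N : f pi / 2 * cint h * N%:R <= 2 * pi * S.
  have : cint (fun t => f pi / 2 * N%:R * h t + - S) <= cint (fun t => f t * q t ^+ N).
    apply: cint_le => //.
    - by apply: contD; [exact: contZ|exact: cont_cst].
    - exact: contM.
    - exact: key.
  rewrite (cintD (contZ ch) (@cont_cst _ _ (- S))) (cintZ _ ch) cint_cst.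
  have -> : cint (fun t => f t * q t ^+ N) = 0.
    rewrite -[RHS](z0 N 0 0); apply: eq_cint => t.
    by rewrite osc0 cos0 mulr1.
  by lra.
have fh : 0 < f pi / 2 * cint h by rewrite mulr_gt0// divr_gt0.
have := archi_boundP (divr_ge0 (mulr_ge0 (ltW (twopi_gt0 R)) S0) (ltW fh)).
rewrite ltr_pdivrMr// ltNge => /negP; apply.
by rewrite mulrC; exact: bound.
Qed.

(** [osc_complete] is one-sided and located at [pi]: a translation brings any point there, and the
    opposite function gives the other inequality. *)
Lemma fourier_uniq f : continuous f -> per f ->
  (forall i, cint (fun t => f t * fcos i t) = 0) -> forall t, f t = 0.
Proof.
move=> cf pf f0 t0.
have half g : continuous g -> per g -> (forall i, cint (fun t => g t * fcos i t) = 0) ->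
    g t0 <= 0.
  move=> cg pg g0; pose a := t0 - pi.
  have csh : continuous (fun t => g (t + a)).
    by apply: cont_comp => //; exact: (der_cont (derD (@der_id R) (der_cst a))).
  have := @osc_complete (fun t => g (t + a)) csh _ _.
  rewrite /a [pi + _]addrC subrK; apply; first by move=> t; rewrite addrAC pg.
  move=> z b; rewrite -[RHS](fourier_osc cg g0 z (b + z%:~R * a)) -/a.
  rewrite -[RHS](@cint_shift _ _ a).
  - apply: eq_cint => t /=; congr (_ * _); rewrite /osc; congr cos; ring.
  - by apply: contM => //; exact: cont_osc.
  - by move=> t; rewrite pg osc_per.
apply/eqP; rewrite eq_le half//= -oppr_le0.
apply: (half (fun t => - f t)).
- by move=> t; apply: continuousN; exact: cf.
- by move=> t; rewrite pf.
- move=> i; rewrite (@eq_cint _ _ (fun t => -1 * (f t * fcos i t))).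
    by rewrite cintZ ?f0 ?mulr0//; apply: contM => //; exact: cont_fcos.
  by move=> t; ring.
Qed.

End FourierBasis.

(** * Finite-dimensional eigenvectors *)

Section FiniteDimensional.
Variable R : realType.

(** The vanishing of a first variation at a minimum. The test value [- b / (c + 1)] avoids the case
    [c = 0]. *)
Lemma quadratic_ge0_linear0 (b c : R) :
  (forall t, 0 <= 2 * t * b + t ^+ 2 * c) -> b = 0.
Proof.
move=> h.
have c0 : 0 <= c by have := h 1; have := h (-1); rewrite sqrrN expr1n; lra.
have c1 : c + 1 != 0 by rewrite gt_eqF// ltr_wpDl.
apply/eqP; rewrite -sqrf_eq0 eq_le sqr_ge0 andbT.
have := h (- b / (c + 1)).
have -> : 2 * (- b / (c + 1)) * b + (- b / (c + 1)) ^+ 2 * c =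
  - (b ^+ 2 * ((c + 2) / (c + 1) ^+ 2)) by field.
rewrite oppr_ge0 pmulr_lle0//.
by rewrite divr_gt0 ?exprn_gt0 ?ltr_wpDl.
Qed.

Section Forms.
Variable N : nat.
Implicit Types (A L : 'M[R]_N) (u v h : 'rV[R]_N).

Definition bform A u v : R := (u *m A *m v^T) 0 0.

Lemma bformE A u v : bform A u v = \sum_i \sum_j u 0 i * A i j * v 0 j.
Proof.
rewrite /bform mxE exchange_big /=; apply: eq_bigr => j _.
by rewrite !mxE mulr_suml.
Qed.

Lemma bformDl A u v h : bform A (u + v) h = bform A u h + bform A v h.
Proof. by rewrite /bform !mulmxDl mxE. Qed.

Lemma bformDr A u v h : bform A h (u + v) = bform A h u + bform A h v.
Proof. by rewrite /bform linearD mulmxDr mxE. Qed.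

Lemma bformZl A (a : R) u h : bform A (a *: u) h = a * bform A u h.
Proof. by rewrite /bform -!scalemxAl mxE. Qed.

Lemma bformZr A (a : R) u h : bform A h (a *: u) = a * bform A h u.
Proof. by rewrite /bform linearZ -scalemxAr mxE. Qed.

Lemma bformC A u v : A^T = A -> bform A u v = bform A v u.
Proof.
move=> sA; rewrite /bform.
have -> : v *m A *m u^T = (u *m A *m v^T)^T by rewrite !trmx_mul trmxK sA mulmxA.
by rewrite [RHS]mxE.
Qed.

Lemma bform_sqr A u h (t : R) : A^T = A ->
  bform A (u + t *: h) (u + t *: h) =
  bform A u u + 2 * t * bform A u h + t ^+ 2 * bform A h h.
Proof.
by move=> sA; rewrite !(bformDl, bformDr, bformZl, bformZr) (bformC h u sA); ring.
Qed.

Lemma cont_bform A : continuous (fun u => bform A u u).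
Proof.
have -> : (fun u => bform A u u) = fun u => \sum_i \sum_j u 0 i * A i j * u 0 j.
  by apply/funext => u; exact: bformE.
apply: cont_sum => i; apply: cont_sum => j; apply: contM; last exact: coord_continuous.
apply: contM; [exact: coord_continuous|exact: cont_cst].
Qed.

(** Minimise the form [L] over the [A]-unit vectors in the kernel of [B], a compact set by
    coercivity. The first variation gives an eigenvalue equation, but only against test vectors of
    that kernel. *)
Lemma min_eigen A L q (B : 'M[R]_(N, q)) (alpha : R) v :
  A^T = A -> L^T = L -> 0 < alpha ->
  (forall u, alpha * \sum_i (u 0 i) ^+ 2 <= bform A u u) ->
  v *m B = 0 -> v != 0 ->
  exists u, [/\ u *m B = 0, bform A u u = 1,
    bform L u u * bform A v v <= bform L v v &
    forall h, h *m B = 0 -> bform L u h = bform L u u * bform A u h].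
Proof.
move=> sA sL al0 coer vB v0.
have sumsq_gt0 u : u != 0 -> 0 < \sum_i (u 0 i) ^+ 2.
  move=> u0; rewrite lt0r sumr_ge0 ?andbT; last by move=> i _; exact: sqr_ge0.
  apply: contra u0 => /eqP /psumr_eq0P u0; apply/eqP/rowP => i; rewrite mxE.
  by apply/eqP; rewrite -sqrf_eq0 u0// => j _; exact: sqr_ge0.
have posA u : u != 0 -> 0 < bform A u u.
  by move=> u0; apply: lt_le_trans (coer u); rewrite mulr_gt0// sumsq_gt0.
(* The linear constraint is written through the form of [B *m B^T], so that both conditions are
   level sets of a continuous quadratic form. *)
pose S := [set u : 'rV[R]_N | bform (B *m B^T) u u = 0] `&` [set u | bform A u u = 1].
have BE u : bform (B *m B^T) u u = 0 <-> u *m B = 0.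
  rewrite /bform mulmxA -mulmxA -trmx_mul; split => [|->]; last by rewrite mul0mx mxE.
  rewrite mxE => /psumr_eq0P h; apply/rowP => i; rewrite [RHS]mxE.
  have h0 j : true -> 0 <= (u *m B) 0 j * (u *m B)^T j 0.
    by move=> _; rewrite [X in _ * X]mxE -expr2 sqr_ge0.
  by have /eqP := h h0 i isT; rewrite [X in _ * X == 0]mxE -expr2 sqrf_eq0 => /eqP.
have normS u : u *m B = 0 -> u != 0 -> S ((Num.sqrt (bform A u u))^-1 *: u).
  move=> uB u0; split; rewrite /= bformZl bformZr.
    by rewrite (BE u).2// !mulr0.
  rewrite mulrA -invfM -expr2 sqr_sqrtr ?ltW ?posA// mulVf//.
  by rewrite gt_eqF ?posA.
have S0 : S !=set0 by exists ((Num.sqrt (bform A v v))^-1 *: v); exact: normS.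
have cS : compact S.
  (* Coercivity bounds each squared entry by [alpha^-1], which is at most [b ^+ 2]; no square root
     is taken. *)
  pose b := 1 + alpha^-1.
  have cbox : compact [set u : 'rV[R]_N | forall i, u ord0 i \in `[- b, b]].
    apply: (@rV_compact _ _ (fun=> `[- b, b]%classic)) => _.
    exact: segment_compact.
  apply: subclosed_compact cbox _.
    have clos M c : closed [set u : 'rV[R]_N | bform M u u = c].
      have /continuous_closedP h := @cont_bform M; exact: (h _ (@closed_eq R c)).
    by apply: closedI; exact: clos.
  move=> u [_ /= u1] i.
  have : alpha * (u 0 i) ^+ 2 <= 1.
    rewrite -u1; apply: le_trans (coer u); rewrite ler_pM2l//.
    by rewrite (bigD1 i)//= lerDl sumr_ge0// => j _; exact: sqr_ge0.
  rewrite mulrC -ler_pdivlMr// div1r => ui.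
  have b1 : u 0 i ^+ 2 <= b ^+ 2.
    apply: (le_trans ui); rewrite /b sqrrD expr1n mul1r.
    by have : 0 < alpha^-1 by [rewrite invr_gt0]; have := sqr_ge0 alpha^-1; lra.
  have b0 : 0 <= b by rewrite /b addr_ge0// invr_ge0 ltW.
  by rewrite in_itv/= -ler_norml -(ler_sqr (normr_ge0 _) b0) real_normK ?num_real.
have [u /set_mem[/= /BE uB u1] minu] := EVT_min_rV S0 cS (continuous_subspaceT (@cont_bform L)).
have minW h : h *m B = 0 -> bform L u u * bform A h h <= bform L h h.
  move=> hB; have [->|h0] := eqVneq h 0; first by rewrite /bform !mul0mx !mxE mulr0.
  have := minu _ (mem_set (normS h hB h0)).
  rewrite bformZl bformZr mulrA -invfM -expr2 sqr_sqrtr ?(ltW (posA _ h0))//.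
  by rewrite [_^-1 * _]mulrC ler_pdivlMr ?posA.
exists u; split => //; first exact: minW.
move=> h hB; apply/subr0_eq.
apply: (@quadratic_ge0_linear0 _ (bform L h h - bform L u u * bform A h h)) => t.
have := minW (u + t *: h); rewrite mulmxDl -scalemxAl uB hB scaler0 addr0 => /(_ erefl).
by rewrite !bform_sqr// u1; lra.
Qed.

End Forms.

Section NewEigenvector.
Variables (N : nat) (A L : 'M[R]_N) (alpha : R) (D : pred 'I_N).
Hypotheses (sA : A^T = A) (sL : L^T = L) (al0 : 0 < alpha).
Hypothesis coer : forall u : 'rV[R]_N, alpha * \sum_i (u 0 i) ^+ 2 <= bform A u u.
Hypothesis blockA : forall i j, D i != D j -> A i j = 0.
Hypothesis blockL : forall i j, D i != D j -> L i j = 0.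

Definition supp (P : pred 'I_N) (u : 'rV[R]_N) := forall i, ~~ P i -> u 0 i = 0.

Lemma block_orth (M : 'M[R]_N) (u h : 'rV[R]_N) : (forall i j, D i != D j -> M i j = 0) ->
  supp D u -> supp (predC D) h -> bform M u h = 0.
Proof.
move=> bM Du Dh; rewrite bformE big1// => i _; rewrite big1// => j _.
have [Di|Di] := boolP (D i); last by rewrite Du// !mul0r.
have [Dj|Dj] := boolP (D j); first by rewrite (Dh j) ?mulr0//= negbK.
by rewrite bM ?mulr0 ?mul0r// Di (negbTE Dj).
Qed.

(** A constrained minimiser solves the full eigenvalue equation when the constraints come from
    eigenvectors and from a block decomposition. A test vector splits into its part outside [D],
    which both forms ignore, a combination of the rows of [P], to which the minimiser is orthogonal
    for both forms, and an admissible remainder. The vector [v] only serves to bound the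
    eigenvalue. *)
Lemma new_eigenvector d (P : 'M[R]_(d, N)) (S : 'rV[R]_d) (c : R) (v : 'rV[R]_N) :
  P *m A *m P^T = 1%:M -> P *m L = diag_mx S *m P *m A ->
  (forall a, supp D (row a P) \/ supp (predC D) (row a P)) ->
  supp D v -> v *m A *m P^T = 0 -> v != 0 -> bform L v v <= c * bform A v v ->
  exists (u : 'rV[R]_N) (s : R), [/\ supp D u, u *m A *m u^T = 1%:M, u *m A *m P^T = 0,
    u *m L = s *: (u *m A) & s <= c].
Proof.
move=> PP PL PD Dv vP v0 vc.
(* Encodes the support condition as a linear constraint, to be placed beside orthogonality to
   [P]. *)
pose K : 'M[R]_N := diag_mx (\row_i (~~ D i)%:R).
have KE u : u *m K = 0 <-> supp D u.
  split=> [h i Di|h].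
    by have := congr1 (fun w : 'rV_N => w 0 i) h; rewrite mul_mx_diag !mxE Di mulr1.
  apply/rowP => i; rewrite mul_mx_diag !mxE.
  by have [Di|Di] := boolP (D i); rewrite ?mulr0// h// mul0r.
pose B := row_mx (A *m P^T) K.
have BE u : u *m B = 0 <-> u *m A *m P^T = 0 /\ supp D u.
  rewrite mul_mx_row mulmxA; split=> [h|[-> /KE ->]]; last by rewrite row_mx0.
  have /eq_row_mx[h1 /KE h2] : row_mx (u *m A *m P^T) (u *m K) = row_mx 0 0.
    by rewrite h row_mx0.
  by [].
have [u [/BE[uP Du] u1 uv EL]] := min_eigen sA sL al0 coer ((BE v).2 (conj vP Dv)) v0.
have vA : 0 < bform A v v.
  apply: lt_le_trans (coer v); rewrite mulr_gt0// lt0r sumr_ge0 ?andbT; last first.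
    by move=> i _; exact: sqr_ge0.
  apply: contra v0 => /eqP /psumr_eq0P e; apply/eqP/rowP => i; rewrite mxE.
  by apply/eqP; rewrite -sqrf_eq0 e// => j _; exact: sqr_ge0.
exists u, (bform L u u); split => //.
- apply/matrixP => i j; rewrite !ord1 !mxE eqxx mulr1n -u1 /bform !mxE.
  by [].
- have uPL : u *m L *m P^T = 0.
    rewrite -[in u *m L]sL -mulmxA -trmx_mul PL -!mulmxA !trmx_mul sA tr_diag_mx !mulmxA.
    by rewrite uP mul0mx.
  have EL' h : bform L u h = bform L u u * bform A u h.
    pose h1 : 'rV[R]_N := \row_i (if D i then h 0 i else 0).
    pose h2 : 'rV[R]_N := \row_i (if D i then 0 else h 0 i).
    have -> : h = h1 + h2.
      by apply/rowP => i; rewrite !mxE; case: ifP => _; rewrite ?addr0 ?add0r.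
    have Dh1 : supp D h1 by move=> i Di; rewrite mxE (negbTE Di).
    have Dh2 : supp (predC D) h2 by move=> i /= Di; rewrite mxE; move: Di; rewrite negbK => ->.
    rewrite !bformDr (block_orth blockA Du Dh2) (block_orth blockL Du Dh2) !addr0.
    (* The coefficients of the [A]-orthogonal projection of [h1] on the rows of [P]. Rows supported
       off [D] get coefficient 0, so the remainder keeps its support in [D]. *)
    pose w := h1 *m A *m P^T.
    have Dw : supp D (h1 - w *m P).
      move=> i Di; rewrite !mxE (negbTE Di) sub0r big1 ?oppr0// => a _.
      have [PDa|PDa] := PD a.
        by have := PDa i Di; rewrite mxE => ->; rewrite mulr0.
      have -> : w 0 a = bform A h1 (row a P).
        by rewrite /w /bform [LHS]mxE [RHS]mxE; apply: eq_bigr => k _; congr (_ * _); rewrite !mxE.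
      by rewrite (block_orth blockA Dh1 PDa) mul0r.
    have wP : (h1 - w *m P) *m A *m P^T = 0.
      by rewrite !mulmxBl -!mulmxA [P *m _]mulmxA PP mulmx1 mulmxA subrr.
    have := EL _ ((BE _).2 (conj wP Dw)).
    have b0 (M : 'M[R]_N) : u *m M *m P^T = 0 -> bform M u (w *m P) = 0.
      by move=> uM; rewrite /bform trmx_mul mulmxA uM mul0mx mxE.
    have e (M : 'M[R]_N) : u *m M *m P^T = 0 -> bform M u (h1 - w *m P) = bform M u h1.
      by move=> uM; rewrite -scaleN1r bformDr bformZr b0// mulr0 addr0.
    by rewrite !e.
  apply/rowP => j; have := EL' (delta_mx 0 j).
  rewrite /bform trmx_delta -!colE !mxE => ->.
  by [].
- by rewrite -(ler_pM2r vA) (le_trans uv).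
Qed.

End NewEigenvector.

Lemma exists_kernel m q (C : 'M[R]_(m, q)) : (q < m)%N ->
  exists2 p : 'rV[R]_m, p != 0 & p *m C = 0.
Proof.
move=> qm; exists (nz_row (kermx C)).
  rewrite nz_row_eq0 -mxrank_eq0 mxrank_ker subn_eq0 -ltnNge.
  exact: leq_ltn_trans (rank_leq_col _) qm.
apply/sub_kermxP; exact: nz_row_sub.
Qed.

End FiniteDimensional.

(** * Series with an inverse-square majorant and Fourier series *)

Section Series.
Variable R : realType.
Implicit Types (a b : nat -> R) (S C D : R).

Lemma le_harmonic_eq0 (x D : R) : (forall N : nat, `|x| <= D / N.+1%:R) -> x = 0.
Proof.
move=> h; apply/eqP; rewrite -normr_le0 leNgt; apply/negP => x0.
have D0 : 0 <= D by have := h 0%N; rewrite divr1; apply: le_trans.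
have := archi_boundP (divr_ge0 D0 (ltW x0)); set N := Num.bound _.
rewrite ltr_pdivrMr// => DN; have := h N; rewrite ler_pdivlMr// leNgt => /negP; apply.
by apply: lt_le_trans DN _; rewrite mulrC ler_wpM2l// ler_nat.
Qed.

Lemma sum_inv_sqr_le (N M : nat) : (N <= M)%N ->
  \sum_(N <= i < M) (1 + i%:R)^-1 ^+ 2 <= 2 / N.+1%:R - 2 / M.+1%:R :> R.
Proof.
elim: M => [|M IH]; first by rewrite leqn0 => /eqP ->; rewrite big_geq// subrr.
rewrite leq_eqVlt => /orP[/eqP <-|]; first by rewrite big_geq// subrr.
rewrite ltnS => NM; rewrite big_nat_recr//=.
apply: le_trans (lerD (IH NM) (lexx _)) _.
have -> : (M.+2%:R : R) = M%:R + 2 by rewrite -addn2 natrD.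
rewrite -[M.+1%:R]natr1 [1 + _]addrC.
have m0 : 0 <= M%:R :> R by [].
move: (M%:R : R) m0 => m m0.
rewrite -subr_ge0 [X in 0 <= X](_ : _ = m / ((m + 1) ^+ 2 * (m + 2))).
  by rewrite divr_ge0// mulr_ge0 ?exprn_ge0 ?addr_ge0.
by field; rewrite nat1r pnatr_eq0 !gt_eqF ?ltr_wpDl.
Qed.

Lemma sum_inv_sqr_le2 (N : nat) : \sum_(i < N) (1 + i%:R)^-1 ^+ 2 <= 2 :> R.
Proof.
rewrite -(big_mkord xpredT (fun i => (1 + i%:R)^-1 ^+ 2 : R)).
apply: (le_trans (sum_inv_sqr_le (leq0n N))).
by rewrite divr1 gerBl divr_ge0.
Qed.

(** The sum of a series converging at rate [O(1/N)], the rate that an inverse-square majorant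
    provides. The rate is part of the definition so that sums are identified by estimating finite
    partial sums. *)
Definition ssum a : R :=
  get [set S | exists D, forall N : nat, `|S - \sum_(i < N) a i| <= D / N.+1%:R].

Lemma ssum_uniq a S D : (forall N : nat, `|S - \sum_(i < N) a i| <= D / N.+1%:R) ->
  ssum a = S.
Proof.
move=> h; rewrite /ssum; set P := (X in get X).
have [D' h'] : P (get P) by apply: getPex; exists S, D.
apply/subr0_eq/(@le_harmonic_eq0 _ (D' + D)) => N.
rewrite -(subrKA (\sum_(i < N) a i)) mulrDl; apply: le_trans (ler_normD _ _) _.
by rewrite lerD//; rewrite distrC.
Qed.

(** Domination by an inverse-square sequence, stronger than square summability. *)
Definition sq_summable C a := forall i : nat, `|a i| <= C * (1 + i%:R)^-1 ^+ 2.

Lemma sq_summable_ge0 C a : sq_summable C a -> 0 <= C.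
Proof. by move=> /(_ 0%N); rewrite addr0 invr1 expr1n mulr1; apply: le_trans. Qed.

Lemma sq_summable_tail C a (N M : nat) : sq_summable C a -> (N <= M)%N ->
  `|\sum_(i < M) a i - \sum_(i < N) a i| <= 2 * C / N.+1%:R - 2 * C / M.+1%:R.
Proof.
move=> aC NM; rewrite -!(big_mkord xpredT a) (@big_cat_nat _ _ _ N 0 M)//= addrAC subrr add0r.
apply: le_trans (ler_norm_sum _ _ _) _.
apply: (@le_trans _ _ (\sum_(N <= i < M) C * (1 + i%:R)^-1 ^+ 2)).
  by apply: ler_sum => i _; exact: aC.
rewrite -mulr_sumr [2 * C]mulrC -!mulrA -mulrBr.
by rewrite ler_wpM2l ?sum_inv_sqr_le// (sq_summable_ge0 aC).
Qed.

(** With [c N] the telescoped bound on the tail, every [p N - c N] lies below every [p M + c M]; the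
    supremum of the lower bounds is the sum. *)
Lemma ssum_tail C a N : sq_summable C a ->
  `|ssum a - \sum_(i < N) a i| <= 2 * C / N.+1%:R.
Proof.
move=> aC; have C0 := sq_summable_ge0 aC.
pose p N := \sum_(i < N) a i.
pose c (n : nat) := 2 * C / n.+1%:R.
have le_pq N1 N2 : p N1 - c N1 <= p N2 + c N2.
  have pos n : 0 <= c n by rewrite divr_ge0// mulr_ge0.
  have [N12|/ltnW N21] := leqP N1 N2.
    have := sq_summable_tail aC N12; rewrite -/(p N1) -/(p N2) -/(c N1) -/(c N2).
    by move: (c N1) (c N2) (pos N2) => c1 c2 c20; rewrite ler_norml => /andP[+ _]; lra.
  have := sq_summable_tail aC N21; rewrite -/(p N1) -/(p N2) -/(c N1) -/(c N2).
  by move: (c N1) (c N2) (pos N1) => c1 c2 c20; rewrite ler_norml => /andP[_]; lra.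
pose E := [set p N - c N | N in [set: nat]].
have hE : has_sup E.
  split; first by exists (p 0%N - c 0%N); exists 0%N.
  by exists (p 0%N + c 0%N) => _ [n _ <-]; exact: le_pq.
have tail n : `|sup E - p n| <= c n.
  rewrite ler_norml; apply/andP; split.
    have /(sup_upper_bound hE) : E (p n - c n) by exists n.
    by move: (c n) => c1; lra.
  have : sup E <= p n + c n.
    by apply: ge_sup; [case: hE|move=> _ [m _ <-]; exact: le_pq].
  by move: (c n) => c1; lra.
rewrite (ssum_uniq tail); exact: tail.
Qed.

Lemma ssum_le C a : sq_summable C a -> `|ssum a| <= 2 * C.
Proof. by move=> /(ssum_tail 0); rewrite big_ord0 subr0 divr1. Qed.

Lemma sq_summableD C a D b : sq_summable C a -> sq_summable D b ->
  sq_summable (C + D) (fun i => a i + b i).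
Proof.
by move=> aC bD i; rewrite mulrDl (le_trans (ler_normD _ _))// lerD.
Qed.

Lemma sq_summableZ C a (k : R) : sq_summable C a ->
  sq_summable (`|k| * C) (fun i => k * a i).
Proof. by move=> aC i; rewrite normrM -mulrA ler_wpM2l. Qed.

Lemma ssumD C a D b : sq_summable C a -> sq_summable D b ->
  ssum (fun i => a i + b i) = ssum a + ssum b.
Proof.
move=> aC bD; apply: (@ssum_uniq _ _ (2 * C + 2 * D)) => N.
rewrite big_split/= opprD addrACA mulrDl; apply: le_trans (ler_normD _ _) _.
by rewrite lerD//; exact: ssum_tail.
Qed.

Lemma ssumZ C a (k : R) : sq_summable C a -> ssum (fun i => k * a i) = k * ssum a.
Proof.
move=> aC; apply: (@ssum_uniq _ _ (`|k| * (2 * C))) => N.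
by rewrite -mulr_sumr -mulrBr normrM -mulrA ler_wpM2l//; exact: ssum_tail.
Qed.

Lemma ssum_finite a (N : nat) : (forall i, (N <= i)%N -> a i = 0) ->
  ssum a = \sum_(i < N) a i.
Proof.
move=> a0; pose B := \sum_(i < N) `|a i|.
apply: (@ssum_uniq _ _ (B * N.+1%:R)) => M.
have B0 : 0 <= B by apply: sumr_ge0.
have [NM|/ltnW MN] := leqP N M.
  suff -> : \sum_(i < M) a i = \sum_(i < N) a i by rewrite subrr normr0 divr_ge0// mulr_ge0.
  rewrite -!(big_mkord xpredT a) (@big_cat_nat _ _ _ N 0 M)//=.
  rewrite -[RHS]addr0; congr (_ + _); rewrite big_nat big1// => i /andP[Ni _].
  exact: a0.
apply: (@le_trans _ _ B).
  rewrite /B -!(big_mkord xpredT a) -(big_mkord xpredT (fun i => `|a i|)).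
  rewrite (@big_cat_nat _ _ _ M 0 N)//= (@big_cat_nat _ _ _ M 0 N _ (fun i => `|a i|))//=.
  rewrite addrAC subrr add0r (le_trans (ler_norm_sum _ _ _))// lerDr.
  by apply: sumr_ge0.
by rewrite ler_pdivlMr// ler_wpM2l// ler_nat ltnS.
Qed.

End Series.

Section UniformLimits.
Variable R : realType.

Lemma uniform_limit_cont (T : topologicalType) (f : nat -> T -> R) (g : T -> R) (D : R) :
  (forall n, continuous (f n)) ->
  (forall n t, `|g t - f n t| <= D / n.+1%:R) -> continuous g.
Proof.
move=> cf fg t.
have D0 : 0 <= D by have := fg 0%N t; rewrite divr1; apply: le_trans.
apply/cvgrPdist_le => e e0.
have e3 : 0 < e / 3 by rewrite divr_gt0.
pose n := Num.bound (D / (e / 3)).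
have Dn : D / n.+1%:R <= e / 3.
  have := archi_boundP (divr_ge0 D0 (ltW e3)); rewrite -/n.
  rewrite ltr_pdivrMr// => h; rewrite ler_pdivrMr// mulrC.
  by apply/ltW/(lt_le_trans h); rewrite ler_pM2r// ler_nat.
have := cf n t => /cvgrPdist_le /(_ _ e3); apply: filterS => s hs.
have -> : g t - g s = (g t - f n t) + (f n t - f n s) + (f n s - g s) by ring.
apply: le_trans (ler_normD _ _) _.
have := ler_normD (g t - f n t) (f n t - f n s).
have := le_trans (fg n t) Dn; have := le_trans (fg n s) Dn.
by rewrite (distrC (g s)); lra.
Qed.

Lemma uniform_limit_cint (f : nat -> R -> R) (g h : R -> R) (D B : R) :
  (forall n, continuous (f n)) -> continuous h -> (forall t, `|h t| <= B) ->
  (forall n t, `|g t - f n t| <= D / n.+1%:R) ->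
  forall n : nat, `|cint (fun t => g t * h t) - cint (fun t => f n t * h t)| <=
    2 * pi * (D * B) / n.+1%:R.
Proof.
move=> cf ch hB fg n.
have cg := uniform_limit_cont cf fg.
have -> : cint (fun t => g t * h t) - cint (fun t => f n t * h t) =
    cint (fun t => (g t + -1 * f n t) * h t).
  rewrite -[X in _ + X = _]mulN1r -cintZ; last exact: contM.
  rewrite -cintD; [|exact: contM|by apply: contZ; exact: contM].
  by apply: eq_cint => t; ring.
have -> : 2 * pi * (D * B) / n.+1%:R = 2 * pi * (D / n.+1%:R * B) by ring.
apply: cint_abs.
  by apply: contM => //; apply: contD => //; exact: contZ.
by move=> t; rewrite normrM mulN1r ler_pM//; exact: fg.
Qed.

End UniformLimits.

Section FourierSeries.
Variable R : realType.
Implicit Types (u : nat -> R) (t : R).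

Definition fseries u t : R := ssum (fun i => u i * fcos i t).

Lemma fseries_summable C u t : sq_summable C u -> sq_summable C (fun i => u i * fcos i t).
Proof.
move=> uC i; rewrite normrM -[leRHS]mulr1 ler_pM//; first exact: fcos_le1.
Qed.

Lemma fseries_tail C u n t : sq_summable C u ->
  `|fseries u t - \sum_(i < n) u i * fcos i t| <= 2 * C / n.+1%:R.
Proof. by move=> uC; apply: ssum_tail; exact: fseries_summable. Qed.

Lemma cont_fpoly u n : continuous (fun t => \sum_(i < n) u i * fcos i t).
Proof. by apply: cont_sum => i; apply: contZ; exact: cont_fcos. Qed.

Lemma cont_fseries C u : sq_summable C u -> continuous (fseries u).
Proof.
move=> uC; apply: (uniform_limit_cont (@cont_fpoly u)) => n t.
exact: fseries_tail uC.
Qed.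

Lemma per_fseries u : per (fseries u).
Proof.
by move=> t; rewrite /fseries; congr ssum; apply/funext => i; rewrite per_fcos.
Qed.

Lemma cint_fseries C u (h : R -> R) B : sq_summable C u -> continuous h ->
  (forall t, `|h t| <= B) ->
  cint (fun t => fseries u t * h t) = ssum (fun i => u i * cint (fun t => fcos i t * h t)).
Proof.
move=> uC ch hB; apply/esym/(@ssum_uniq _ _ _ (2 * pi * (2 * C * B))) => n.
have := uniform_limit_cint (@cont_fpoly u) ch hB (fun n t => fseries_tail n t uC) n.
congr (`|_ - _| <= _).
rewrite (@eq_cint _ _ (fun t => \sum_(i < n) u i * (fcos i t * h t))).
  rewrite cint_sum; last by move=> i; apply/contZ/contM => //; exact: cont_fcos.
  by apply: eq_bigr => i _; rewrite cintZ//; apply: contM => //; exact: cont_fcos.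
by move=> t; rewrite mulr_suml; apply: eq_bigr => i _; rewrite mulrA.
Qed.

Lemma fseries_coef C u j : sq_summable C u ->
  cint (fun t => fseries u t * fcos j t) = fnorm R j * u j.
Proof.
move=> uC; rewrite (cint_fseries uC (@cont_fcos R j) (fcos_le1 j)).
rewrite (@ssum_finite _ _ j.+1).
  rewrite big_ord_recr/= big1 ?add0r; last first.
    by move=> i _; rewrite cint_fcosM (ltn_eqF (ltn_ord i)) !mulr0.
  by rewrite cint_fcosM eqxx mulr1 mulrC.
by move=> i ji; rewrite cint_fcosM (gtn_eqF ji) !mulr0.
Qed.

(** Two integrations by parts make the coefficients inverse-square summable; the series then has the
    same coefficients as [v], and [fourier_uniq] identifies the two. *)
Lemma fourier_expansion (v v' v'' : R -> R) : der v v' -> der v' v'' ->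
  continuous v'' -> per v -> per v' -> per v'' ->
  exists C, let c i := cint (fun t => v t * fcos i t) / fnorm R i in
    sq_summable C c /\ fseries c = v.
Proof.
move=> dv dv' cv'' pv pv' pv''.
have cv := der_cont dv; have cv' := der_cont dv'.
have bnd (f : R -> R) (q b B : R) : continuous f -> (forall t, `|f t| <= B) ->
    `|cint (fun t => f t * osc q b t)| <= 2 * pi * B.
  move=> cf fB; apply: cint_abs.
    by apply: contM => //; exact: cont_osc.
  by move=> t; rewrite normrM -[leRHS]mulr1 ler_pM//; exact: osc_le1.
have [B0 hB0] : exists B : R, forall t, `|v t| <= B := per_bounded cv pv.
have [B2 hB2] : exists B : R, forall t, `|v'' t| <= B := per_bounded cv'' pv''.
have B00 : 0 <= B0 := le_trans (normr_ge0 _) (hB0 0).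
have B20 : 0 <= B2 := le_trans (normr_ge0 _) (hB2 0).
pose c i := cint (fun t => v t * fcos i t) / fnorm R i.
have p0 := twopi_gt0 R.
have fn i : `|(fnorm R i)^-1| <= 1.
  have f0 := fnorm_gt0 R i.
  rewrite ger0_norm ?invr_ge0 ?(ltW f0)// invf_le1// /fnorm; have := @pi_ge2 R.
  by case: ifP => _; lra.
(* The first summand covers the index 0; the factor 9 is the square of the 3 in
   [1 + i <= 3 * freq i], valid for [i > 0]. *)
have cC : sq_summable (2 * pi * B0 + 2 * pi * B2 * 9) c.
  move=> i; rewrite /c normrM; apply: (@le_trans _ _ `|cint (fun t => v t * fcos i t)|).
    by rewrite -[leRHS]mulr1 ler_wpM2l.
  case: i => [|i].
    rewrite addr0 invr1 expr1n mulr1; apply: (le_trans (bnd _ _ _ _ cv hB0)).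
    by rewrite lerDl !mulr_ge0// pi_ge0.
  rewrite /fcos (cint_parts _ dv)// (cint_parts _ dv')//.
  set q := (freq i.+1)%:R.
  have q0 : 0 < q by rewrite /q ltr0n.
  rewrite !normrM !normrN !(@ger0_norm _ q^-1) ?invr_ge0 ?(ltW q0)//.
  have iq : 1 + i.+1%:R <= 3 * q.
    rewrite /q nat1r -natrM ler_nat /freq uphalf_half.
    have := odd_double_half i.+1; lia.
  have i0 : 0 < 1 + i.+1%:R :> R by rewrite ltr_wpDr.
  apply: (@le_trans _ _ (q^-1 * (q^-1 * (2 * pi * B2)))).
    by rewrite !ler_wpM2l ?invr_ge0 ?(ltW q0)// bnd.
  apply: (@le_trans _ _ (2 * pi * B2 * 9 * (1 + i.+1%:R)^-1 ^+ 2)); last first.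
    rewrite ler_wpM2r ?exprn_ge0 ?invr_ge0 ?(ltW i0)//.
    by rewrite lerDr !mulr_ge0// pi_ge0.
  have -> : q^-1 * (q^-1 * (2 * pi * B2)) = 2 * pi * B2 * q^-1 ^+ 2 by ring.
  rewrite -!mulrA !ler_wpM2l ?pi_ge0//.
  have -> : 9 = 3 ^+ 2 :> R by ring.
  rewrite -exprMn lerXn2r ?nnegrE ?mulr_ge0 ?invr_ge0 ?(ltW i0) ?(ltW q0)//.
  by rewrite ler_pdivlMr// ler_pdivrMl// mulrC.
exists (2 * pi * B0 + 2 * pi * B2 * 9); split => //.
apply/funext => t; apply/eqP; rewrite -subr_eq0; apply/eqP.
have cs := cont_fseries cC.
pose g s := fseries c s + -1 * v s.
have -> : fseries c t - v t = g t by rewrite /g mulN1r.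
apply: fourier_uniq.
- by apply: contD => //; exact: contZ.
- by move=> s; rewrite /g per_fseries pv.
move=> i; rewrite (@eq_cint _ _ (fun s => fseries c s * fcos i s + -1 * (v s * fcos i s))).
  rewrite cintD; [|by apply: contM => //; exact: cont_fcos|
    by apply/contZ/contM => //; exact: cont_fcos].
  rewrite cintZ; last by apply: contM => //; exact: cont_fcos.
  by rewrite (fseries_coef i cC) /c mulrCA mulfV ?mulr1 ?gt_eqF ?fnorm_gt0// mulN1r subrr.
by move=> s; rewrite /g; ring.
Qed.

End FourierSeries.

Section Discriminant.
Variable R : realType.

Lemma discriminant_le (a b c : R) : 0 <= c ->
  (forall s, 0 <= a + 2 * s * b + s ^+ 2 * c) -> b ^+ 2 <= a * c.
Proof.
rewrite le_eqVlt => /predU1P[<-|c0] h.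
  rewrite mulr0; have [->|b0] := eqVneq b 0; first by rewrite expr0n.
  have := h (- (a + 1) / (2 * b)).
  have -> : a + 2 * (- (a + 1) / (2 * b)) * b + (- (a + 1) / (2 * b)) ^+ 2 * 0 = -1.
    by field.
  by rewrite lerNr oppr0 ler10.
have := h (- b / c).
have -> : a + 2 * (- b / c) * b + (- b / c) ^+ 2 * c = (a * c - b ^+ 2) / c.
  by field; rewrite gt_eqF.
by rewrite pmulr_lge0 ?invr_gt0// subr_ge0.
Qed.

Lemma sum_cauchy_schwarz (I : finType) (p q : I -> R) :
  (\sum_i p i * q i) ^+ 2 <= (\sum_i p i ^+ 2) * (\sum_i q i ^+ 2).
Proof.
apply: discriminant_le => [|s]; first by apply: sumr_ge0 => i _; exact: sqr_ge0.
rewrite !mulr_sumr -!big_split/=; apply: sumr_ge0 => i _.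
rewrite [X in 0 <= X](_ : _ = (p i + s * q i) ^+ 2) ?sqr_ge0//; ring.
Qed.

End Discriminant.

Lemma fsin_odd (R : realType) m (t : R) : fsin m.*2.+1 t = - fcos m.*2.+2 t.
Proof.
rewrite /fsin /fcos /osc /phase /freq /= negbK odd_double /= doubleK uphalf_double.
rewrite -[LHS](opprK) -cosDpi; congr (- cos _); by field.
Qed.

Lemma fsin_even (R : realType) m (t : R) : fsin m.*2.+2 t = fcos m.*2.+1 t.
Proof.
by rewrite /fsin /fcos /osc /phase /freq /= negbK odd_double /= doubleK uphalf_double add0r.
Qed.

(** * Galerkin approximation *)

Section Galerkin.
Variable R : realType.
Variable rho : R -> R.
Hypotheses (crho : continuous rho) (rho_gt0 : forall t, 0 < rho t).

Definition trig N (u : 'rV[R]_N) (t : R) : R := \sum_i u 0 i * fcos i t.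

(** The mass matrix of the boundary density. The truncated Steklov problem is
    [u *m stiff = e *: (u *m gram)]. *)
Definition gram N : 'M[R]_N :=
  \matrix_(i, j) cint (fun t => rho t * (fcos i t * fcos j t)).

(** The Dirichlet energy of the harmonic extension, diagonal in the Fourier basis. The common factor
    [pi] is correct at index 0 too, where the frequency vanishes. *)
Definition stiff N : 'M[R]_N := diag_mx (\row_i (pi * (freq i)%:R)).

Lemma cont_trig N (u : 'rV[R]_N) : continuous (trig u).
Proof. by apply: cont_sum => i; apply: contZ; exact: cont_fcos. Qed.

Lemma gram_sym N : (gram N)^T = gram N.
Proof.
apply/matrixP => i j; rewrite !mxE; apply: eq_cint => t; congr (_ * _).
exact: mulrC.
Qed.

Lemma stiff_sym N : (stiff N)^T = stiff N.
Proof. exact: tr_diag_mx. Qed.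

Lemma gramE N (u v : 'rV[R]_N) :
  bform (gram N) u v = cint (fun t => rho t * (trig u t * trig v t)).
Proof.
have ci (i j : 'I_N) : continuous (fun t => u 0 i * v 0 j * (rho t * (fcos i t * fcos j t))).
  by apply: contZ; apply: contM => //; apply: contM; exact: cont_fcos.
rewrite (@eq_cint _ _ (fun t => \sum_(i < N) \sum_(j < N)
    u 0 i * v 0 j * (rho t * (fcos i t * fcos j t)))).
  rewrite bformE cint_sum; last by move=> i; apply: cont_sum => j; exact: ci.
  apply: eq_bigr => i _; rewrite cint_sum; last by move=> j; exact: ci.
  apply: eq_bigr => j _; rewrite mxE cintZ; first by ring.
  by apply: contM => //; apply: contM; exact: cont_fcos.
move=> t; rewrite mulr_suml mulr_sumr; apply: eq_bigr => i _.
by rewrite !mulr_sumr; apply: eq_bigr => j _; ring.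
Qed.

Lemma stiffE N (u v : 'rV[R]_N) :
  bform (stiff N) u v = \sum_(i < N) pi * (freq i)%:R * (u 0 i * v 0 i).
Proof.
rewrite /bform mxE; apply: eq_bigr => i _.
by rewrite mul_mx_diag !mxE; ring.
Qed.

(** The constant is [pi] times the minimum of the density. Its independence of [N] is what later
    bounds the eigenvectors uniformly in the truncation. *)
Lemma gram_coercive : exists2 al : R, 0 < al &
  forall N (u : 'rV[R]_N), al * \sum_i (u 0 i) ^+ 2 <= bform (gram N) u u.
Proof.
have [c _ rc] := @EVT_min R rho 0 (2 * pi) (ltW (twopi_gt0 R)) (continuous_subspaceT crho).
exists (rho c * pi) => [|N u]; first by rewrite mulr_gt0// pi_gt0.
rewrite gramE; apply: (@le_trans _ _ (cint (fun t => rho c * (trig u t * trig u t)))).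
  have cu : continuous (fun t => trig u t * trig u t) by apply: contM; exact: cont_trig.
  rewrite cintZ// -mulrA ler_pM2l//.
  rewrite (@eq_cint _ _ (fun t => \sum_(i < N) \sum_(j < N) u 0 i * u 0 j * (fcos i t * fcos j t))).
    have ci (i j : 'I_N) : continuous (fun t => u 0 i * u 0 j * (fcos i t * fcos j t)).
      by apply: contZ; apply: contM; exact: cont_fcos.
    rewrite cint_sum; last by move=> i; apply: cont_sum => j; exact: ci.
    rewrite mulr_sumr; apply: ler_sum => i _.
    rewrite cint_sum; last by move=> j; exact: ci.
    rewrite (bigD1 i)//= big1 => [|j ij]; rewrite cintZ ?cint_fcosM; try by apply: contM; exact: cont_fcos.
      rewrite eqxx mulr1 addr0 -expr2 mulrC ler_wpM2l ?sqr_ge0// /fnorm.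
      by case: ifP => _; rewrite // ler_peMl ?pi_ge0// ler1n.
    by rewrite eq_sym (negbTE (_ : nat_of_ord j != i))// !mulr0.
  move=> t; rewrite mulr_suml; apply: eq_bigr => i _.
  by rewrite !mulr_sumr; apply: eq_bigr => j _; ring.
have cu : continuous (fun t => trig u t * trig u t) by apply: contM; exact: cont_trig.
apply: cint_le; [exact: contZ|exact: contM|move=> t tI].
by rewrite ler_wpM2r -?expr2 ?sqr_ge0// rc// in_itv.
Qed.

Lemma weighted_cauchy_schwarz (f g : R -> R) : continuous f -> continuous g ->
  cint (fun t => f t * (rho t * g t)) ^+ 2 <=
  cint (fun t => rho t * (f t * f t)) * cint (fun t => rho t * (g t * g t)).
Proof.
move=> cf cg.
have c1 : continuous (fun t => rho t * (f t * f t)).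
  by apply: contM => //; exact: contM.
have c2 : continuous (fun t => f t * (rho t * g t)).
  by apply: contM => //; exact: contM.
have c3 : continuous (fun t => rho t * (g t * g t)).
  by apply: contM => //; exact: contM.
apply: discriminant_le => [|s].
  rewrite -(cint0 R); apply: cint_le => // [|t _]; first exact: cont_cst.
  by rewrite -expr2 mulr_ge0 ?sqr_ge0// ltW.
rewrite -(cintZ _ c2) -(cintZ _ c3) -(cintD c1 (contZ c2)).
rewrite -cintD; [|by apply: contD => //; exact: contZ|exact: contZ].
rewrite -(cint0 R); apply: cint_le; [exact: cont_cst| |].
  by apply: contD; [apply: contD => //|]; exact: contZ.
move=> t _; rewrite [X in 0 <= X](_ : _ = rho t * (f t + s * g t) ^+ 2); last by ring.
by rewrite mulr_ge0 ?sqr_ge0// ltW.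
Qed.

Definition coefs N (v : R -> R) : 'rV[R]_N :=
  \row_i (cint (fun t => v t * fcos i t) / fnorm R i).
(* In the basis [fcos], the harmonic conjugate. *)
Definition vconj N (v : R -> R) : 'rV[R]_N :=
  \row_i (- cint (fun t => v t * fsin i t) / pi).

(** Conjugation exchanges the sine and cosine coefficients of a frequency up to sign, and the energy
    weighs both equally. The odd size [K.*2.+1] keeps both members of every pair. *)
Lemma conj_energy K (v : R -> R) : continuous v ->
  bform (stiff K.*2.+1) (coefs _ v) (coefs _ v) =
  bform (stiff K.*2.+1) (vconj _ v) (vconj _ v).
Proof.
move=> cv; rewrite !stiffE.
under eq_bigr do rewrite !mxE.
under [RHS]eq_bigr do rewrite !mxE.
elim: K => [|K IH]; first by rewrite !big_ord1 /freq /= !mulr0 !mul0r.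
rewrite doubleS !(big_ord_recr K.*2.+2) !(big_ord_recr K.*2.+1)/= {}IH -!addrA; congr (_ + _).
have -> : cint (fun t => v t * fsin K.*2.+1 t) = - cint (fun t => v t * fcos K.*2.+2 t).
  rewrite -mulN1r -cintZ; last by apply: contM => //; exact: cont_fcos.
  by apply: eq_cint => t; rewrite fsin_odd; ring.
have -> : cint (fun t => v t * fsin K.*2.+2 t) = cint (fun t => v t * fcos K.*2.+1 t).
  by apply: eq_cint => t; rewrite fsin_even.
rewrite /freq /= doubleK uphalf_double /fnorm /=; ring.
Qed.

(* Integration by parts turns the energy of the conjugate [W] into [- int W v'];
   Cauchy-Schwarz then compares it with weighted norms of [W] and [v']. *)
Lemma conj_energy_le N (v g : R -> R) (a : R) :
  der v (fun t => rho t * g t) -> continuous g -> per v ->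
  bform (stiff N.+1) (vconj _ v) (vconj _ v) ^+ 2 <=
  bform (gram N.+1) (vconj _ v + a *: delta_mx 0 0) (vconj _ v + a *: delta_mx 0 0) *
  cint (fun t => rho t * (g t * g t)).
Proof.
move=> dv cg pv; have cv := der_cont dv.
set w := vconj _ v; set w' := w + _.
rewrite gramE; apply: le_trans (weighted_cauchy_schwarz (@cont_trig _ w') cg).
have crg : continuous (fun t => rho t * g t) by exact: contM.
suff -> : cint (fun t => trig w' t * (rho t * g t)) = - bform (stiff N.+1) w w.
  by rewrite sqrrN.
have parts i : cint (fun t => fcos i t * (rho t * g t)) =
    (freq i)%:R * cint (fun t => v t * fsin i t).
  have c1 : continuous (fun t => fcos i t * (rho t * g t)) by apply: contM => //; exact: cont_fcos.
  have c2 : continuous (fun t => v t * fsin i t) by apply: contM => //; exact: cont_fsin.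
  apply/eqP; rewrite -subr_eq0 -mulNr -(cintZ _ c2) -(cintD c1 (contZ c2)).
  rewrite (@eq_cint _ _ (fun t => (- (freq i)%:R * fsin i t) * v t + fcos i t * (rho t * g t))).
    rewrite (cint_FTC (derM (der_fcos i) dv)).
      by rewrite -[X in fcos i X](add0r (2 * pi)) -[X in v X](add0r (2 * pi)) pv per_fcos subrr.
    apply: contD => //; apply: contM => //; apply: contZ; exact: cont_fsin.
  by move=> t; ring.
rewrite (@eq_cint _ _ (fun t => \sum_(i < N.+1) w' 0 i * (fcos i t * (rho t * g t)))).
  rewrite cint_sum => [|i]; last by apply: contZ; apply: contM => //; exact: cont_fcos.
  rewrite stiffE -sumrN; apply: eq_bigr => i _.
  rewrite cintZ; last by apply: contM => //; exact: cont_fcos.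
  rewrite parts /w' /w !mxE eqxx.
  (* At index 0 the frequency vanishes, so the multiple [a] of the constant may be arbitrary. *)
  have [->|i0] := eqVneq i 0; first by rewrite /freq /=; ring.
  rewrite /= mulr0 addr0; move: (lt0r_neq0 (pi_gt0 R)); move: (pi : R) => q q0; by field.
by move=> t; rewrite /trig mulr_suml; apply: eq_bigr => i _; rewrite -mulrA.
Qed.

End Galerkin.

(** * Rotation characters and trial functions in arc length *)

Section ShiftOrthogonality.
Variables (R : realType) (tau : R).
Implicit Types f g h w : R -> R.

Lemma cont_shift f c : continuous f -> continuous (fun t => f (t + c)).
Proof.
by move=> cf; apply: cont_comp => //; exact: (der_cont (derD (@der_id R) (der_cst c))).
Qed.

Lemma cint_shift_weight w f g c : continuous w -> continuous f -> continuous g ->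
  per w -> per f -> per g -> (forall t, w (t + c) = w t) ->
  cint (fun t => w t * (f (t + c) * g t)) = cint (fun t => w t * (f t * g (t - c))).
Proof.
move=> cw cf cg pw pf pg wc; rewrite -[RHS](@cint_shift _ _ c).
- by apply: eq_cint => t; rewrite wc addrK.
- by apply: contM => //; apply: contM => //; exact: cont_shift.
- by move=> t; rewrite pw pf; congr (_ * (_ * _)); rewrite addrAC pg.
Qed.

(** For an invariant weight the sum of the shifts by [tau] and [- tau] is a self-adjoint operator,
    and eigenfunctions with distinct eigenvalues are orthogonal. Using the sum keeps the
    decomposition by characters real. *)
Lemma shift_orth w f g (a b : R) : continuous w -> continuous f -> continuous g ->
  per w -> per f -> per g -> (forall t, w (t + tau) = w t) ->
  (forall t, f (t + tau) + f (t - tau) = a * f t) ->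
  (forall t, g (t + tau) + g (t - tau) = b * g t) -> a != b ->
  cint (fun t => w t * (f t * g t)) = 0.
Proof.
move=> cw cf cg pw pf pg wtau fa gb ab.
have cwfg h k : continuous h -> continuous k -> continuous (fun t => w t * (h t * k t)).
  by move=> ch ck; apply: contM => //; exact: contM.
have wtauN t : w (t - tau) = w t by rewrite -[in RHS](subrK tau t) wtau.
have s1 := cint_shift_weight cw cf cg pw pf pg wtau.
have s2 := cint_shift_weight cw cf cg pw pf pg wtauN; rewrite opprK in s2.
have ea : a * cint (fun t => w t * (f t * g t)) =
    cint (fun t => w t * (f (t + tau) * g t)) + cint (fun t => w t * (f (t - tau) * g t)).
  rewrite -cintZ; last exact: cwfg.
  rewrite -cintD; [|by apply: cwfg => //; exact: cont_shift..].
  apply: eq_cint => t.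
  have -> : a * (w t * (f t * g t)) = w t * ((a * f t) * g t) by ring.
  by rewrite -fa; ring.
have eb : b * cint (fun t => w t * (f t * g t)) =
    cint (fun t => w t * (f t * g (t - tau))) + cint (fun t => w t * (f t * g (t + tau))).
  rewrite -cintZ; last exact: cwfg.
  rewrite -cintD; [|by apply: cwfg => //; exact: cont_shift..].
  apply: eq_cint => t.
  have -> : b * (w t * (f t * g t)) = w t * (f t * (b * g t)) by ring.
  by rewrite -gb; ring.
have /eqP : (a - b) * cint (fun t => w t * (f t * g t)) = 0.
  by rewrite mulrBl ea eb s1 s2 subrr.
by rewrite mulf_eq0 subr_eq0 (negbTE ab) => /eqP.
Qed.

End ShiftOrthogonality.

Section Trial.
Variable R : realType.
Variables (rho rho' x : R -> R) (tau kappa : R).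
Hypotheses (drho : der rho rho') (crho' : continuous rho').
Hypotheses (prho : per rho) (prho' : per rho') (rho_gt0 : forall t, 0 < rho t).
Hypothesis rho_tau : forall t, rho (t + tau) = rho t.
Hypotheses (kappa_gt0 : 0 < kappa) (dx : der x (fun t => kappa * rho t)).
Hypothesis x_per : forall t, x (t + 2 * pi) = x t + 2 * pi.
Hypothesis x_tau : forall t, x (t + tau) = x t + tau.

Let crho : continuous rho := der_cont drho.
Let cx : continuous x := der_cont dx.

(** The condition [freq i = +-1] modulo [n], expressed as equality of eigenvalues of the symmetric
    shift operator. *)
Definition resonant (i : nat) : bool := cos ((freq i)%:R * tau) == cos tau.

Lemma osc_tau (q b t : R) : osc q b (t + tau) + osc q b (t - tau) = 2 * cos (q * tau) * osc q b t.
Proof.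
rewrite /osc; have -> : q * (t + tau) - b = (q * t - b) + q * tau by ring.
have -> : q * (t - tau) - b = (q * t - b) - q * tau by ring.
move: (q * t - b) => y.
by rewrite cosD cosB; ring.
Qed.

Lemma x_tauN t : x (t - tau) = x t - tau.
Proof. by rewrite -[in RHS](subrK tau t) x_tau addrK. Qed.

Lemma osc_x_tau (q b t : R) :
  osc q b (x (t + tau)) + osc q b (x (t - tau)) = 2 * cos (q * tau) * osc q b (x t).
Proof. by rewrite x_tau x_tauN osc_tau. Qed.

Lemma resonant_neq i j : resonant i != resonant j ->
  2 * cos ((freq i)%:R * tau) != 2 * cos ((freq j)%:R * tau).
Proof.
apply: contra => /eqP/(@mulfI _ _ (_ : 2 != 0 :> R)) h.
by rewrite /resonant h.
Qed.

Lemma gram_block N (i j : 'I_N) : resonant i != resonant j -> gram rho N i j = 0.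
Proof.
move=> ij; rewrite mxE.
apply: (shift_orth crho _ _ prho _ _ rho_tau (osc_tau _ _) (osc_tau _ _) (resonant_neq ij)).
- exact: cont_osc.
- exact: cont_osc.
- exact: (osc_per (freq i)).
- exact: (osc_per (freq j)).
Qed.

Lemma stiff_block N (i j : 'I_N) : resonant i != resonant j -> stiff R N i j = 0.
Proof.
move=> ij; rewrite !mxE; case: eqP => [e|_]; last by rewrite mulr0n.
by rewrite e eqxx in ij.
Qed.

Definition tfun i t : R := fcos i (x t).

Lemma cont_tfun i : continuous (tfun i).
Proof. by apply: cont_comp; [exact: cx|exact: cont_fcos]. Qed.

Lemma per_tfun i : per (tfun i).
Proof. by move=> t; rewrite /tfun x_per per_fcos. Qed.

Lemma der_tfun i :
  der (tfun i) (fun t => rho t * (kappa * (- (freq i)%:R * fsin i (x t)))).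
Proof.
by apply: (der_ext (der_comp (der_fcos i) dx)) => // t; ring.
Qed.

Lemma tfun_expansion i : exists C, sq_summable C (fun j => cint (fun t => tfun i t * fcos j t) / fnorm R j)
  /\ fseries (fun j => cint (fun t => tfun i t * fcos j t) / fnorm R j) = tfun i.
Proof.
have dfs : der (fun t => fsin i (x t)) (fun t => (freq i)%:R * fcos i (x t) * (kappa * rho t)).
  exact: (der_comp (der_fsin i) dx).
have dv' := derM drho (derZ kappa (derZ (- (freq i)%:R) dfs)).
have cfs : continuous (fun t => fsin i (x t)) by apply: (der_cont dfs).
have ctf := @cont_tfun i.
have pfs : per (fun t => fsin i (x t)).
  by move=> t; rewrite x_per /fsin (osc_per (freq i)).
apply: (fourier_expansion (@der_tfun i) dv').
- apply: contD; apply: contM => //; do 2 apply: contZ => //.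
  by apply: contM; [exact: contZ|exact: contZ].
- exact: per_tfun.
- by move=> t; rewrite prho pfs.
- by move=> t; rewrite prho prho' pfs x_per per_fcos.
Qed.

Section TrialSpace.
Variables (nb m : nat) (idx : 'I_nb -> nat).
Hypotheses (idx_inj : injective idx) (idx_gt0 : forall b, (0 < idx b)%N).
Hypothesis idx_freq : forall b, (freq (idx b) <= m)%N.
Implicit Types p : 'rV[R]_nb.

Definition tcomb p t : R := \sum_(b < nb) p 0 b * tfun (idx b) t.
(** The derivative of [tcomb p] with the factor [rho] removed, the form in which integration by
    parts and the weighted Cauchy-Schwarz inequality consume it. *)
Definition tslope p t : R :=
  \sum_(b < nb) p 0 b * (kappa * (- (freq (idx b))%:R * fsin (idx b) (x t))).

Lemma cont_tcomb p : continuous (tcomb p).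
Proof. by apply: cont_sum => b; apply: contZ; exact: cont_tfun. Qed.

Lemma cont_tslope p : continuous (tslope p).
Proof.
apply: cont_sum => b; do 3 apply: contZ.
by apply: cont_comp; [exact: cx|exact: cont_fsin].
Qed.

Lemma per_tcomb p : per (tcomb p).
Proof. by move=> t; apply: eq_bigr => b _; rewrite per_tfun. Qed.

Lemma der_tcomb p : der (tcomb p) (fun t => rho t * tslope p t).
Proof.
apply: (der_ext (der_sum (index_enum _) xpredT (fun b => derZ (p 0 b) (@der_tfun (idx b))))) => // t.
by rewrite /tslope mulr_sumr; apply: eq_bigr => b _; ring.
Qed.

Lemma cint_rho_sqr (f : nat -> R -> R) (q : 'I_nb -> R) (nu : R) :
  (forall i, continuous (f i)) ->
  (forall i j, (0 < i)%N -> cint (fun t => rho t * (f i t * f j t)) = nu * (i == j)%:R) ->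
  cint (fun t => rho t * ((\sum_b q b * f (idx b) t) * (\sum_b q b * f (idx b) t))) =
  nu * \sum_b q b ^+ 2.
Proof.
move=> cf orth.
have cff i j : continuous (fun t => rho t * (f i t * f j t)).
  by apply: contM => //; exact: contM.
rewrite (@eq_cint _ _ (fun t => \sum_(a < nb) \sum_(b < nb)
    q a * q b * (rho t * (f (idx a) t * f (idx b) t)))).
  rewrite cint_sum; last by move=> a; apply: cont_sum => b; apply: contZ; exact: cff.
  rewrite mulr_sumr; apply: eq_bigr => a _.
  rewrite cint_sum; last by move=> b; apply: contZ; exact: cff.
  rewrite (bigD1 a)//= big1 => [|b ba].
    by rewrite cintZ// (orth _ _ (idx_gt0 a)) eqxx mulr1; ring.
  rewrite cintZ// (orth _ _ (idx_gt0 a)); case: eqP => [e|_]; last by rewrite !mulr0.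
  by rewrite (idx_inj e) eqxx in ba.
move=> t; rewrite mulr_suml mulr_sumr; apply: eq_bigr => a _.
by rewrite !mulr_sumr; apply: eq_bigr => b _; ring.
Qed.

Lemma rho_orth (f : nat -> R -> R) : (forall i, continuous (f i)) ->
  (forall i j, (0 < i)%N -> cint (fun t => kappa * rho t * (f i t * f j t)) = pi * (i == j)%:R) ->
  forall i j, (0 < i)%N -> cint (fun t => rho t * (f i t * f j t)) = pi / kappa * (i == j)%:R.
Proof.
move=> cf orth i j i0; rewrite mulrAC -orth// -[LHS](mulKf (lt0r_neq0 kappa_gt0)) -cintZ.
  by rewrite mulrC; congr (_ / _); apply: eq_cint => t; ring.
by apply: contM => //; exact: contM.
Qed.

Let ckrho : continuous (fun t => kappa * rho t).
Proof. exact: contZ. Qed.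

Let x2pi : x (2 * pi) = x 0 + 2 * pi.
Proof. by rewrite -x_per add0r. Qed.

Lemma tcomb_norm p : cint (fun t => rho t * (tcomb p t * tcomb p t)) =
  pi / kappa * \sum_b (p 0 b) ^+ 2.
Proof.
apply: (@cint_rho_sqr tfun (fun b => p 0 b)); first exact: cont_tfun.
by apply: rho_orth => [|i j i0]; [exact: cont_tfun|exact: fcos_orth dx ckrho x2pi i j i0].
Qed.

(** In arc length the density is constant up to [kappa], so sines and cosines are orthogonal for the
    weight and differentiation is diagonal, with factors at most [kappa * m]. *)
Lemma tslope_norm p : cint (fun t => rho t * (tslope p t * tslope p t)) <=
  (kappa * m%:R) ^+ 2 * cint (fun t => rho t * (tcomb p t * tcomb p t)).
Proof.
have cfs i : continuous (fun t => fsin i (x t)).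
  by apply: cont_comp; [exact: cx|exact: cont_fsin].
have -> : tslope p = (fun t => \sum_b (p 0 b * (kappa * - (freq (idx b))%:R)) * fsin (idx b) (x t)).
  by apply/funext => t; apply: eq_bigr => b _; ring.
rewrite (@cint_rho_sqr (fun i t => fsin i (x t)) _ (pi / kappa) cfs); last first.
  by apply: rho_orth => // i j i0; exact: fsin_orth dx ckrho x2pi i j i0.
rewrite tcomb_norm mulrCA ler_wpM2l ?divr_ge0 ?pi_ge0 ?(ltW kappa_gt0)//.
rewrite mulr_sumr; apply: ler_sum => b _.
rewrite exprMn mulrC ler_wpM2r ?sqr_ge0// !exprMn sqrrN ler_wpM2l ?sqr_ge0//.
by rewrite lerXn2r ?nnegrE// ler_nat.
Qed.

Lemma coefs_tcomb N p : coefs N (tcomb p) = p *m (\matrix_b coefs N (tfun (idx b))).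
Proof.
apply/rowP => j; rewrite !mxE.
rewrite (@eq_cint _ _ (fun t => \sum_(b < nb) p 0 b * (tfun (idx b) t * fcos j t))).
  rewrite cint_sum => [|b]; last first.
    by apply: contZ; apply: contM; [exact: cont_tfun|exact: cont_fcos].
  rewrite mulr_suml; apply: eq_bigr => b _; rewrite !mxE cintZ ?mulrA//.
  by apply: contM; [exact: cont_tfun|exact: cont_fcos].
by move=> t; rewrite mulr_suml; apply: eq_bigr => b _; rewrite mulrA.
Qed.

Lemma vconj_tcomb N p : vconj N (tcomb p) = p *m (\matrix_b vconj N (tfun (idx b))).
Proof.
apply/rowP => j; rewrite !mxE.
rewrite (@eq_cint _ _ (fun t => \sum_(b < nb) p 0 b * (tfun (idx b) t * fsin j t))).
  rewrite cint_sum => [|b]; last first.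
    by apply: contZ; apply: contM; [exact: cont_tfun|exact: cont_fsin].
  rewrite -sumrN mulr_suml; apply: eq_bigr => b _; rewrite !mxE cintZ; first by ring.
  by apply: contM; [exact: cont_tfun|exact: cont_fsin].
by move=> t; rewrite mulr_suml; apply: eq_bigr => b _; rewrite mulrA.
Qed.

Lemma tcomb_approx : exists2 E : R, 0 <= E & forall N p t,
  (tcomb p t - trig (coefs N (tcomb p)) t) ^+ 2 <= (\sum_b (p 0 b) ^+ 2) * (E / N.+1%:R).
Proof.
have /choice[C hC] b := tfun_expansion (idx b).
exists (\sum_b (2 * C b) ^+ 2) => [|N p t]; first by apply: sumr_ge0 => b _; exact: sqr_ge0.
have -> : tcomb p t - trig (coefs N (tcomb p)) t =
    \sum_b p 0 b * (tfun (idx b) t - trig (coefs N (tfun (idx b))) t).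
  under [RHS]eq_bigr do rewrite mulrBr.
  rewrite sumrB; congr (_ - _); rewrite coefs_tcomb /trig.
  under eq_bigr do rewrite mxE mulr_suml.
  rewrite exchange_big; apply: eq_bigr => b _; rewrite mulr_sumr.
  by apply: eq_bigr => j _; rewrite [X in p 0 b * X]mxE mulrA.
apply: le_trans (sum_cauchy_schwarz _ _) _.
rewrite ler_wpM2l ?sumr_ge0//; first by move=> b _; exact: sqr_ge0.
rewrite mulr_suml; apply: ler_sum => b _.
have [sC eC] := hC b.
have tl := fseries_tail N t sC; rewrite eC in tl.
have -> : trig (coefs N (tfun (idx b))) t =
    \sum_(j < N) cint (fun t => tfun (idx b) t * fcos j t) / fnorm R j * fcos j t.
  by apply: eq_bigr => j _; rewrite mxE.
rewrite -[leLHS]real_normK ?num_real//.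
apply: (@le_trans _ _ ((2 * C b / N.+1%:R) ^+ 2)).
  by rewrite lerXn2r ?nnegrE// (le_trans _ tl).
rewrite exprMn ler_wpM2l ?sqr_ge0// exprVn lef_pV2 ?posrE// expr2 -natrM ler_nat.
by rewrite leq_pmulr.
Qed.

(** Truncation costs at most a factor [r], uniformly over the trial space: the squared error in
    [tcomb_approx] is relative to the sum of squares of [p], which is a multiple of the weighted
    norm itself. *)
Lemma tcomb_gram_ge (r : R) : 1 < r -> exists N0, forall N p, (N0 <= N)%N ->
  cint (fun t => rho t * (tcomb p t * tcomb p t)) <=
  r * bform (gram rho N) (coefs N (tcomb p)) (coefs N (tcomb p)).
Proof.
move=> r1; have [E E0 hE] := tcomb_approx.
have r0 : 0 < r by apply: lt_trans r1.
pose s := (r - 1) / 2; have s0 : 0 < s by rewrite divr_gt0// subr_gt0.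
have [L0 hL] : exists L : R, L = cint rho by eexists.
pose M := (1 + s^-1) * (L0 * (kappa / pi) * E).
have L0p : 0 < L0.
  rewrite hL; apply: (@cint_gt0 _ _ 0) => //; first by move=> t _; exact: ltW.
  by rewrite lexx ltW// twopi_gt0.
have M0 : 0 <= M.
  by rewrite /M !mulr_ge0 ?invr_ge0 ?pi_ge0 ?(ltW L0p) ?(ltW kappa_gt0) ?addr_ge0 ?invr_ge0 ?(ltW s0).
(* Chosen so that [1 + s = (1 - e) * r], where [1 + s] is the factor lost in Young's inequality for
   [f = g + (f - g)]; the error term [e * X] is then absorbed on the left. *)
pose e := (r - 1) / (2 * r); have e0 : 0 < e by rewrite divr_gt0 ?subr_gt0// mulr_gt0.
exists (Num.bound (M / e)) => N p NN.
have Me : M / N.+1%:R <= e.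
  rewrite ler_pdivrMr// mulrC -ler_pdivrMr//.
  apply: ltW; apply: (lt_le_trans (archi_boundP (divr_ge0 M0 (ltW e0)))).
  by rewrite ler_nat (leq_trans NN).
rewrite gramE//; set f := tcomb p; set g := trig (coefs N f).
set X := cint _; set G := cint _.
have cf : continuous f by exact: cont_tcomb.
have cg : continuous g by exact: cont_trig.
have P2 : \sum_b (p 0 b) ^+ 2 = kappa / pi * X.
  rewrite /X /f tcomb_norm mulrA; have p0 := @pi_gt0 R.
  by rewrite mulrA divfK ?gt_eqF// mulfV ?gt_eqF// mul1r.
have P20 : 0 <= \sum_b (p 0 b) ^+ 2 by apply: sumr_ge0 => b _; exact: sqr_ge0.
have key : X <= (1 + s) * G + M / N.+1%:R * X.
  have -> : M / N.+1%:R * X = (1 + s^-1) * ((\sum_b (p 0 b) ^+ 2) * (E / N.+1%:R)) * cint rho.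
    by rewrite P2 -hL /M; ring.
  have crg : continuous (fun t => rho t * (g t * g t)) by apply: contM => //; exact: contM.
  rewrite /G -(cintZ _ crg) -(cintZ _ crho) -(cintD (contZ crg) (contZ crho)).
  apply: cint_le.
  - by apply: contM => //; exact: contM.
  - by apply: contD; exact: contZ.
  move=> t _; rewrite [leRHS](_ : _ = rho t * ((1 + s) * (g t * g t) +
    (1 + s^-1) * ((\sum_b (p 0 b) ^+ 2) * (E / N.+1%:R)))); last by ring.
  rewrite ler_wpM2l ?(ltW (rho_gt0 t))//.
  apply: (@le_trans _ _ ((1 + s) * (g t * g t) + (1 + s^-1) * (f t - g t) ^+ 2)).
    rewrite -subr_ge0 [X in 0 <= X](_ : _ = (s * g t - (f t - g t)) ^+ 2 / s); last first.
      by field; rewrite gt_eqF.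
    by rewrite divr_ge0 ?sqr_ge0 ?(ltW s0).
  by rewrite lerD2l ler_wpM2l ?addr_ge0 ?invr_ge0 ?(ltW s0)//; exact: hE.
have X0 : 0 <= X by rewrite /X /f tcomb_norm mulr_ge0 ?divr_ge0 ?pi_ge0 ?(ltW kappa_gt0).
have : X <= (1 + s) * G + e * X.
  by apply: (le_trans key); rewrite lerD2l ler_wpM2r.
have -> : (1 + s) = (1 - e) * r by rewrite /s /e; field; rewrite gt_eqF.
have e1 : 0 < 1 - e.
  rewrite subr_gt0 /e ltr_pdivrMr ?mulr_gt0// mul1r; lra.
move=> h; rewrite -(ler_pM2l e1); move: h; rewrite -mulrA.
by move: (r * G) => rG; lra.
Qed.

End TrialSpace.

End Trial.

Section GalerkinEigenvectors.
Variable R : realType.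
Variables (rho rho' x : R -> R) (tau kappa : R).
Hypotheses (drho : der rho rho') (crho' : continuous rho').
Hypotheses (prho : per rho) (prho' : per rho') (rho_gt0 : forall t, 0 < rho t).
Hypothesis rho_tau : forall t, rho (t + tau) = rho t.
Hypotheses (kappa_gt0 : 0 < kappa) (dx : der x (fun t => kappa * rho t)).
Hypothesis x_per : forall t, x (t + 2 * pi) = x t + 2 * pi.
Hypothesis x_tau : forall t, x (t + tau) = x t + tau.

Let crho : continuous rho := der_cont drho.
Let cx : continuous x := der_cont dx.
Let G N := gram rho N.

(** The arc length [x] commutes with the rotation, so a trial function has the same character as the
    basis function it is built from, although its Fourier expansion is infinite. *)
Lemma coefs_block N i (j : 'I_N) : resonant tau i != resonant tau j ->
  coefs N (tfun x i) 0 j = 0.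
Proof.
move=> ij; rewrite mxE (_ : cint _ = 0) ?mul0r//.
rewrite -[RHS](@shift_orth R tau (fun=> 1) (tfun x i) (fcos j) _ _ (@cont_cst R R 1) _ _ _ _ _
  _ (osc_x_tau x_tau _ _) (osc_tau _ _ _) (resonant_neq ij)) //.
- by apply: eq_cint => t; rewrite mul1r.
- exact: (cont_tfun dx).
- exact: cont_osc.
- exact: (per_tfun x_per).
- exact: (osc_per (freq j)).
Qed.

Lemma vconj_block N i (j : 'I_N) : resonant tau i != resonant tau j ->
  vconj N (tfun x i) 0 j = 0.
Proof.
move=> ij; rewrite mxE (_ : cint _ = 0) ?oppr0 ?mul0r//.
rewrite -[RHS](@shift_orth R tau (fun=> 1) (tfun x i) (fsin j) _ _ (@cont_cst R R 1) _ _ _ _ _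
  _ (osc_x_tau x_tau _ _) (osc_tau _ _ _) (resonant_neq ij)) //.
- by apply: eq_cint => t; rewrite mul1r.
- exact: (cont_tfun dx).
- exact: cont_osc.
- exact: (per_tfun x_per).
- exact: (osc_per (freq j)).
Qed.

(** The normalised eigenvector of eigenvalue 0. It is kept apart from the eigensystems because
    orthogonality to it constrains the trial vector. *)
Definition unit_const N : 'rV[R]_N.+1 := (Num.sqrt (cint rho))^-1 *: delta_mx 0 0.
Local Notation z N := (unit_const N).

Lemma cint_rho_gt0 : 0 < cint rho.
Proof.
apply: (@cint_gt0 _ _ 0) => //; first by move=> t _; exact: ltW.
by rewrite lexx ltW// twopi_gt0.
Qed.

Lemma trig_delta N (i : 'I_N) t : trig (delta_mx 0 i) t = fcos i t :> R.
Proof.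
rewrite /trig (bigD1 i)//= big1 ?addr0 => [|j ji]; rewrite mxE eqxx /=.
  by rewrite eqxx mul1r.
by rewrite (negbTE ji) mul0r.
Qed.

Lemma unit_const_norm N : z N *m G N.+1 *m (z N)^T = 1%:M.
Proof.
apply/matrixP => i j; rewrite !ord1 [RHS]mxE eqxx -[LHS]/(bform (G N.+1) (z N) (z N)).
rewrite /unit_const bformZl bformZr gramE//.
rewrite (_ : cint (fun t => _) = cint rho); last first.
  by apply: eq_cint => t; rewrite !trig_delta fcos0 !mulr1.
rewrite mulrA -invfM -expr2 sqr_sqrtr ?(ltW cint_rho_gt0)//.
by rewrite mulVf// gt_eqF// cint_rho_gt0.
Qed.

Lemma unit_const_stiff N : z N *m stiff R N.+1 = 0.
Proof.
rewrite -scalemxAl -rowE; apply/rowP => j; rewrite !mxE.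
by rewrite /freq /= mulr0 mul0rn mulr0.
Qed.

Definition side (s : bool) N : pred 'I_N := fun i => resonant tau i == s.

Lemma side_neq s N (i j : 'I_N) : side s i != side s j -> resonant tau i != resonant tau j.
Proof. by rewrite /side; apply: contra => /eqP ->. Qed.

Lemma unit_const_side s N :
  supp (@side s N.+1) (z N) \/ supp (predC (@side s N.+1)) (z N).
Proof.
have [h|h] := boolP (side s (0 : 'I_N.+1)); [left|right] => i /= hi; rewrite !mxE eqxx.
  by case: eqP => [e|]; [rewrite e h in hi|rewrite mulr0].
by rewrite negbK in hi; case: eqP => [e|]; [rewrite -e hi in h|rewrite mulr0].
Qed.

Definition eigsys N (c : R) (s : bool) d (P : 'M[R]_(d, N.+1)) (S : 'rV[R]_d) :=
  [/\ P *m G N.+1 *m P^T = 1%:M, P *m stiff R N.+1 = diag_mx S *m P *m G N.+1,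
      forall a, S 0 a <= c, forall a, supp (@side s N.+1) (row a P)
    & z N *m G N.+1 *m P^T = 0].

Section Step.
Variables (nb m : nat) (idx : 'I_nb -> nat) (s : bool) (c : R).
Hypotheses (idx_inj : injective idx) (idx_gt0 : forall b, (0 < idx b)%N).
Hypothesis idx_freq : forall b, (freq (idx b) <= m)%N.
Hypothesis idx_side : forall b, resonant tau (idx b) = s.
Hypotheses (m0 : (0 < m)%N) (mc : kappa * m%:R < c).

(* The Hersch-Payne-Schiffer argument: if [v] and its conjugate [w] both satisfy
   the constraints then the product of their Rayleigh quotients is at most
   [(kappa * m) ^+ 2] up to the truncation error, so one of them is below [c]. *)
Lemma trial_vector : exists K0, forall K, (K0 <= K)%N -> let N := K.*2 in
  forall d (P : 'M[R]_(d, N.+1)) S, eigsys c s P S -> (d.*2.+1 < nb)%N ->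
  exists v : 'rV[R]_N.+1, [/\ supp (@side s N.+1) v, v != 0,
    v *m G N.+1 *m (z N)^T = 0, v *m G N.+1 *m P^T = 0
    & bform (stiff R N.+1) v v <= c * bform (G N.+1) v v].
Proof.
have km0 : 0 < kappa * m%:R by rewrite mulr_gt0// ltr0n.
have c0 : 0 < c := lt_trans km0 mc.
(* The slack granted to truncation: this factor times [(kappa * m) ^+ 2] is exactly [c ^+ 2]. *)
have r1 : 1 < (c / (kappa * m%:R)) ^+ 2.
  by rewrite exprn_egt1// ltr_pdivlMr// mul1r.
have [N0 hN0] := tcomb_gram_ge drho crho' prho prho' rho_gt0 kappa_gt0 dx x_per idx_inj idx_gt0 r1.
exists N0 => K K0 N d P S [PP PL Sc PD zP] dnb.
pose T := \matrix_b coefs N.+1 (tfun x (idx b)).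
pose T' := \matrix_b vconj N.+1 (tfun x (idx b)).
(* The [1 + d + d] constraints: mean zero and orthogonality to [P] for the trial vector, and
   orthogonality to [P] alone for its conjugate. *)
pose C := row_mx (T *m G N.+1 *m (z N)^T) (row_mx (T *m G N.+1 *m P^T) (T' *m G N.+1 *m P^T)).
have [p p0 pC] : exists2 p : 'rV_nb, p != 0 & p *m C = 0.
  by apply: exists_kernel; move: dnb; rewrite -addnn; lia.
pose V := tcomb x idx p; pose v := coefs N.+1 V; pose w := vconj N.+1 V.
have vE : v = p *m T by exact: (coefs_tcomb dx).
have wE : w = p *m T' by exact: (vconj_tcomb dx).
have [vz vP wP] : [/\ v *m G N.+1 *m (z N)^T = 0, v *m G N.+1 *m P^T = 0
    & w *m G N.+1 *m P^T = 0].
  move: pC; rewrite /C !mul_mx_row !mulmxA -vE -wE -[RHS]row_mx0.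
  by move=> /eq_row_mx[-> ]; rewrite -[RHS]row_mx0 => /eq_row_mx[-> ->].
have sv : supp (@side s N.+1) v.
  move=> i hi; rewrite vE mxE big1// => b _; rewrite [T _ _]mxE coefs_block ?mulr0//.
  by rewrite idx_side eq_sym.
have sw : supp (@side s N.+1) w.
  move=> i hi; rewrite wE mxE big1// => b _; rewrite [T' _ _]mxE vconj_block ?mulr0//.
  by rewrite idx_side eq_sym.
pose a := bform (G N.+1) w (z N).
(* Removing the mean of the conjugate does not change its energy, and it does not disturb
   orthogonality to [P]. *)
pose w' := w - a *: z N.
have sG : (G N.+1)^T = G N.+1 by exact: gram_sym.
have sw' : supp (@side s N.+1) w'.
  move=> i hi; have -> : w' 0 i = w 0 i - a * z N 0 i.
    by rewrite [LHS]mxE [X in _ + X]mxE [X in _ - X = _]mxE.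
  rewrite sw// add0r; have [hz|hz] := unit_const_side s N; first by rewrite hz// mulr0 oppr0.
  have -> : a = 0.
    apply: (block_orth _ sw hz) => i' j' /side_neq; exact: gram_block.
  by rewrite mul0r oppr0.
have wz' : w' *m G N.+1 *m (z N)^T = 0.
  rewrite !mulmxBl -(scalemxAl a (z N)) -(scalemxAl a (z N *m _)) unit_const_norm [X in X - _]mx11_scalar.
  by rewrite -/(bform (G N.+1) w (z N)) -/a scalemx1 subrr.
have wP' : w' *m G N.+1 *m P^T = 0.
  by rewrite !mulmxBl -(scalemxAl a (z N)) -(scalemxAl a (z N *m _)) zP wP scaler0 subrr.
have Lw : bform (stiff R N.+1) w' w' = bform (stiff R N.+1) w w.
  have zL h : bform (stiff R N.+1) (z N) h = 0.
    by rewrite /bform unit_const_stiff mul0mx mxE.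
  have sL := stiff_sym R N.+1.
  by rewrite /w' -scaleN1r scalerA mulN1r bform_sqr// (bformC w _ sL) !zL !mulr0 !addr0.
have Ew : bform (stiff R N.+1) w w = bform (stiff R N.+1) v v.
  by rewrite conj_energy//; exact: (cont_tcomb dx).
have hK : (N0 <= N.+1)%N by rewrite (leq_trans K0)// /N -addnn; lia.
have Gw0 : 0 <= bform (G N.+1) w' w'.
  have [al al0 hal] := gram_coercive crho rho_gt0.
  apply: le_trans (hal _ _); rewrite mulr_ge0 ?(ltW al0) ?sumr_ge0// => i _.
  exact: sqr_ge0.
have key : bform (stiff R N.+1) v v ^+ 2 <= bform (G N.+1) w' w' * (c ^+ 2 * bform (G N.+1) v v).
  have dV : der V (fun t => rho t * tslope x kappa idx p t) by exact: (der_tcomb dx).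
  have cV : continuous (tslope x kappa idx p) by exact: (cont_tslope dx).
  have pV : per V by exact: (per_tcomb x_per).
  have := @conj_energy_le R rho crho rho_gt0 N V _ (- a * (Num.sqrt (cint rho))^-1) dV cV pV.
  rewrite -/w -scalerA scaleNr -/w' Ew => /le_trans; apply.
  rewrite ler_wpM2l//.
  apply: (le_trans (tslope_norm drho kappa_gt0 dx x_per idx_inj idx_gt0 idx_freq p)).
  apply: (@le_trans _ _ ((kappa * m%:R) ^+ 2 * ((c / (kappa * m%:R)) ^+ 2 * bform (G N.+1) v v))).
    by rewrite ler_wpM2l ?sqr_ge0// hN0.
  by rewrite mulrA -exprMn [_ * (c / _)]mulrC divfK// gt_eqF.
have v0 : 0 < bform (G N.+1) v v.
  have := hN0 N.+1 p hK; rewrite (tcomb_norm drho kappa_gt0 dx x_per idx_inj idx_gt0).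
  move=> h; rewrite -(pmulr_rgt0 _ (lt_trans ltr01 r1)); apply: lt_le_trans h.
  rewrite mulr_gt0 ?divr_gt0 ?pi_gt0// lt0r sumr_ge0 ?andbT => [|b _]; last exact: sqr_ge0.
  apply: contra p0 => /eqP /psumr_eq0P e; apply/eqP/rowP => b; rewrite mxE.
  by apply/eqP; rewrite -sqrf_eq0 e// => b' _; exact: sqr_ge0.
have [Ev|Ev] := leP (bform (stiff R N.+1) v v) (c * bform (G N.+1) v v).
  exists v; split => //; apply: contraTneq v0 => ->.
  by rewrite /bform !mul0mx mxE ltxx.
have E0 : 0 < bform (stiff R N.+1) v v by apply: lt_trans Ev; rewrite mulr_gt0.
exists w'; split => //.
  by apply: contraTneq E0 => w'0; rewrite -Ew -Lw w'0 /bform !mul0mx mxE ltxx.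
rewrite Lw Ew -(ler_pM2r E0) -expr2; apply: (le_trans key).
rewrite [c * _]mulrC -[leRHS]mulrA ler_wpM2l// expr2 -mulrA ler_wpM2l ?(ltW c0)//.
exact: ltW.
Qed.

Lemma eigsys_step : exists K0, forall K, (K0 <= K)%N -> let N := K.*2 in
  forall d (P : 'M[R]_(d, N.+1)) S, eigsys c s P S -> (d.*2.+1 < nb)%N ->
  exists (u : 'rV[R]_N.+1) (e : R), [/\ supp (@side s N.+1) u,
    u *m G N.+1 *m u^T = 1%:M, u *m G N.+1 *m P^T = 0, u *m G N.+1 *m (z N)^T = 0 &
    u *m stiff R N.+1 = e *: (u *m G N.+1) /\ e <= c].
Proof.
have [K0 hK0] := trial_vector; exists K0 => K KK N d P S ES dnb.
have [v [sv v0 vz vP Ev]] := hK0 K KK d P S ES dnb.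
have [PP PL Sc PD zP] := ES.
have [al al0 hal] := gram_coercive crho rho_gt0.
have sG : (G N.+1)^T = G N.+1 by exact: gram_sym.
(* The constant joins the known eigenvectors, with eigenvalue 0, so that the new one is orthogonal
   to it as well. *)
pose P1 := col_mx (z N) P; pose S1 : 'rV_(1 + d) := row_mx 0 S.
have Pz : P *m G N.+1 *m (z N)^T = 0.
  by apply: trmx_inj; rewrite trmx0 !trmx_mul trmxK sG mulmxA.
have P1P1 : P1 *m G N.+1 *m P1^T = 1%:M.
  rewrite mul_col_mx tr_col_mx mul_col_row unit_const_norm zP Pz PP.
  by rewrite -scalar_mx_block.
have P1L : P1 *m stiff R N.+1 = diag_mx S1 *m P1 *m G N.+1.
  rewrite mul_col_mx unit_const_stiff PL diag_mx_row mul_block_col mul_col_mx.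
  by rewrite !mul0mx add0r addr0 (_ : diag_mx 0 = 0) ?mul0mx// linear0.
have P1D (a : 'I_(1 + d)) : supp (@side s N.+1) (row a P1) \/ supp (predC (@side s N.+1)) (row a P1).
  case: (split_ordP a) => b ->.
    by rewrite rowKu row_id; exact: unit_const_side.
  by rewrite rowKd; left; exact: PD.
have vP1 : v *m G N.+1 *m P1^T = 0 by rewrite tr_col_mx mul_mx_row vz vP row_mx0.
have [u [e [su u1 uP1 uL ec]]] := new_eigenvector sG (stiff_sym R N.+1) al0 (hal N.+1)
  (fun i j h => gram_block drho prho rho_tau (side_neq h))
  (fun i j h => @stiff_block R tau _ i j (side_neq h)) P1P1 P1L P1D sv vP1 v0 Ev.
exists u, e; move: uP1; rewrite tr_col_mx mul_mx_row -[RHS]row_mx0.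
by move=> /eq_row_mx[uz uP]; split.
Qed.

End Step.

End GalerkinEigenvectors.

(** * The complex structure on the resonant space *)

Section Conjugation.
Variable R : realType.

Lemma nat_pair_case i : i = 0%N \/ exists m, i = m.*2.+1 \/ i = m.*2.+2.
Proof.
case: i => [|i]; [by left|right]; exists i./2.
by have := odd_double_half i; case: (odd i) => /= e; [right|left]; rewrite -[in LHS]e.
Qed.

(** Exchanges the sine and the cosine of one frequency; with the sign [csgn] it expresses [fsin] in
    the basis [fcos]. *)
Definition cidx i := if i == 0%N then 0%N else if odd i then i.+1 else i.-1.
Definition csgn i : R := if i == 0%N then 0 else if odd i then -1 else 1.

Lemma fsin_cidx i (t : R) : fsin i t = csgn i * fcos (cidx i) t.
Proof.
case: (nat_pair_case i) => [->|[m [->|->]]].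
- by rewrite /fsin osc0 /phase /= add0r cos_pihalf mul0r.
- by rewrite fsin_odd /csgn /cidx /= odd_double mulN1r.
- by rewrite fsin_even /csgn /cidx /= negbK odd_double mul1r.
Qed.

Lemma freq_cidx i : freq (cidx i) = freq i.
Proof.
case: (nat_pair_case i) => [->//|[m [->|->]]].
  by rewrite /cidx /= odd_double /freq /= uphalf_double doubleK.
by rewrite /cidx /= negbK odd_double /freq /= uphalf_double doubleK.
Qed.

Lemma cidxK : involutive cidx.
Proof.
move=> i; case: (nat_pair_case i) => [->//|[m [->|->]]].
  by rewrite /cidx /= odd_double /= negbK odd_double.
by rewrite /cidx /= negbK odd_double /= odd_double.
Qed.

Lemma csgn_cidx i : csgn (cidx i) = - csgn i.
Proof.
case: (nat_pair_case i) => [->|[m [->|->]]].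
- by rewrite /cidx /csgn /= oppr0.
- by rewrite /cidx /csgn /= odd_double /= negbK odd_double opprK.
- by rewrite /cidx /csgn /= negbK odd_double /= odd_double.
Qed.

Lemma cidx_lt K i : (i < K.*2.+1)%N -> (cidx i < K.*2.+1)%N.
Proof.
case: (nat_pair_case i) => [->//|[m [->|->]]]; rewrite /cidx /= ?negbK odd_double /=.
  by rewrite -!addnn; lia.
by rewrite -!addnn; lia.
Qed.

Variable tau : R.

(** At a resonant index the quotient of sines is 1 or -1, according to whether the frequency is 1 or
    -1 modulo [n]. *)
Definition cmul i : R := - (sin ((freq i)%:R * tau) / sin tau) * csgn i.

(* The complex structure of the resonant space: multiplication by [+-i] on
   [exp (+- i m t)], i.e. [(shift_tau - shift_{-tau}) / (2 sin tau)]. *)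
Definition cstr N : 'M[R]_N := \matrix_(i, j) if (j : nat) == cidx i then cmul i else 0.

Lemma cstr_anti N : (cstr N)^T = - cstr N.
Proof.
apply/matrixP => i j; rewrite !mxE.
have -> : ((i : nat) == cidx j) = ((j : nat) == cidx i).
  by apply/eqP/eqP => ->; rewrite cidxK.
case: eqP => [->|_]; last by rewrite oppr0.
by rewrite /cmul csgn_cidx freq_cidx; ring.
Qed.

Lemma cstr_freq N (i j : 'I_N) : freq i != freq j -> cstr N i j = 0.
Proof. by rewrite mxE => ij; case: ifP => // /eqP e; rewrite e freq_cidx eqxx in ij. Qed.

Lemma cstr_stiff N : cstr N *m stiff R N = stiff R N *m cstr N.
Proof.
apply/matrixP => i j; rewrite mul_mx_diag mul_diag_mx !mxE.
by case: eqP => [->|_]; rewrite ?mulr0 ?mul0r// freq_cidx mulrC.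
Qed.

Lemma cstr_side s N (u : 'rV[R]_N) : supp (@side R tau s N) u ->
  supp (@side R tau s N) (u *m cstr N).
Proof.
move=> su j hj; rewrite mxE big1// => i _.
have [e|ne] := eqVneq (freq i) (freq j); last by rewrite cstr_freq// mulr0.
by rewrite su ?mul0r//; move: hj; rewrite /side /resonant e.
Qed.

Hypothesis sin_tau : sin tau != 0.

Lemma trig_cstr K (u : 'rV[R]_(K.*2.+1)) (t : R) :
  trig (u *m cstr K.*2.+1) t = (trig u (t + tau) - trig u (t - tau)) / (2 * sin tau).
Proof.
have E i : (i < K.*2.+1)%N ->
    \sum_(j < K.*2.+1) (if (j : nat) == cidx i then cmul i else 0) * fcos j t =
    (fcos i (t + tau) - fcos i (t - tau)) / (2 * sin tau).
  move=> iK; rewrite (bigD1 (Ordinal (cidx_lt iK)))//= eqxx big1 => [|j ji]; last first.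
    by rewrite ifN ?mul0r.
  rewrite addr0 /cmul -mulrA -fsin_cidx.
  have -> : fcos i (t + tau) - fcos i (t - tau) = - 2 * sin ((freq i)%:R * tau) * fsin i t.
    rewrite /fcos /fsin /osc.
    have -> : (freq i)%:R * t - (phase R i + pi / 2) = ((freq i)%:R * t - phase R i) - pi / 2 by ring.
    rewrite cosBpihalf.
    have -> : (freq i)%:R * (t + tau) - phase R i = ((freq i)%:R * t - phase R i) + (freq i)%:R * tau by ring.
    have -> : (freq i)%:R * (t - tau) - phase R i = ((freq i)%:R * t - phase R i) - (freq i)%:R * tau by ring.
    move: ((freq i)%:R * t - phase R i) ((freq i)%:R * tau) => a b.
    by rewrite cosD cosB; ring.
  by field.
rewrite /trig -sumrB mulr_suml.
under eq_bigr do rewrite mxE mulr_suml.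
rewrite exchange_big; apply: eq_bigr => i _.
rewrite -mulrBr -mulrA -E// mulr_sumr; apply: eq_bigr => j _.
by rewrite mxE mulrA.
Qed.

Lemma cstr_sqr K (u : 'rV[R]_(K.*2.+1)) : supp (@side R tau true _) u ->
  u *m cstr _ *m cstr _ = - u.
Proof.
move=> su; apply/rowP => j; rewrite -mulmxA mxE [RHS]mxE.
have JJ (i : 'I_(K.*2.+1)) : (cstr K.*2.+1 *m cstr _) i j =
    if i == j then cmul i * cmul (cidx i) else 0.
  rewrite mxE (bigD1 (Ordinal (cidx_lt (ltn_ord i))))//= big1 => [|l li]; last first.
    by rewrite [X in X * _]mxE ifN ?mul0r.
  rewrite addr0 !mxE eqxx /= cidxK eq_sym.
  by rewrite -[(i : nat) == j]/(i == j); case: ifP; rewrite ?mulr0.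
rewrite (bigD1 j)//= JJ eqxx big1 ?addr0 => [|i ij]; last by rewrite JJ (negbTE ij) mulr0.
have [hj|hj] := boolP (@side R tau true _ j); last by rewrite su// mul0r oppr0.
(* The constant is not resonant: [cos tau = 1] would force [sin tau = 0]. At index 0 the sign [csgn]
   is 0 and the square would not be -1. *)
have j0 : (j : nat) != 0%N.
  apply: contraNneq sin_tau => j0; move: hj; rewrite /side /resonant j0 /freq /= mul0r cos0.
  move=> /eqP/eqP e; rewrite -sqrf_eq0 sin2cos2 -e expr1n subrr.
  by [].
have -> : cmul j * cmul (cidx j) = - ((sin ((freq j)%:R * tau) / sin tau) ^+ 2 * csgn j ^+ 2).
  by rewrite /cmul freq_cidx csgn_cidx; ring.
have -> : csgn j ^+ 2 = 1.
  by rewrite /csgn (negbTE j0); case: ifP => _; rewrite ?sqrrN expr1n.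
have -> : (sin ((freq j)%:R * tau) / sin tau) ^+ 2 = 1.
  move: hj; rewrite /side /resonant => /eqP/eqP e.
  by rewrite expr_div_n sin2cos2 e -sin2cos2 divff// sqrf_eq0.
by rewrite mulr1 mulrN1.
Qed.

End Conjugation.

Section GalerkinTheorem.
Variable R : realType.
Variables (rho rho' x : R -> R) (tau kappa : R).
Hypotheses (drho : der rho rho') (crho' : continuous rho').
Hypotheses (prho : per rho) (prho' : per rho') (rho_gt0 : forall t, 0 < rho t).
Hypothesis rho_tau : forall t, rho (t + tau) = rho t.
Hypotheses (kappa_gt0 : 0 < kappa) (dx : der x (fun t => kappa * rho t)).
Hypothesis x_per : forall t, x (t + 2 * pi) = x t + 2 * pi.
Hypothesis x_tau : forall t, x (t + tau) = x t + tau.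
Hypothesis sin_tau : sin tau != 0.

Let crho : continuous rho := der_cont drho.
Let G N := gram rho N.
Local Notation z N := (unit_const rho N).
Local Notation J N := (cstr tau N).

(** Invariance of the density makes the shifts by [tau] and [- tau] adjoint to each other, hence
    their difference skew. *)
Lemma cstr_skew K (h w : 'rV[R]_(K.*2.+1)) :
  bform (G _) (h *m J _) w = - bform (G _) h (w *m J _).
Proof.
have per_trig N (u : 'rV[R]_N) : per (trig u).
  by move=> t; apply: eq_bigr => i _; rewrite per_fcos.
have crfg (f g : R -> R) : continuous f -> continuous g ->
    continuous (fun t => rho t * (f t * g t)).
  by move=> cf cg; apply: contM => //; exact: contM.
have ct := @cont_trig R.
have rho_tauN t : rho (t - tau) = rho t by rewrite -[in RHS](subrK tau t) rho_tau.
have s1 := cint_shift_weight crho (ct _ h) (ct _ w) prho (per_trig _ h) (per_trig _ w) rho_tau.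
have s2 := cint_shift_weight crho (ct _ h) (ct _ w) prho (per_trig _ h) (per_trig _ w) rho_tauN.
rewrite opprK in s2.
have c2 : 2 * sin tau != 0 by rewrite mulf_neq0.
have csh (u : 'rV[R]_(K.*2.+1)) c : continuous (fun t => trig u (t + c)).
  by apply: cont_shift; exact: ct.
have c1 : continuous (fun t => rho t * (trig h (t + tau) * trig w t)) by exact: crfg.
have c3 : continuous (fun t => rho t * (trig h (t - tau) * trig w t)) by exact: crfg.
have c4 : continuous (fun t => rho t * (trig h t * trig w (t + tau))) by exact: crfg.
have c5 : continuous (fun t => rho t * (trig h t * trig w (t - tau))) by exact: crfg.
rewrite !gramE//.
rewrite (@eq_cint _ _ (fun t => (2 * sin tau)^-1 * (rho t * (trig h (t + tau) * trig w t)) +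
  - (2 * sin tau)^-1 * (rho t * (trig h (t - tau) * trig w t)))); last first.
  by move=> t; rewrite trig_cstr//; field.
rewrite (@eq_cint _ (fun t => rho t * (trig h t * trig (w *m _) t))
  (fun t => (2 * sin tau)^-1 * (rho t * (trig h t * trig w (t + tau))) +
  - (2 * sin tau)^-1 * (rho t * (trig h t * trig w (t - tau))))); last first.
  by move=> t; rewrite trig_cstr//; field.
rewrite (cintD (contZ c1) (contZ c3)) (cintD (contZ c4) (contZ c5)).
by rewrite !cintZ// s1 s2; ring.
Qed.

(** [J] is skew for the Gram form and also antisymmetric as a matrix; together these say that it
    commutes with the Gram matrix. *)
Lemma cstr_gram K : J K.*2.+1 *m G _ = G _ *m J _.
Proof.
apply/matrixP => i j.
have E (M : 'M[R]_(K.*2.+1)) : M i j = bform M (delta_mx 0 i) (delta_mx 0 j).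
  by rewrite /bform trmx_delta -rowE -colE !mxE.
rewrite [LHS]E [RHS]E; have := cstr_skew (delta_mx 0 i) (delta_mx 0 j).
rewrite /bform !mulmxA => ->; rewrite trmx_mul cstr_anti mulNmx mulmxN mxE opprK.
by rewrite !mulmxA.
Qed.

Lemma cstr_skew_mx K d (h : 'rV[R]_(K.*2.+1)) (P : 'M[R]_(d, K.*2.+1)) :
  h *m J _ *m G _ *m P^T = - (h *m G _ *m (P *m J _)^T).
Proof.
by rewrite trmx_mul cstr_anti mulNmx mulmxN opprK -!mulmxA (mulmxA (J _)) cstr_gram !mulmxA.
Qed.

Lemma eigsys_add s c N d (P : 'M[R]_(d, N.+1)) S (u : 'rV[R]_N.+1) (e : R) :
  eigsys rho tau c s P S -> supp (@side R tau s N.+1) u ->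
  u *m G _ *m u^T = 1%:M -> u *m G _ *m P^T = 0 -> u *m G _ *m (z N)^T = 0 ->
  u *m stiff R _ = e *: (u *m G _) -> e <= c ->
  eigsys rho tau c s (col_mx u P) (row_mx (e%:M : 'rV_1) S).
Proof.
move=> [PP PL Sc PD zP] su u1 uP uz uL ec.
have sG N' : (G N')^T = G N' by exact: gram_sym.
have Pu : P *m G N.+1 *m u^T = 0.
  by apply: trmx_inj; rewrite trmx0 !trmx_mul trmxK sG mulmxA.
have zu : z N *m G N.+1 *m u^T = 0.
  by apply: trmx_inj; rewrite trmx0 !trmx_mul trmxK sG mulmxA.
split.
- by rewrite mul_col_mx tr_col_mx mul_col_row u1 uP Pu PP -scalar_mx_block.
- rewrite mul_col_mx uL PL diag_mx_row mul_block_col mul_col_mx !mul0mx add0r addr0.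
  congr (col_mx _ _); rewrite -mul_scalar_mx mulmxA; congr (_ *m _ *m _).
  by apply/matrixP => i j; rewrite !ord1 !mxE.
- move=> a; case: (split_ordP a) => b ->; last by rewrite row_mxEr.
  by rewrite row_mxEl mxE !ord1.
- move=> a; case: (split_ordP a) => b ->; last by rewrite rowKd.
  by rewrite rowKu row_id.
- by rewrite tr_col_mx mul_mx_row zu zP row_mx0.
Qed.

Lemma eigsys0 s c N : eigsys rho tau c s (0 : 'M[R]_(0, N.+1)) 0.
Proof.
split; [by apply/matrixP => -[]|by apply/matrixP => -[]|by case|by case|].
by apply/matrixP => i [].
Qed.

Section Iterate.
Variables (nb m : nat) (idx : 'I_nb -> nat) (s : bool) (c : R).
Hypotheses (idx_inj : injective idx) (idx_gt0 : forall b, (0 < idx b)%N).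
Hypothesis idx_freq : forall b, (freq (idx b) <= m)%N.
Hypothesis idx_side : forall b, resonant tau (idx b) = s.
Hypotheses (m0 : (0 < m)%N) (mc : kappa * m%:R < c).

(** Passing from [d] to [d + 1] vectors imposes [2 d + 1] constraints on [nb] trial functions, so
    the step is possible while [2 (d + 1) <= nb]. The threshold [K0] does not depend on [d]. *)
Lemma eigsys_single : exists K0, forall K, (K0 <= K)%N ->
  forall d, (d.*2 <= nb)%N ->
  exists (P : 'M[R]_(d, K.*2.+1)) S, eigsys rho tau c s P S.
Proof.
have [K0 hK0] := eigsys_step drho crho' prho prho' rho_gt0 rho_tau kappa_gt0 dx x_per x_tau
  idx_inj idx_gt0 idx_freq idx_side m0 mc.
exists K0 => K KK; elim=> [_|d IH dnb]; first by exists 0, 0; exact: eigsys0.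
have [P [S ES]] := IH (leq_trans (leq_trans (leqnSn _) (leqnSn _)) dnb).
have [u [e [su u1 uP uz [uL ec]]]] := hK0 K KK d P S ES (dnb : (d.*2.+1 < nb)%N).
by exists (col_mx u P), (row_mx (e%:M : 'rV_1) S); exact: eigsys_add ES su u1 uP uz uL ec.
Qed.

End Iterate.

Section IteratePairs.
Variables (nb m : nat) (idx : 'I_nb -> nat) (c : R).
Hypotheses (idx_inj : injective idx) (idx_gt0 : forall b, (0 < idx b)%N).
Hypothesis idx_freq : forall b, (freq (idx b) <= m)%N.
Hypothesis idx_side : forall b, resonant tau (idx b) = true.
Hypotheses (m0 : (0 < m)%N) (mc : kappa * m%:R < c).

(* Resonant eigenvectors come in pairs [u, J u]; keeping the orthogonal of the
   system stable under [J] lets the pair be added at once. *)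
Lemma eigsys_pairs : exists K0, forall K, (K0 <= K)%N ->
  forall b, (b.*2.*2 <= nb.+2)%N ->
  exists (P : 'M[R]_(b.*2, K.*2.+1)) S, eigsys rho tau c true P S /\
    forall h : 'rV_(K.*2.+1), supp (@side R tau true _) h ->
      h *m G _ *m P^T = 0 -> h *m J _ *m G _ *m P^T = 0.
Proof.
have [K0 hK0] := eigsys_step drho crho' prho prho' rho_gt0 rho_tau kappa_gt0 dx x_per x_tau
  idx_inj idx_gt0 idx_freq idx_side m0 mc.
exists K0 => K KK; elim=> [_|b IH bnb].
  exists 0, 0; split; first exact: eigsys0.
  by move=> h _ _; apply/matrixP => i [].
have [|P [S [ES stP]]] := IH; first by apply: leq_trans bnb; rewrite -!addnn; lia.
(* Only the first vector of the new pair needs a trial function, hence [4 b + 1 < nb]. When [nb] is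
   2 modulo 4 the last pair brings the total to one more than [nb / 2]: this is the gain by
   parity. *)
have dnb : (b.*2.*2.+1 < nb)%N by move: bnb; rewrite -!addnn; lia.
have [u [e [su u1 uP uz [uL ec]]]] := hK0 K KK _ P S ES dnb.
have ES1 := eigsys_add ES su u1 uP uz uL ec.
have sG N' : (G N')^T = G N' by exact: gram_sym.
pose v := u *m J K.*2.+1.
have sv : supp (@side R tau true _) v by exact: cstr_side.
have uJJ : u *m J _ *m J _ = - u by exact: cstr_sqr.
(* [J] is skew and the form symmetric, so the product of [u] and [J u] equals its opposite. *)
have vu : v *m G _ *m u^T = 0.
  have e1 : v *m G _ *m u^T = - (u *m G _ *m v^T) by exact: cstr_skew_mx.
  have e2 : v *m G _ *m u^T = u *m G _ *m v^T.
    have tr1 (X : 'M[R]_1) : X^T = X by apply/matrixP => i j; rewrite mxE !ord1.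
    by rewrite -[RHS]tr1 [RHS]trmx_mul trmxK [in RHS]trmx_mul sG mulmxA.
  have /eqP : (v *m G _ *m u^T) + (v *m G _ *m u^T) = 0 by rewrite {2}e1 e2 subrr.
  by rewrite -mulr2n -scaler_nat scaler_eq0 pnatr_eq0 => /eqP.
have v1 : v *m G _ *m v^T = 1%:M.
  by rewrite (cstr_skew_mx u v) /v uJJ linearN mulmxN opprK.
have vP : v *m G _ *m P^T = 0 by exact: stP.
have vz : v *m G _ *m (z K.*2)^T = 0.
  rewrite cstr_skew_mx (_ : z K.*2 *m J _ = 0) ?trmx0 ?mulmx0 ?oppr0//.
  rewrite -scalemxAl -rowE; apply/rowP => j; rewrite !mxE.
  by rewrite /cmul /csgn /=; case: ifP => _; rewrite ?mulr0.
have vL : v *m stiff R _ = e *: (v *m G _).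
  by rewrite -mulmxA cstr_stiff mulmxA uL -scalemxAl -!mulmxA cstr_gram.
have vP1 : v *m G _ *m (col_mx u P)^T = 0.
  by rewrite tr_col_mx mul_mx_row vu vP row_mx0.
have stP2 (h : 'rV_(K.*2.+1)) : supp (@side R tau true _) h ->
    h *m G _ *m (col_mx v (col_mx u P))^T = 0 ->
    h *m J _ *m G _ *m (col_mx v (col_mx u P))^T = 0.
  move=> sh; rewrite !tr_col_mx !mul_mx_row.
  rewrite -[X in _ = X -> _]row_mx0 => /eq_row_mx[hv].
  rewrite -[X in _ = X -> _]row_mx0 => /eq_row_mx[hu hP].
  by rewrite stP// !cstr_skew_mx uJJ linearN mulmxN opprK hu -/v hv oppr0 !row_mx0.
exists (col_mx v (col_mx u P)), (row_mx (e%:M : 'rV_1) (row_mx (e%:M : 'rV_1) S)).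
by split; [exact: (eigsys_add ES1 sv v1 vP1 vz vL ec)|exact: stP2].
Qed.

End IteratePairs.

End GalerkinTheorem.

(** * Counting resonant frequencies *)

Section ResonantCount.
Variables (R : realType) (n : nat).
Hypothesis n3 : (2 < n)%N.
Let tau : R := 2 * pi / n%:R.

Let n_gt0 : 0 < n%:R :> R. Proof. by rewrite ltr0n; lia. Qed.

Lemma tau_small : 0 < tau < pi.
Proof.
have p0 := @pi_gt0 R; rewrite /tau divr_gt0 ?mulr_gt0//= ltr_pdivrMr// mulrC ltr_pM2l//.
by rewrite ltr_nat.
Qed.

Lemma sin_tau_neq0 : sin tau != 0.
Proof. by rewrite gt_eqF// sin_gt0_pi// tau_small. Qed.

(** After reduction modulo [n], a remainder beyond [n / 2] is reflected to [n - r], which preserves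
    the cosine; the angle then lies in [[0, pi]], where the cosine is injective. *)
Lemma cos_tauP l : (cos (l%:R * tau) == cos tau) = (l %% n == 1)%N || (l %% n == n.-1)%N.
Proof.
have /andP[t0 tp] := tau_small.
have ntau : n%:R * tau = 2 * pi by rewrite /tau mulrC divfK// gt_eqF.
have rn : (l %% n < n)%N by rewrite ltn_mod; lia.
have -> : cos (l%:R * tau) = cos ((l %% n)%:R * tau).
  rewrite {1}(divn_eq l n) natrD natrM mulrDl -mulrA ntau.
  by rewrite -[RHS](cos_shift_int (l %/ n)%:Z) addrC.
move: (l %% n)%N rn => r rn.
have tauI : tau \in `[0, pi] by rewrite in_itv/= (ltW t0) (ltW tp).
have inj (q : nat) : (q.*2 <= n)%N -> (cos (q%:R * tau) == cos tau) = (q == 1)%N.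
  move=> qn; apply/eqP/eqP => [|->]; last by rewrite mul1r.
  move=> /cos_inj => /(_ _ tauI) h; have : q%:R * tau = 1 * tau.
    rewrite mul1r h// in_itv/= mulr_ge0 ?(ltW t0)//=.
    rewrite -(ler_pM2l (ltr0n R 2 : 0 < 2%:R)) -ntau mulrA ler_pM2r// -natrM ler_nat; lia.
  by move/mulIf => /(_ (lt0r_neq0 t0))/eqP; rewrite pnatr_eq1 => /eqP.
have [h|h] := leqP r.*2 n; first by rewrite inj//; apply/idP/idP; lia.
have -> : cos (r%:R * tau) = cos ((n - r)%:R * tau).
  rewrite natrB 1?ltnW// mulrBl ntau -[RHS]cosN opprB.
  by rewrite -[LHS](cos_shift_int (-1)) mulrN1z mulN1r.
by rewrite inj; [apply/idP/idP; lia|lia].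
Qed.

Definition rescount m := (\sum_(1 <= l < m.+1) (cos (l%:R * tau) == cos tau))%N.

(** Every full period contributes the residues 1 and [n - 1]. For [0 < t < n - 1] the last,
    incomplete period contributes only the first of them and the count is odd: the hypothesis on [k]
    modulo [n] acts here. *)
Lemma rescountE q t : (t < n)%N ->
  rescount (q * n + t) = (q.*2 + (0 < t) + (t == n.-1))%N.
Proof.
have resE q' t' : (t' < n)%N -> (cos ((q' * n + t')%:R * tau) == cos tau) =
    (t' == 1)%N || (t' == n.-1)%N.
  by move=> tn; rewrite cos_tauP modnMDl modn_small.
have step m : rescount m.+1 = (rescount m + (cos (m.+1%:R * tau) == cos tau))%N.
  by rewrite /rescount big_nat_recr.
have period q' : rescount (q' * n) = q'.*2 -> forall t', (t' < n)%N ->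
    rescount (q' * n + t') = (q'.*2 + (0 < t') + (t' == n.-1))%N.
  move=> h0; elim=> [_|t' IH tn]; first by rewrite addn0 h0; lia.
  by rewrite addnS step IH ?(ltnW tn)// -addnS resE//; lia.
move=> tn; apply: (period) => //.
elim: q => [|q IH]; first by rewrite mul0n /rescount big_geq.
have nE : n = n.-1.+1 by lia.
rewrite mulSnr {2}nE addnS step (period _ IH) -?addnS; last by lia.
rewrite -nE -mulSnr -[X in X%:R]addn0 resE; lia.
Qed.

Definition trial_set (m : nat) (s : bool) : {set 'I_(m.*2.+1)} :=
  [set i : 'I_(m.*2.+1) | (0 < i)%N && (resonant tau i == s)]%SET.

Lemma card_trial_true m : #|trial_set m true| = (rescount m).*2.
Proof.
have -> : #|trial_set m true| = (\sum_(1 <= i < m.*2.+1) resonant tau i)%N.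
  rewrite -sum1_card big_mkcond big_ord_recl /trial_set finset.in_set /= add0n.
  rewrite big_add1 big_mkord; apply: eq_bigr => i _.
  by rewrite finset.in_set /= eqb_id; case: resonant.
elim: m => [|m IH]; first by rewrite /rescount !big_geq.
rewrite doubleS big_nat_recr//= big_nat_recr//= IH /rescount [in RHS]big_nat_recr//= doubleD.
rewrite -addnA; congr (_ + _)%N; rewrite /resonant /freq /= doubleK uphalf_double.
by rewrite -addnn.
Qed.

Lemma card_trial m : (#|trial_set m true| + #|trial_set m false|)%N = m.*2.
Proof.
rewrite -cardsUI (_ : _ :&: _ = finset.set0)%SET; last first.
  by apply/setP => i; rewrite !finset.inE; case: resonant; rewrite ?andbF.
rewrite cards0 addn0 (_ : _ :|: _ = [set~ ord0])%SET; last first.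
  apply/setP => i; rewrite !finset.inE -val_eqE /= -lt0n.
  by case: resonant; rewrite ?andbF ?orbF ?andbT.
by rewrite cardsC1 card_ord.
Qed.

End ResonantCount.

Section GalerkinCount.
Variable R : realType.
Variables (rho rho' x : R -> R) (n m : nat) (kappa c : R).
Let tau : R := 2 * pi / n%:R.
Hypotheses (drho : der rho rho') (crho' : continuous rho').
Hypotheses (prho : per rho) (prho' : per rho') (rho_gt0 : forall t, 0 < rho t).
Hypothesis rho_tau : forall t, rho (t + tau) = rho t.
Hypotheses (kappa_gt0 : 0 < kappa) (dx : der x (fun t => kappa * rho t)).
Hypothesis x_per : forall t, x (t + 2 * pi) = x t + 2 * pi.
Hypothesis x_tau : forall t, x (t + tau) = x t + tau.
Hypotheses (n3 : (2 < n)%N) (mc : kappa * m%:R < c).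

Lemma bform_rows N d1 d2 (A : 'M[R]_N) (P : 'M[R]_(d1, N)) (Q : 'M[R]_(d2, N)) a b :
  (P *m A *m Q^T) a b = bform A (row a P) (row b Q).
Proof.
rewrite /bform -row_mul [LHS]mxE [RHS]mxE; apply: eq_bigr => i _.
by congr (_ * _); rewrite !mxE.
Qed.

Definition galerkin_system N d (P : 'M[R]_(d, N)) := exists S : 'rV[R]_d,
  [/\ P *m gram rho N *m P^T = 1%:M, P *m stiff R N = diag_mx S *m P *m gram rho N
    & forall a, S 0 a <= c].

Lemma galerkin_join N d1 d2 (P1 : 'M[R]_(d1, N)) (P2 : 'M[R]_(d2, N)) :
  galerkin_system P1 -> galerkin_system P2 -> P1 *m gram rho N *m P2^T = 0 ->
  galerkin_system (col_mx P1 P2).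
Proof.
move=> [S1 [P11 L1 c1]] [S2 [P22 L2 c2]] P12; exists (row_mx S1 S2).
have P21 : P2 *m gram rho N *m P1^T = 0.
  by apply: trmx_inj; rewrite trmx0 !trmx_mul trmxK gram_sym mulmxA.
split.
- by rewrite mul_col_mx tr_col_mx mul_col_row P11 P12 P21 P22 -scalar_mx_block.
- by rewrite mul_col_mx L1 L2 diag_mx_row mul_block_col mul_col_mx !mul0mx add0r addr0.
- by move=> a; case: (split_ordP a) => b ->; rewrite ?row_mxEl ?row_mxEr.
Qed.

(** With [q = m %/ n] the vectors are the constant, [m - (2 q + 1)] nonresonant ones and [2 (q + 1)]
    resonant ones, in all [m + 2]. The two families are orthogonal because they lie in different
    blocks of the Gram matrix. *)
Lemma galerkin_eigenvectors : (0 < m %% n < n.-1)%N ->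
  exists K0, forall K, (K0 <= K)%N ->
  exists P : 'M[R]_(m.+2, K.*2.+1), galerkin_system P.
Proof.
move=> /andP[m0n mn].
have m0 : (0 < m)%N by case: (m) m0n => //; rewrite mod0n.
have /andP[tau0 taupi] := tau_small R n3.
have cardT : #|@trial_set R n m true| = ((m %/ n).*2.+1).*2.
  rewrite card_trial_true// {1}(divn_eq m n) rescountE//; last by lia.
  by rewrite m0n (ltn_eqF mn) addn0 addn1.
have c0 : 0 <= c by apply: ltW (le_lt_trans _ mc); rewrite mulr_ge0// ltW.
pose idx s (b : 'I_#|@trial_set R n m s|) : nat := enum_val b.
have idxP s (b : 'I_#|@trial_set R n m s|) : (0 < idx s b)%N && (resonant tau (idx s b) == s).
  by have := enum_valP b; rewrite finset.inE.
have idx_inj s : injective (@idx s) by move=> b1 b2 /val_inj/enum_val_inj.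
have idx_freq s b : (freq (@idx s b) <= m)%N.
  by have := ltn_ord (enum_val b); rewrite -/(idx s b) /freq uphalf_half -addnn; have := odd_double_half (idx s b); rewrite -addnn; lia.
have idx_gt0 s b : (0 < idx s b)%N by case/andP: (idxP s b).
have idx_side s b : resonant tau (idx s b) = s by case/andP: (idxP s b) => _ /eqP.
have [K1 hK1] := eigsys_single drho crho' prho prho' rho_gt0 rho_tau kappa_gt0 dx x_per x_tau
  (@idx_inj false) (@idx_gt0 false) (@idx_freq false) (@idx_side false) m0 mc.
have [K2 hK2] := eigsys_pairs drho crho' prho prho' rho_gt0 rho_tau kappa_gt0 dx x_per x_tau
  (sin_tau_neq0 R n3) (@idx_inj true) (@idx_gt0 true) (@idx_freq true) (@idx_side true) m0 mc.
have q_le : ((m %/ n).*2.+1 <= m)%N.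
  have := divn_eq m n; have : (2 * (m %/ n) <= m %/ n * n)%N by rewrite mulnC leq_mul2l (ltnW n3) orbT.
  by rewrite -addnn; lia.
pose d1 := (m - (m %/ n).*2.+1)%N; pose b2 := (m %/ n).+1.
exists (maxn K1 K2) => K; rewrite geq_max => /andP[KK1 KK2].
have [|P1 [S1 [PP1 PL1 Sc1 PD1 zP1]]] := hK1 K KK1 d1.
  by have := card_trial R n m; rewrite cardT /d1 -!addnn; lia.
have [|P2 [S2 [[PP2 PL2 Sc2 PD2 zP2] _]]] := hK2 K KK2 b2.
  by rewrite cardT /b2 -!addnn; lia.
have sysz : galerkin_system (unit_const rho K.*2).
  exists 0; split; first by apply: unit_const_norm => //; exact: drho.
    by rewrite unit_const_stiff linear0 !mul0mx.
  by move=> a; rewrite mxE.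
have sys1 : galerkin_system P1 by exists S1.
have sys2 : galerkin_system P2 by exists S2.
have P12 : P1 *m gram rho _ *m P2^T = 0.
  apply: trmx_inj; rewrite trmx0 !trmx_mul trmxK gram_sym mulmxA.
  apply/matrixP => a b; rewrite bform_rows [RHS]mxE.
  apply: (@block_orth _ _ (@side R tau true _)).
  - by move=> i j /side_neq; exact: gram_block.
  - exact: PD2.
  - by move=> i /= hi; apply: PD1; move: hi; rewrite /side; case: resonant.
have -> : m.+2 = (1 + (d1 + b2.*2))%N by rewrite /d1 /b2 -!addnn; move: q_le; rewrite -addnn; lia.
exists (col_mx (unit_const rho K.*2) (col_mx P1 P2)).
apply: galerkin_join => //; first exact: galerkin_join.
by rewrite tr_col_mx mul_mx_row zP1 zP2 row_mx0.
Qed.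

End GalerkinCount.

(** Limits along a single ultrafilter finer than the tails exist for all coordinates at once, in
    place of a diagonal extraction. Finitely many coordinates are then approximated by one index
    [K]. *)
Lemma bounded_cluster (R : realType) (I : finType) (y : nat -> I -> nat -> R)
    (B : nat -> R) (K0 : nat) :
  (forall K a i, (K0 <= K)%N -> `|y K a i| <= B i) ->
  exists phi : I -> nat -> R, forall (e : R) (M K1 : nat), 0 < e ->
    exists2 K, (K1 <= K)%N & forall a i, (i < M)%N -> `|y K a i - phi a i| <= e.
Proof.
move=> yB; have [U [UU FU]] := @ultraFilterLemma nat \oo _.
have lim a i : exists l : R, (fun K => y K a i) @ U --> l.
  have [|l [_ hl]] := @segment_compact R (- B i) (B i) ((fun K => y K a i) @ U) _.
    apply: FU; exists K0 => // K /= KK.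
    by rewrite in_itv/= -ler_norml; exact: yB.
  exists l => V Vl; have [//|UV] := in_ultra_setVsetC ((fun K => y K a i) @^-1` V) UU.
  by have [r [/= nVr Vr]] := hl (~` V) V UV Vl.
have /choice[phi hphi] : forall ai : I * nat, exists l : R, (fun K => y K ai.1 ai.2) @ U --> l.
  by move=> ai; exact: lim.
exists (fun a i => phi (a, i)) => e M K1 e0.
have near ai : U [set K | `|y K ai.1 ai.2 - phi ai| <= e].
  by have /cvgrPdist_le/(_ e e0) := hphi ai; apply: filterS => K; rewrite distrC.
have nearM : U [set K | forall ab : I * 'I_M, `|y K ab.1 ab.2 - phi (ab.1, ab.2 : nat)| <= e].
  by apply: filter_forall => ab; exact: (near (ab.1, ab.2 : nat)).
have nearK : U [set K | (K1 <= K)%N] by apply: FU; exists K1.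
have [K [h1 h2]] := filter_ex (filterI nearM nearK).
by exists K => // a i iM; exact: (h1 (a, Ordinal iM)).
Qed.

(** * Passage to the limit *)

Section MatrixDecay.
Variable R : realType.
Variable F : nat -> R -> R.
Hypothesis FT : ptower F.
Let rho := F 0%N.

Let crho : continuous rho.
Proof. by case: FT => dF _; exact: der_cont (dF 0%N). Qed.

Definition gap (i j : nat) : nat := (i - j + (j - i))%N.
Definition gramc (i j : nat) : R := cint (fun t => rho t * (fcos i t * fcos j t)).

(** A product of two basis functions consists of oscillations at the sum and the difference of the
    frequencies, both at least the gap of the frequencies in absolute value; the Fourier decay of
    the density applies to each. *)
Lemma gramc_decay s : exists2 C : R, 0 <= C &
  forall i j, `|gramc i j| * (1 + (gap i j)%:R) ^+ s <= C.
Proof.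
have [C hC] := ptower_decay s FT.
have C0 : 0 <= C by apply: le_trans (hC 0%N 0); rewrite mulr_ge0// exprn_ge0// addr_ge0.
exists (2 ^+ s * C) => [|i j]; first by rewrite mulr_ge0// exprn_ge0.
have hz (z : int) b (g : nat) : (g <= `|z|)%N ->
    `|cint (fun t => rho t * osc z%:~R b t)| * (1 + g%:R) ^+ s <= C.
  move=> gz; apply: (@le_trans _ _ (`|cint (fun t => rho t * osc z%:~R b t)| * (1 + `|z|%N%:R) ^+ s)).
    rewrite ler_wpM2l// lerXn2r ?nnegrE ?addr_ge0// lerD2l ler_nat//.
  case: z gz => k _; first exact: hC.
  by rewrite NegzE mulrNz oscN abszN; exact: hC.
set q := freq i; set q' := freq j.
have cc z b : continuous (fun t => 2^-1 * (rho t * osc z b t)).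
  by apply: contZ; apply: contM => //; exact: cont_osc.
have cc' z b : continuous (fun t => rho t * osc z b t).
  by apply: contM => //; exact: cont_osc.
have -> : gramc i j = 2^-1 * cint (fun t => rho t * osc (q%:Z - q'%:Z)%:~R (phase R i - phase R j) t) +
    2^-1 * cint (fun t => rho t * osc (q%:Z + q'%:Z)%:~R (phase R i + phase R j) t).
  rewrite -cintZ// -cintZ// -cintD//; apply: eq_cint => t.
  by rewrite oscM intrB intrD -!pmulrn; field.
pose g := gap q q'.
have gapE : (1 + gap i j <= 2 * (1 + g))%N.
  rewrite /g /gap /q /q' /freq !uphalf_half.
  have := odd_double_half i; have := odd_double_half j; rewrite -!addnn; lia.
apply: (@le_trans _ _ (`|2^-1 * cint (fun t => rho t * osc (q%:Z - q'%:Z)%:~R (phase R i - phase R j) t) +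
    2^-1 * cint (fun t => rho t * osc (q%:Z + q'%:Z)%:~R (phase R i + phase R j) t)| * (2 ^+ s * (1 + g%:R) ^+ s))).
  rewrite ler_wpM2l// -exprMn lerXn2r ?nnegrE ?mulr_ge0 ?addr_ge0//.
  by rewrite !nat1r -natrM ler_nat; exact: gapE.
rewrite mulrCA ler_wpM2l ?exprn_ge0//.
have h1 := hz (q%:Z - q'%:Z) (phase R i - phase R j) g _.
have h2 := hz (q%:Z + q'%:Z) (phase R i + phase R j) g _.
set X := cint _ in h1 *; set Y := cint _ in h2 *.
set E := (1 + g%:R) ^+ s in h1 h2 *.
have E0 : 0 <= E by rewrite exprn_ge0// addr_ge0.
apply: (@le_trans _ _ (2^-1 * (`|X| * E) + 2^-1 * (`|Y| * E))).
  rewrite !mulrA -mulrDl ler_wpM2r//; apply: le_trans (ler_normD _ _) _.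
  by rewrite !normrM !(@ger0_norm _ 2^-1).
have {}h1 : `|X| * E <= C by apply: h1; rewrite /g /gap; lia.
have {}h2 : `|Y| * E <= C by apply: h2; rewrite /g /gap; lia.
by lra.
Qed.

Lemma sum_gap_le (i N : nat) : \sum_(j < N) (1 + (gap i j)%:R)^-1 ^+ 2 <= 4 :> R.
Proof.
pose f d : R := (1 + d%:R)^-1 ^+ 2.
have f0 d : 0 <= f d by exact: sqr_ge0.
apply: (@le_trans _ _ (\sum_(0 <= j < i + N) f (gap i j))).
  rewrite -(big_mkord xpredT (fun j => f (gap i j))).
  by rewrite [leRHS](@big_cat_nat _ _ _ N)//= ?leq_addl// lerDl sumr_ge0.
rewrite (@big_cat_nat _ _ _ i)//= ?leq_addr//.
have -> : 4 = 2 + 2 :> R by ring.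
apply: lerD.
  rewrite big_nat_rev/= add0n big_mkord.
  apply: le_trans (sum_inv_sqr_le2 R i); apply: ler_sum => j _.
  rewrite /f lerXn2r ?nnegrE ?invr_ge0 ?addr_ge0// lef_pV2 ?posrE ?ltr_wpDr//.
  by rewrite lerD2l ler_nat /gap; have := ltn_ord j; lia.
rewrite -{1}[i]add0n big_addn addKn big_mkord.
apply: le_trans (sum_inv_sqr_le2 R N); apply: ler_sum => j _.
by rewrite /f (_ : gap i (j + i) = j)// /gap; lia.
Qed.

End MatrixDecay.

Section Limit.
Variables (R : realType) (F : nat -> R -> R) (c : R).
Hypotheses (FT : ptower F) (rho_gt0 : forall t, 0 < F 0%N t).
Let rho := F 0%N.

Let crho : continuous rho.
Proof. by case: FT => dF _; exact: der_cont (dF 0%N). Qed.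

Let prho : per rho.
Proof. by case: FT => _ pF; exact: pF. Qed.

Lemma freq_ge i : (0 < i)%N -> 1 + i%:R <= 3 * (freq i)%:R :> R.
Proof.
rewrite nat1r -natrM ler_nat /freq uphalf_half.
by have := odd_double_half i; rewrite -addnn; lia.
Qed.

(* Elliptic regularity: the eigenvalue equation trades one power of [1 + i]
   against the off-diagonal decay of the Gram matrix. *)
Lemma galerkin_decay (B0 : R) s : exists B : R, forall N (u : nat -> R) (e : R),
  0 <= e <= c -> (forall i, `|u i| <= B0) -> (forall i, (N <= i)%N -> u i = 0) ->
  (forall i, (i < N)%N ->
     pi * (freq i)%:R * u i = e * \sum_(j < N) u j * gramc F j i) ->
  forall i, `|u i| * (1 + i%:R) ^+ s <= B.
Proof.
elim: s => [|s [B IH]].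
  by exists B0 => N u e _ uB _ _ i; rewrite mulr1.
(* [s] powers carry the weight from index [j] to index [i], and two more make the sum over [j]
   converge. *)
have [C C0 hC] := gramc_decay FT s.+2.
have p0 := @pi_gt0 R.
exists (`|B0| + 3 / pi * (`|c| * (`|B| * C * 4))) => N u e ec uB u0 ueq i.
have /andP[e0 ec1] := ec.
have R0 : 0 <= 3 / pi * (`|c| * (`|B| * C * 4)).
  by rewrite !mulr_ge0// invr_ge0 ltW.
have [Ni|iN] := leqP N i; first by rewrite u0// normr0 mul0r addr_ge0.
have [i0|i0] := posnP i.
  rewrite i0 addr0 expr1n mulr1 (le_trans (uB _))// (le_trans (ler_norm B0))//.
  by rewrite lerDl.
have i1 : 0 <= 1 + i%:R :> R by rewrite addr_ge0.
apply: (@le_trans _ _ (3 / pi * (`|c| * (`|B| * C * 4)))); last by rewrite lerDr.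
rewrite exprS mulrA; apply: (@le_trans _ _ (`|u i| * (3 * (freq i)%:R) * (1 + i%:R) ^+ s)).
  by rewrite ler_wpM2r ?exprn_ge0// ler_wpM2l//; exact: freq_ge.
have -> : `|u i| * (3 * (freq i)%:R) = 3 / pi * `|pi * (freq i)%:R * u i|.
  rewrite !normrM (gtr0_norm p0) normr_nat; move: (lt0r_neq0 p0).
  by move: (pi : R) => q q0; field.
rewrite ueq// -!mulrA ler_wpM2l// ler_wpM2l ?invr_ge0 ?(ltW p0)// normrM -mulrA.
apply: ler_pM => //.
  by rewrite ger0_norm// (le_trans ec1)// ler_norm.
apply: (@le_trans _ _ (\sum_(j < N) `|B| * C * (1 + (gap i j)%:R)^-1 ^+ 2)); last first.
  by rewrite -mulr_sumr !mulrA ler_wpM2l ?mulr_ge0// sum_gap_le.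
apply: (@le_trans _ _ ((\sum_(j < N) `|u j * gramc F j i|) * (1 + i%:R) ^+ s)).
  by rewrite ler_wpM2r ?exprn_ge0// ler_norm_sum.
rewrite mulr_suml; apply: ler_sum => j _.
have g0 : 0 < 1 + (gap i j)%:R :> R by rewrite ltr_wpDr.
have hu := IH N u e ec uB u0 ueq j.
have hg := hC j i.
have gsym : gap j i = gap i j by rewrite /gap addnC.
rewrite gsym in hg.
have peetre : (1 + i%:R) ^+ s <= (1 + j%:R) ^+ s * (1 + (gap i j)%:R) ^+ s :> R.
  rewrite -exprMn lerXn2r ?nnegrE ?mulr_ge0 ?addr_ge0//.
  rewrite !nat1r -natrM ler_nat /gap; nia.
rewrite normrM; apply: (@le_trans _ _ (`|u j| * `|gramc F j i| * ((1 + j%:R) ^+ s * (1 + (gap i j)%:R) ^+ s))).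
  by rewrite ler_wpM2l ?mulr_ge0.
rewrite exprVn ler_pdivlMr ?exprn_gt0//.
have -> : `|u j| * `|gramc F j i| * ((1 + j%:R) ^+ s * (1 + (gap i j)%:R) ^+ s) * (1 + (gap i j)%:R) ^+ 2 =
    (`|u j| * (1 + j%:R) ^+ s) * (`|gramc F j i| * (1 + (gap i j)%:R) ^+ s.+2).
  by rewrite -[s.+2]addn2 exprD; ring.
apply: ler_pM => //.
exact: le_trans hu (ler_norm _).
Qed.

Definition ext N (u : 'rV[R]_N) (i : nat) : R := oapp (u 0) 0 (insub i : option 'I_N).

Lemma ext_ord N (u : 'rV[R]_N) (i : 'I_N) : ext u i = u 0 i.
Proof. by rewrite /ext valK. Qed.

Lemma ext_out N (u : 'rV[R]_N) i : (N <= i)%N -> ext u i = 0.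
Proof. by move=> Ni; rewrite /ext insubN// -leqNgt. Qed.

Lemma fseries_ext N (u : 'rV[R]_N) : fseries (ext u) = trig u.
Proof.
apply/funext => t; rewrite /fseries (@ssum_finite _ _ N) => [|i Ni]; last first.
  by rewrite ext_out// mul0r.
by apply: eq_bigr => i _; rewrite ext_ord.
Qed.

Lemma galerkin_row d N (P : 'M[R]_(d, N)) : galerkin_system rho c P -> forall a, exists e : R,
  0 <= e <= c /\ forall i, (i < N)%N ->
    pi * (freq i)%:R * ext (row a P) i = e * \sum_(j < N) ext (row a P) j * gramc F j i.
Proof.
move=> [S [PP PL Sc]] a; exists (S 0 a).
have uL : row a P *m stiff R N = S 0 a *: (row a P *m gram rho N).
  rewrite -!row_mul PL -mulmxA row_mul row_diag_mx -scalemxAl -rowE.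
  by rewrite row_mul.
have u1 : bform (gram rho N) (row a P) (row a P) = 1.
  by rewrite -bform_rows PP mxE eqxx.
have SE : S 0 a = bform (stiff R N) (row a P) (row a P).
  by rewrite /bform uL -scalemxAl mxE -/(bform _ _ _) u1 mulr1.
split.
  rewrite Sc andbT SE stiffE sumr_ge0// => i _.
  by rewrite -expr2 mulr_ge0 ?sqr_ge0// mulr_ge0 ?pi_ge0.
move=> i iN; have := congr1 (fun w : 'rV_N => w 0 (Ordinal iN)) uL.
rewrite mul_mx_diag !mxE => h.
rewrite -[i in ext _ i]/(nat_of_ord (Ordinal iN)) ext_ord [X in _ * X = _]mxE mulrC h.
by congr (_ * _); apply: eq_bigr => j _; rewrite ext_ord !mxE.
Qed.

Lemma galerkin_bound : exists B : R, forall d N (P : 'M[R]_(d, N)),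
  galerkin_system rho c P -> forall a i, `|ext (row a P) i| <= B.
Proof.
have [al al0 hal] := gram_coercive crho rho_gt0.
exists (1 + al^-1) => d N P [S [PP _ _]] a i.
have b0 : 0 <= 1 + al^-1 :> R by rewrite addr_ge0// invr_ge0 ltW.
have [Ni|iN] := leqP N i; first by rewrite ext_out// normr0.
rewrite -[i]/(nat_of_ord (Ordinal iN)) ext_ord; set j := Ordinal iN.
have : al * (row a P 0 j) ^+ 2 <= 1.
  have := hal N (row a P); rewrite -bform_rows PP mxE eqxx; apply: le_trans.
  rewrite ler_pM2l// (bigD1 j)//= lerDl sumr_ge0// => k _; exact: sqr_ge0.
rewrite mulrC -ler_pdivlMr// div1r => ui.
rewrite -(ler_sqr (normr_ge0 _) b0) real_normK ?num_real//.
apply: (le_trans ui); rewrite sqrrD expr1n mul1r.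
by have : 0 < al^-1 by [rewrite invr_gt0]; have := sqr_ge0 al^-1; lra.
Qed.

Lemma fseries_dist (u v : nat -> R) (C e : R) M t : sq_summable C u -> sq_summable C v ->
  (forall i, (i < M)%N -> `|u i - v i| <= e) ->
  `|fseries u t - fseries v t| <= M%:R * e + 4 * C / M.+1%:R.
Proof.
move=> uC vC uv.
have -> : fseries u t - fseries v t =
  (fseries u t - \sum_(i < M) u i * fcos i t) +
  \sum_(i < M) (u i - v i) * fcos i t +
  (\sum_(i < M) v i * fcos i t - fseries v t).
  have -> : \sum_(i < M) (u i - v i) * fcos i t =
      \sum_(i < M) u i * fcos i t - \sum_(i < M) v i * fcos i t.
    by rewrite -sumrB; apply: eq_bigr => i _; rewrite mulrBl.
  by ring.
have h1 := fseries_tail M t uC; have h2 := fseries_tail M t vC; rewrite distrC in h2.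
have h3 : `|\sum_(i < M) (u i - v i) * fcos i t| <= M%:R * e.
  apply: le_trans (ler_norm_sum _ _ _) _.
  apply: (@le_trans _ _ (\sum_(i < M) e)); last by rewrite sumr_const card_ord mulr_natl.
  apply: ler_sum => i _; rewrite normrM -[leRHS]mulr1.
  by apply: ler_pM => //; [exact: uv|exact: fcos_le1].
have -> : M%:R * e + 4 * C / M.+1%:R = 2 * C / M.+1%:R + M%:R * e + 2 * C / M.+1%:R by field; rewrite nat1r pnatr_eq0.
apply: le_trans (ler_normD _ _) _; apply: lerD => //.
by apply: le_trans (ler_normD _ _) _; apply: lerD.
Qed.

Lemma le_eps0 (x D : R) : (forall e : R, 0 < e -> `|x| <= D * e) -> x = 0.
Proof.
move=> h; apply: (@le_harmonic_eq0 _ x D) => N.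
by apply: h; rewrite invr_gt0.
Qed.

(** Uniform decay controls the tails, so closeness of finitely many coefficients gives uniform
    closeness of the series. The weak equation and the orthonormality thus pass to the limit, and
    [fourier_uniq] turns equality of coefficients into the pointwise equation. *)
Lemma galerkin_limit d :
  (exists K0, forall K, (K0 <= K)%N -> exists P : 'M[R]_(d, K.*2.+1), galerkin_system rho c P) ->
  exists (phi : 'I_d -> nat -> R) (e : 'I_d -> R),
  [/\ forall a, e a <= c,
      forall a s, exists C, forall i, `|phi a i| * (1 + i%:R) ^+ s <= C,
      forall a t, fseries (fun i => (freq i)%:R * phi a i) t = e a * (rho t * fseries (phi a) t) &
      forall a b, cint (fun t => rho t * (fseries (phi a) t * fseries (phi b) t)) = (a == b)%:R].
Proof.
move=> [K0 hK0].
have [B0 hB0] := galerkin_bound.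
(* Slot 0 of [y a] holds the eigenvalue and slot [i.+1] the coefficient of index [i], so that one
   cluster point captures both. Below [K0] the value is a dummy. *)
have /choice[y hy] K : exists y : 'I_d -> nat -> R, (K0 <= K)%N ->
    [/\ forall a, 0 <= y a 0%N <= c, forall a i, (K.*2.+1 <= i)%N -> y a i.+1 = 0,
      forall a i, (i < K.*2.+1)%N -> pi * (freq i)%:R * y a i.+1 =
        y a 0%N * \sum_(j < K.*2.+1) y a j.+1 * gramc F j i,
      forall a i, `|y a i.+1| <= B0 &
      forall a b, cint (fun t => rho t * (fseries (fun i => y a i.+1) t *
        fseries (fun i => y b i.+1) t)) = (a == b)%:R].
  have [KK|KK] := leqP K0 K; last by exists (fun _ _ => 0).
  have [P GP] := hK0 K KK.
  have /choice[e he] := galerkin_row GP.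
  exists (fun a i => if i is j.+1 then ext (row a P) j else e a) => _; split.
  - by move=> a; case: (he a).
  - by move=> a i; exact: ext_out.
  - by move=> a i; case: (he a) => _; apply.
  - by move=> a i; exact: hB0 GP a i.
  - move=> a b; have [S [PP _ _]] := GP.
    rewrite -[LHS]/(cint (fun t => rho t *
      (fseries (ext (row a P)) t * fseries (ext (row b P)) t))).
    by rewrite !fseries_ext -(gramE crho) -bform_rows PP mxE.
have [phi hphi] : exists phi : 'I_d -> nat -> R, forall (e : R) (M K1 : nat), 0 < e ->
    exists2 K, (K1 <= K)%N & forall a i, (i < M)%N -> `|y K a i - phi a i| <= e.
  apply: (@bounded_cluster R _ y (fun=> `|c| + `|B0|) K0) => K a i KK.
  have [h1 _ _ h4 _] := hy K KK; case: i => [|i].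
    have /andP[e0 ec] := h1 a; rewrite ger0_norm//.
    by rewrite (le_trans ec)// (le_trans (ler_norm c))// lerDl.
  by rewrite (le_trans (h4 a i))// (le_trans (ler_norm B0))// lerDr.
have decay s : exists B, (forall K a i, (K0 <= K)%N -> `|y K a i.+1| * (1 + i%:R) ^+ s <= B) /\
    forall a i, `|phi a i.+1| * (1 + i%:R) ^+ s <= B.
  have [B hB] := galerkin_decay B0 s; exists B.
  have h K a i : (K0 <= K)%N -> `|y K a i.+1| * (1 + i%:R) ^+ s <= B.
    move=> KK; have [h1 h2 h3 h4 _] := hy K KK.
    exact: (hB _ (fun i => y K a i.+1) (y K a 0%N) (h1 a) (h4 a) (h2 a) (h3 a) i).
  split=> // a i; have i0 : 0 < (1 + i%:R) ^+ s :> R by rewrite exprn_gt0// ltr_wpDr.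
  apply/ler_addgt0Pr => e e0.
  have [K KK /(_ a i.+1 (ltnSn _)) hK] := hphi (e / (1 + i%:R) ^+ s) i.+2 K0 (divr_gt0 e0 i0).
  have : `|phi a i.+1| <= `|y K a i.+1| + e / (1 + i%:R) ^+ s.
    rewrite -lerBlDl; apply: le_trans hK; rewrite distrC; exact: lerB_dist.
  rewrite -(ler_pM2r i0) mulrDl divfK ?gt_eqF// => /le_trans; apply.
  by rewrite lerD2r; exact: h.
have [C [yC phiC]] := decay 2%N.
have sy K a : (K0 <= K)%N -> sq_summable C (fun i => y K a i.+1).
  move=> KK i; rewrite exprVn ler_pdivlMr ?exprn_gt0 ?ltr_wpDr//; exact: yC.
have sphi a : sq_summable C (fun i => phi a i.+1).
  by move=> i; rewrite exprVn ler_pdivlMr ?exprn_gt0 ?ltr_wpDr//; exact: phiC.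
pose U K a := fseries (fun i => y K a i.+1); pose Phi a := fseries (fun i => phi a i.+1).
have approx (e : R) (i0 : nat) : 0 < e -> exists2 K, (K0 <= K)%N && (i0 <= K)%N & forall a,
    [/\ `|y K a 0%N - phi a 0%N| <= e, `|y K a i0.+1 - phi a i0.+1| <= e &
      forall t, `|U K a t - Phi a t| <= 2 * e].
  move=> e0.
  pose M := maxn i0.+1 (Num.bound (4 * `|C| / e)).
  have eM : 0 < e / M.+1%:R by rewrite divr_gt0.
  have [K] := hphi _ M.+1 (maxn K0 i0) eM; rewrite geq_max => /andP[KK iK] hK.
  exists K => [|a]; first by rewrite KK.
  have le_e : e / M.+1%:R <= e by rewrite ler_pdivrMr// ler_peMr ?(ltW e0)// ler1n.
  split; [by apply: le_trans (hK a 0%N isT) le_e| |].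
    by apply: le_trans (hK a i0.+1 _) le_e; rewrite ltnS leq_maxl.
  move=> t; have iM i : (i < M)%N -> `|y K a i.+1 - phi a i.+1| <= e / M.+1%:R.
    by move=> iM; apply: hK.
  apply: le_trans (fseries_dist t (sy K a KK) (sphi a) iM) _.
  have -> : 2 * e = e + e by ring.
  apply: lerD.
    rewrite mulrA ler_pdivrMr// mulrC ler_wpM2l ?(ltW e0)// ler_nat//.
  rewrite ler_pdivrMr// [e * _]mulrC -ler_pdivrMr//.
  apply: (@le_trans _ _ (4 * `|C| / e)); first by rewrite ler_wpM2r ?invr_ge0 ?(ltW e0)// ler_wpM2l// ler_norm.
  apply/ltW/(lt_le_trans (archi_boundP _)); first by rewrite divr_ge0 ?(ltW e0)// mulr_ge0.
  by rewrite ler_nat (leq_trans (leq_maxr i0.+1 _)).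
have [Br hBr] := per_bounded crho prho.
have Br0 : 0 <= Br := le_trans (normr_ge0 _) (hBr 0).
have cU K a : (K0 <= K)%N -> continuous (U K a) by move=> KK; exact: (cont_fseries (sy K a KK)).
have cPhi a : continuous (Phi a) by exact: (cont_fseries (sphi a)).
have dist (f g : R -> R) (e : R) : continuous f -> continuous g ->
    (forall t, `|f t - g t| <= e) -> `|cint f - cint g| <= 2 * pi * e.
  move=> cf cg fg; rewrite (_ : cint f - cint g = cint (fun t => f t + -1 * g t)).
    by apply: cint_abs => [|t]; [apply: contD => //; exact: contZ|rewrite mulN1r].
  by rewrite cintD ?cintZ ?mulN1r//; exact: contZ.
have UB K a t : (K0 <= K)%N -> `|U K a t| <= 2 * C.
  by move=> KK; apply: ssum_le; exact: fseries_summable (sy K a KK).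
have PhiB a t : `|Phi a t| <= 2 * C by apply: ssum_le; exact: fseries_summable (sphi a).
have C0 (a : 'I_d) : 0 <= C by exact: (sq_summable_ge0 (sphi a)).
have weak a i : pi * (freq i)%:R * phi a i.+1 = phi a 0%N * cint (fun t => rho t * (Phi a t * fcos i t)).
  have c1 (V : R -> R) : continuous V -> continuous (fun t => rho t * (V t * fcos i t)).
    by move=> cV; apply: contM => //; apply: contM => //; exact: cont_fcos.
  apply/subr0_eq/(@le_eps0 _ (pi * (freq i)%:R + 2 * pi * (Br * (2 * C)) + `|phi a 0%N| * (2 * pi * (Br * 2)))) => e e0.
  have [K /andP[KK iK] hK] := approx e i e0; have [ha hi ht] := hK a.
  have [_ h2 h3 _ _] := hy K KK.
  have eqK : pi * (freq i)%:R * y K a i.+1 = y K a 0%N * cint (fun t => rho t * (U K a t * fcos i t)).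
    rewrite h3; last by rewrite ltnS -addnn (leq_trans iK)// leq_addr.
    congr (_ * _); rewrite (@eq_cint _ _ (fun t => \sum_(j < K.*2.+1)
        y K a j.+1 * (rho t * (fcos j t * fcos i t)))).
      have cj (j : nat) : continuous (fun t => rho t * (fcos j t * fcos i t)).
        by apply: contM => //; apply: contM; exact: cont_fcos.
      rewrite cint_sum => [|j]; last exact: contZ.
      by apply: eq_bigr => j _; rewrite cintZ.
    move=> t; rewrite /U /fseries (@ssum_finite _ _ K.*2.+1) => [|j jK].
      by rewrite mulr_suml mulr_sumr; apply: eq_bigr => j _; ring.
    by rewrite h2// mul0r.
  have -> : pi * (freq i)%:R * phi a i.+1 - phi a 0%N * cint (fun t => rho t * (Phi a t * fcos i t)) =
      pi * (freq i)%:R * (phi a i.+1 - y K a i.+1) +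
      (y K a 0%N - phi a 0%N) * cint (fun t => rho t * (U K a t * fcos i t)) +
      phi a 0%N * (cint (fun t => rho t * (U K a t * fcos i t)) - cint (fun t => rho t * (Phi a t * fcos i t))).
    by rewrite [in RHS]mulrBr eqK; ring.
  have b1 : `|cint (fun t => rho t * (U K a t * fcos i t))| <= 2 * pi * (Br * (2 * C)).
    apply: cint_abs => [|t]; first exact: (c1 _ (cU K a KK)).
    rewrite normrM ler_pM// normrM -[leRHS]mulr1 ler_pM//; [exact: UB|exact: fcos_le1].
  have b2 : `|cint (fun t => rho t * (U K a t * fcos i t)) - cint (fun t => rho t * (Phi a t * fcos i t))|
      <= 2 * pi * (Br * (2 * e)).
    apply: dist => [||t]; [exact: (c1 _ (cU K a KK))|exact: (c1 _ (cPhi a))|].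
    rewrite -mulrBr -mulrBl normrM ler_pM// normrM -[leRHS]mulr1 ler_pM//; exact: fcos_le1.
  apply: le_trans (ler_normD _ _) _; rewrite [leRHS]mulrDl [X in _ <= X + _]mulrDl; apply: lerD.
    apply: le_trans (ler_normD _ _) _; apply: lerD.
      by rewrite normrM ger0_norm ?mulr_ge0 ?pi_ge0// distrC ler_wpM2l ?mulr_ge0 ?pi_ge0.
    by rewrite normrM mulrC ler_pM.
  by rewrite normrM -[leRHS]mulrA ler_wpM2l// (le_trans b2)// -!mulrA.
exists (fun a i => phi a i.+1), (fun a => phi a 0%N); split.
- move=> a; apply/ler_addgt0Pr => e e0.
  have [K /andP[KK _] /(_ a)[ha _ _]] := approx e 0%N e0.
  have [h1 _ _ _ _] := hy K KK; have /andP[_ h] := h1 a.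
  move: ha; rewrite distrC ler_norml => /andP[_]; rewrite lerBlDr => /le_trans; apply.
  by rewrite addrC lerD2r.
- by move=> a s; have [B [_ hB]] := decay s; exists B => i; exact: hB.
- move=> a t; apply/subr0_eq; set w := fun i => (freq i)%:R * phi a i.+1.
  (* One power more than for the function itself, because the coefficients are multiplied by the
     frequency. *)
  have [C3 [_ phiC3]] := decay 3%N.
  have sw : sq_summable C3 w.
    move=> i; have i1 : 0 < 1 + i%:R :> R by rewrite ltr_wpDr.
    rewrite exprVn ler_pdivlMr ?exprn_gt0//; apply: le_trans (phiC3 a i).
    rewrite /w normrM normr_nat [X in _ <= _ * X]exprS [leRHS]mulrA ler_wpM2r ?exprn_ge0 ?(ltW i1)//.
    rewrite mulrC ler_wpM2l// nat1r ler_nat /freq uphalf_half.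
    by have := odd_double_half i; rewrite -addnn; lia.
  have cw := cont_fseries sw.
  have cr : continuous (fun t => rho t * Phi a t) by exact: contM.
  pose g s := fseries w s + - phi a 0%N * (rho s * Phi a s).
  have -> : fseries w t - phi a 0%N * (rho t * fseries (fun i => phi a i.+1) t) = g t.
    by rewrite /g mulNr.
  apply: fourier_uniq.
  - by apply: contD => //; exact: contZ.
  - by move=> s; rewrite /g per_fseries prho /Phi per_fseries.
  move=> i; have cwi : continuous (fun s => fseries w s * fcos i s).
    by apply: contM => //; exact: cont_fcos.
  have cri : continuous (fun s => rho s * (Phi a s * fcos i s)).
    by apply: contM => //; apply: contM => //; exact: cont_fcos.
  rewrite (@eq_cint _ _ (fun s => fseries w s * fcos i s +
      - phi a 0%N * (rho s * (Phi a s * fcos i s)))); last first.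
    by move=> s; rewrite /g; ring.
  rewrite (cintD cwi (contZ cri)) (cintZ _ cri) (fseries_coef i sw) mulNr -weak.
  rewrite /w /fnorm; case: eqP => [->|_]; first by rewrite /freq /=; ring.
  by ring.
- move=> a b; apply/esym/subr0_eq/(@le_eps0 _ (2 * pi * (Br * (8 * C)))) => e e0.
  have [K /andP[KK _] hK] := approx e 0%N e0.
  have [_ _ hta] := hK a; have [_ _ htb] := hK b.
  have [_ _ _ _ h5] := hy K KK; rewrite -h5.
  have -> : 2 * pi * (Br * (8 * C)) * e = 2 * pi * (Br * (8 * C * e)) by ring.
  apply: dist.
  - by apply: contM => //; apply: contM; [exact: (cU K a)|exact: (cU K b)].
  - by apply: contM => //; apply: contM; exact: cPhi.
  move=> t; rewrite -mulrBr normrM ler_pM//.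
  have -> : fseries (fun i => y K a i.+1) t * fseries (fun i => y K b i.+1) t - Phi a t * Phi b t =
     (U K a t - Phi a t) * U K b t + Phi a t * (U K b t - Phi b t) by rewrite /U; ring.
  apply: le_trans (ler_normD _ _) _; rewrite !normrM.
  have -> : 8 * C * e = 2 * e * (2 * C) + 2 * C * (2 * e) by ring.
  by apply: lerD; apply: ler_pM => //; exact: UB.
Qed.

End Limit.

(* [x] is arc length for the boundary metric, rescaled to total length [2 * pi]. *)
Lemma steklov_on_circle (R : realType) (n m : nat) (F : nat -> R -> R) (c : R) :
  ptower F -> (forall t, 0 < F 0%N t) -> (forall t, F 0%N (t + 2 * pi / n%:R) = F 0%N t) ->
  (2 < n)%N -> (0 < m %% n < n.-1)%N -> 2 * pi * m%:R < c * cint (F 0%N) ->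
  exists (phi : 'I_m.+2 -> nat -> R) (e : 'I_m.+2 -> R),
  [/\ forall a, e a <= c,
      forall a s, exists C, forall i, `|phi a i| * (1 + i%:R) ^+ s <= C,
      forall a t, fseries (fun i => (freq i)%:R * phi a i) t = e a * (F 0%N t * fseries (phi a) t) &
      forall a b, cint (fun t => F 0%N t * (fseries (phi a) t * fseries (phi b) t)) = (a == b)%:R].
Proof.
move=> FT rho_gt0 rho_tau n3 mn mc; set rho := F 0%N in rho_gt0 rho_tau mc *.
have [dF pF] := FT.
have crho : continuous rho by exact: der_cont (dF 0%N).
have prho : per rho by exact: pF.
have p0 := twopi_gt0 R.
have L0 : 0 < cint rho.
  by apply: (@cint_gt0 _ _ 0) => //; [move=> t _; exact: ltW|rewrite lexx ltW].
have [X dX] := cont_primitive crho.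
pose kappa := 2 * pi / cint rho; pose x t := kappa * X t.
have kappa0 : 0 < kappa by rewrite divr_gt0.
have dx : der x (fun t => kappa * rho t) by exact: derZ.
have shiftX (b : R) : (forall t, rho (t + b) = rho t) -> forall t, x (t + b) - x t = x b - x 0.
  move=> rb t; have dxs : der (fun s => x (s + b)) (fun s => kappa * rho (s + b)).
    apply: (der_ext (der_comp dx (derD (@der_id R) (der_cst b)))) => // s.
    by rewrite addr0 mulr1.
  have dD : der (fun s => x (s + b) + -1 * x s) (fun=> 0).
    by apply: (der_ext (derD dxs (derZ (-1) dx))) => // s; rewrite rb; ring.
  by have := der0_cst t 0 dD; rewrite add0r !mulN1r.
have x_per t : x (t + 2 * pi) = x t + 2 * pi.
  rewrite -[LHS](subrK (x t)) shiftX// [LHS]addrC; congr (_ + _).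
  by rewrite /x -mulrBr -(cint_FTC dX crho) /kappa divfK// gt_eqF.
pose tau : R := 2 * pi / n%:R.
have n0 : n%:R != 0 :> R by rewrite pnatr_eq0; lia.
(* The increment of [x] over [tau] is a constant [d] by invariance of the density, and [n] such
   increments make up [2 * pi]; hence [d = tau]. *)
have x_tau t : x (t + tau) = x t + tau.
  have h := shiftX _ rho_tau; set d := x tau - x 0.
  have hk (k : nat) : x (t + k%:R * tau) = x t + k%:R * d.
    elim: k => [|k IH]; first by rewrite !mul0r !addr0.
    rewrite -natr1 !mulrDl !mul1r !addrA -IH.
    by rewrite -[LHS](subrK (x (t + k%:R * tau))) h -/tau [LHS]addrC addrA.
  have := hk n; rewrite /tau mulrC divfK// x_per => /addrI e.
  have e2 : tau = d by rewrite /tau e mulrC mulKf.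
  by rewrite -[LHS](subrK (x t)) h [LHS]addrC; congr (_ + _); exact: esym e2.
have mc' : kappa * m%:R < c by rewrite /kappa mulrAC ltr_pdivrMr.
apply: galerkin_limit => //.
exact: (galerkin_eigenvectors (dF 0%N) (der_cont (dF 1%N)) prho (pF 1%N) rho_gt0
  rho_tau kappa0 dx x_per x_tau n3 mc' mn).
Qed.

(** * Smooth harmonic extensions *)

Section Cutoff.
Variable R : realType.
Implicit Types (f g : R -> R) (t h : R) (p s : nat).

Definition tower (F : nat -> R -> R) := forall s, der (F s) (F s.+1).

(** Smoothness from closure: choice selects a derivative inside the class, which is then
    iterated. *)
Lemma class_tower (P : (R -> R) -> Prop) f :
  (forall f, P f -> exists2 f', P f' & der f f') -> P f ->
  exists2 F, F 0%N = f & tower F.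
Proof.
move=> hP Pf.
have /choice[D hD] g : exists g', P g -> P g' /\ der g g'.
  by have [/hP[g' Pg' dg]|nPg] := pselect (P g); [exists g'|exists g].
have PF s : P (iter s D f) by elim: s => //= s IH; case: (hD _ IH).
exists (fun s => iter s D f) => // s; by case: (hD _ (PF s)).
Qed.

Lemma is_derive_quadratic f t l C :
  (forall h, `|h| <= 1 -> `|f (t + h) - f t - h * l| <= C * h ^+ 2) -> is_derive t 1 f l.
Proof.
move=> fC; have C0 : 0 <= C.
  by have := fC 1; rewrite normr1 lexx expr1n mulr1 => /(_ isT); apply: le_trans.
have cv : h^-1 *: ((f \o shift t) (h *: (1 : R)) - f t) @[h --> 0^'] --> l.
  apply/cvgrPdist_le => e e0; near=> h.
  have h0 : h != 0 by near: h; exact: nbhs_dnbhs_neq.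
  have hn : 0 < `|h| by rewrite normr_gt0.
  have h1 : `|h| <= 1.
    by near: h; apply: dnbhs0_le; exact: ltr01.
  have he : `|h| <= e / (C + 1).
    by near: h; apply: dnbhs0_le; rewrite divr_gt0// ltr_wpDl.
  rewrite /= /shift/= [h *: 1]mulr1 [h + t]addrC -[l](mulKf h0) -mulrBr normrM normfV.
  rewrite ler_pdivrMl// distrC (le_trans (fC h h1))//.
  rewrite -[h ^+ 2]real_normK ?num_real// expr2 mulrA mulrC ler_wpM2l//.
  apply: le_trans (_ : (C + 1) * `|h| <= _); first by rewrite ler_wpM2r// lerDl.
  by rewrite mulrC -ler_pdivlMr// ltr_wpDl.
by split; [apply/cvg_ex; exists l|exact/cvg_lim].
Unshelve. all: by end_near. Qed.

(** The flat function [exp (- 1 / t)] with negative powers of [t] attached, which makes the family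
    closed under differentiation up to linear combinations. *)
Definition flat p t : R := if 0 < t then t^-1 ^+ p * expR (- t^-1) else 0.

(** With [y = 1 / t], the exponential of [y] dominates [(y / (p + 2)) ^+ (p + 2)]. A bound quadratic
    in [t] is what gives derivative 0 at the origin. *)
Lemma flat_le p t : `|flat p t| <= (p.+2%:R) ^+ p.+2 * t ^+ 2.
Proof.
rewrite /flat; case: ifP => [t0|_]; last by rewrite normr0 mulr_ge0 ?sqr_ge0// exprn_ge0.
have y0 : 0 < t^-1 by rewrite invr_gt0.
rewrite ger0_norm ?mulr_ge0 ?exprn_ge0 ?expR_ge0 ?(ltW y0)//.
move: t^-1 y0 (invrK t) => y y0 <-.
rewrite expRN ler_pdivrMr ?expR_gt0//.
have n0 : 0 < p.+2%:R :> R by [].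
have : (y / p.+2%:R) ^+ p.+2 <= expR y.
  have -> : expR y = expR (y / p.+2%:R) ^+ p.+2.
    by rewrite -expRM_natl -mulr_natl mulrC divfK// gt_eqF.
  rewrite lerXn2r ?nnegrE ?expR_ge0 ?divr_ge0 ?(ltW y0)//.
  by apply: le_trans (expR_ge1Dx _); rewrite lerDr.
rewrite expr_div_n ler_pdivrMr ?exprn_gt0// => h.
have -> : y ^+ p = y ^+ p.+2 * y^-1 ^+ 2.
  by rewrite -[p.+2]addn2 exprD exprVn mulfK// expf_neq0// gt_eqF.
rewrite [leRHS]mulrAC ler_wpM2r ?sqr_ge0//.
by rewrite mulrC.
Qed.

Lemma der_pow p : der (fun t => t ^+ p) (fun t => p%:R * t ^+ p.-1).
Proof.
elim: p => [|p IH]; first by apply: (der_ext (der_cst 1)) => // t; rewrite mul0r.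
apply: (der_ext (derM (@der_id R) IH)) => t; first by rewrite exprS.
by rewrite -natr1; case: p {IH} => [|p]; rewrite ?exprS /=; ring.
Qed.

Lemma is_derive_mul f g t (a b : R) : is_derive t 1 f a -> is_derive t 1 g b ->
  is_derive t 1 (fun u => f u * g u) (a * g t + f t * b).
Proof.
move=> df dg; apply: is_derive_eq.
by rewrite /GRing.scale/=; ring.
Qed.

Lemma der_flat p : der (flat p) (fun t => flat p.+2 t + - p%:R * flat p.+1 t).
Proof.
move=> t; have [t0|t0|->] := ltgtP t 0.
- have -> : flat p.+2 t + - p%:R * flat p.+1 t = 0.
    by rewrite /flat ltNge (ltW t0)/= mulr0 addr0.
  apply: near_eq_is_derive (is_derive_cst 0 t 1); near=> s.
  rewrite /flat ltNge ltW//; near: s; exact: lt_nbhsl.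
- have dg : is_derive t 1 (fun s : R => s^-1 ^+ p * expR (- s^-1))
      (flat p.+2 t + - p%:R * flat p.+1 t).
    have dV : is_derive t 1 (fun s : R => s^-1) (- t ^- 2).
      apply: is_derive_eq; first exact: (@is_deriveV R id t 1 1 (lt0r_neq0 t0) (is_derive_id _ _)).
      by rewrite /GRing.scale/= mulr1.
    have dexpN : der (fun y : R => expR (- y)) (fun y => - expR (- y)).
      apply: (der_ext (der_comp (@der_exp R) (derZ (-1) (@der_id R)))) => y.
        by rewrite mulN1r.
      by rewrite mulN1r mulr1 mulrN1.
    have dE : is_derive t 1 (fun s : R => expR (- s^-1)) (- expR (- t^-1) * - t ^- 2).
      exact: (@is_derive1_comp _ (fun y : R => expR (- y)) (fun s : R => s^-1) t _ _ (dexpN _) dV).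
    have dP : is_derive t 1 (fun s : R => s^-1 ^+ p) (p%:R * t^-1 ^+ p.-1 * - t ^- 2).
      exact: (@is_derive1_comp _ (fun y : R => y ^+ p) (fun s : R => s^-1) t _ _ (der_pow p _) dV).
    have := is_derive_mul dP dE; congr is_derive.
    rewrite /flat t0 /= -exprVn.
    by case: p {dP} => [|p] /=; rewrite ?exprS ?expr0; ring.
  apply: near_eq_is_derive dg; near=> s.
  by rewrite /flat ifT//; near: s; exact: lt_nbhsr.
- rewrite /flat ltxx mulr0 addr0; apply: (@is_derive_quadratic _ _ _ (p.+2%:R ^+ p.+2)) => h _.
  by rewrite add0r ltxx mulr0 !subr0; exact: flat_le.
Unshelve. all: by end_near. Qed.

(** Equal to 1 for [t <= 0] and to [1 - exp (1 - 1 / t)] for [t > 0], hence 0 at [t = 1] and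
    negative beyond. Composed with [flat 0] and multiplied by [expR 1], it gives the cutoff. *)
Let inside t := 1 + - expR 1 * flat 0 t.

Inductive flat_class : (R -> R) -> Prop :=
| flat_class_flat p : flat_class (flat p)
| flat_class_comp p : flat_class (fun t => flat p (inside t))
| flat_class_cst a : flat_class (fun=> a)
| flat_class_add f g : flat_class f -> flat_class g -> flat_class (fun t => f t + g t)
| flat_class_mul f g : flat_class f -> flat_class g -> flat_class (fun t => f t * g t).

Lemma flat_class_der f : flat_class f -> exists2 f', flat_class f' & der f f'.
Proof.
have dflat p : exists2 f', flat_class f' & der (flat p) f'.
  exists (fun t => flat p.+2 t + - p%:R * flat p.+1 t); last exact: der_flat.
  apply: flat_class_add; first exact: flat_class_flat.
  by apply: flat_class_mul; [exact: flat_class_cst|exact: flat_class_flat].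
elim=> [p|p|a|f1 g1 _ [f' Ff df] _ [g' Fg dg]|f1 g1 F1 [f' Ff df] G1 [g' Fg dg]].
- exact: dflat.
- have dins : der inside (fun t => 0 + - expR 1 * (flat 2 t + - 0%:R * flat 1 t)).
    by apply: derD; [exact: der_cst|apply: derZ; exact: der_flat].
  exists (fun t => (flat p.+2 (inside t) + - p%:R * flat p.+1 (inside t)) *
     (0 + - expR 1 * (flat 2 t + - 0%:R * flat 1 t))); last exact: (der_comp (der_flat p) dins).
  repeat first [exact: flat_class_comp|exact: flat_class_flat|exact: flat_class_cst
    |apply: flat_class_mul|apply: flat_class_add].
- by exists (fun=> 0); [exact: flat_class_cst|exact: der_cst].
- by exists (fun t => f' t + g' t); [exact: flat_class_add|exact: derD].
- exists (fun t => f' t * g1 t + f1 t * g' t); last exact: derM.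
  by apply: flat_class_add; exact: flat_class_mul.
Qed.

Lemma tower_vanish (F : nat -> R -> R) (A : set R) (a : R) : tower F -> open A ->
  (forall t, A t -> F 0%N t = a) -> forall s t, A t -> F s.+1 t = 0.
Proof.
move=> dF oA FA; elim=> [|s IH] t At.
  have : is_derive t 1 (F 0%N) 0.
    apply: near_eq_is_derive (is_derive_cst a t 1).
    by have := open_nbhs_nbhs (conj oA At); apply: filterS => u Au; rewrite FA.
  by move=> d0; rewrite -(@derive_val _ _ _ _ _ _ _ (dF 0%N t)) (@derive_val _ _ _ _ _ _ _ d0).
have d0 : is_derive t 1 (F s.+1) 0.
  apply: near_eq_is_derive (is_derive_cst 0 t 1).
  by have := open_nbhs_nbhs (conj oA At); apply: filterS => u Au; rewrite IH.
by rewrite -(@derive_val _ _ _ _ _ _ _ (dF s.+1 t)) (@derive_val _ _ _ _ _ _ _ d0).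
Qed.

Lemma cutoff : exists chi : nat -> R -> R,
  [/\ tower chi, forall t, t <= 0 -> chi 0%N t = 1, forall s t, t <= 0 -> chi s.+1 t = 0,
      forall s t, 1 < t -> chi s t = 0 & forall s, exists B, forall t, `|chi s t| <= B].
Proof.
pose chi0 t := expR 1 * flat 0 (inside t).
have c0 : flat_class chi0 by apply: flat_class_mul; [exact: flat_class_cst|exact: flat_class_comp].
have [chi chiE dchi] := class_tower flat_class_der c0.
have left t : t <= 0 -> chi 0%N t = 1.
  move=> t0; have f0 : flat 0 t = 0 by rewrite /flat ltNge t0.
  rewrite chiE /chi0 /inside f0 mulr0 addr0 /flat ltr01 expr0 mul1r invr1.
  by rewrite -expRD subrr expR0.
have right t : 1 < t -> chi 0%N t = 0.
  move=> t1; have t0 : 0 < t by apply: lt_trans t1.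
  rewrite chiE /chi0 (_ : flat 0 (inside t) = 0) ?mulr0// /flat ifF//.
  apply/negbTE; rewrite -leNgt /inside /flat t0 expr0 mul1r mulNr -expRD subr_le0.
  rewrite -expR0 ler_expR subr_ge0.
  have : t^-1 <= 1 by rewrite invf_le1 ?(ltW t1).
  by rewrite ?expR0.
have left' s t : t < 0 -> chi s.+1 t = 0.
  apply: (@tower_vanish _ [set u | u < 0] 1 dchi (@open_lt R 0)) => u /ltW; exact: left.
have right' s t : 1 < t -> chi s t = 0.
  case: s => [|s]; first exact: right.
  exact: (@tower_vanish _ [set u | 1 < u] 0 dchi (@open_gt R 1)).
have at0 s : chi s.+1 0 = 0.
  have cs : continuous (chi s.+1) by exact: der_cont (dchi s.+1).
  apply/eqP; rewrite -normr_eq0; apply/eqP; apply: contrapT => /eqP n0.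
  have {}n0 : 0 < `|chi s.+1 0| by rewrite lt0r n0 normr_ge0.
  have /cvgrPdist_lt/(_ _ n0)[d /= d0 hd] := cs 0.
  have := hd (- (d / 2)); rewrite /= sub0r opprK ger0_norm ?divr_ge0 ?(ltW d0)//.
  rewrite ltr_pdivrMr// ltr_pMr// ltr1n => /(_ isT).
  have n2 : - (d / 2) < 0 by rewrite ltrNl oppr0 divr_gt0.
  by rewrite (left' _ _ n2) subr0 ltxx.
exists chi; split => //.
  by move=> s t; rewrite le_eqVlt => /predU1P[->|]; [exact: at0|exact: left'].
move=> s; have cs : continuous (fun t => `|chi s t|).
  by move=> t; apply: cvg_norm; exact: der_cont (dchi s) t.
have [c _ hc] := @EVT_max R (fun t => `|chi s t|) 0 1 ler01 (continuous_subspaceT cs).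
exists (1 + `|chi s c|) => t.
have [t0|t0] := leP t 0.
  case: s {cs hc} t0 => [|s] t0; first by rewrite left// normr1 lerDl.
  rewrite (_ : chi s.+1 t = 0) ?normr0 ?addr_ge0//.
  by move: t0; rewrite le_eqVlt => /predU1P[->|]; [exact: at0|exact: left'].
have [t1|t1] := leP t 1; last by rewrite right'// normr0 addr_ge0.
by rewrite (le_trans (hc t _)) ?lerDr// in_itv/= (ltW t0).
Qed.

End Cutoff.

Lemma quadratic_is_diff (R : realType) (V W : normedModType R) (f : V -> W)
    (L : {linear V -> W}) (p : V) (C : R) : continuous L ->
  (forall v, `|v| <= 1 -> `|f (p + v) - f p - L v| <= C * `|v| ^+ 2) ->
  is_diff p f L.
Proof.
move=> cL fC.
have dL : f \o shift p = cst (f p) + (L : V -> W) +o_ 0 id.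
  apply/eqaddoP => e e0; near=> v.
  have v1 : `|v| <= 1.
    near: v; apply/nbhs_ballP; exists 1 => //= v.
    by rewrite -ball_normE /= sub0r normrN => /ltW.
  have ve : `|v| <= e / (`|C| + 1).
    near: v; apply/nbhs_ballP; exists (e / (`|C| + 1)) => /=.
      by rewrite divr_gt0// ltr_wpDl.
    by move=> v; rewrite -ball_normE /= sub0r normrN => /ltW.
  rewrite !fctE /= /shift /= [v + p]addrC opprD addrA.
  apply: le_trans (fC v v1) _.
  rewrite expr2 mulrA ler_wpM2r//.
  apply: le_trans (_ : (`|C| + 1) * `|v| <= _); last by rewrite mulrC -ler_pdivlMr// ltr_wpDl.
  by rewrite ler_wpM2r// (le_trans (ler_norm _))// lerDl.
have dE := diff_unique cL dL; apply: DiffDef => //.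
by apply/diff_locallyP; rewrite dE.
Unshelve. all: by end_near. Qed.

(** * Differential calculus on the plane *)

Section PlaneCalculus.
Variable R : realType.
Implicit Types (f : plane R -> R) (g : 'I_2 -> plane R -> R) (p q v : plane R).

Lemma entry_le v i : `|v 0 i| <= `|v|.
Proof.
rewrite [leRHS]/Num.Def.normr/= mx_normrE.
exact: (@le_bigmax _ _ _ _ (fun ij : 'I_1 * 'I_2 => `|v ij.1 ij.2|) (0, i)).
Qed.

Lemma ord2_case (i : 'I_2) : i = 0 \/ i = 1.
Proof. by case: i => -[|[|]]// i; [left|right]; exact/val_inj. Qed.

Lemma sum2 (F : 'I_2 -> R) : \sum_i F i = F 0 + F 1.
Proof. by rewrite big_ord_recl big_ord1; congr (_ + F _); exact/val_inj. Qed.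

Definition lincomb (c : 'I_2 -> R) v : R := \sum_i v 0 i * c i.

Lemma lincomb2 c v : lincomb c v = v 0 0 * c 0 + v 0 1 * c 1.
Proof. exact: sum2. Qed.

Lemma lincomb_le c v B : (forall i, `|c i| <= B) -> `|lincomb c v| <= 2 * B * `|v|.
Proof.
move=> cB; apply: le_trans (ler_norm_sum _ _ _) _.
apply: le_trans (ler_sum _ (_ : forall i, true -> _ <= B * `|v|)) _.
  by move=> i _; rewrite normrM mulrC ler_pM// entry_le.
by rewrite sumr_const card_ord -mulrnAl -mulr_natl.
Qed.

Lemma lincomb_linear c : linear (lincomb c).
Proof. by move=> a u v; rewrite !lincomb2 !mxE/= /GRing.scale/=; ring. Qed.

Lemma lincomb_continuous c : continuous (lincomb c).
Proof.
apply: cont_sum => i; apply: contM; [exact: coord_continuous|exact: cont_cst].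
Qed.

Definition grad f g := forall p, is_diff p f (lincomb (g^~ p)).

Lemma is_diff_quadratic f c p C :
  (forall v, `|v| <= 1 -> `|f (p + v) - f p - lincomb c v| <= C * `|v| ^+ 2) ->
  is_diff p f (lincomb c).
Proof.
pose L : {linear plane R -> R} := HB.pack (lincomb c)
  (GRing.isLinear.Build _ _ _ _ _ (lincomb_linear c)).
exact: (@quadratic_is_diff R _ _ f L p C (@lincomb_continuous c)).
Qed.

Lemma grad_ext f g f1 g1 : grad f g -> f =1 f1 -> (forall i, g i =1 g1 i) -> grad f1 g1.
Proof.
move=> df /funext <- gg p; have -> : g1^~ p = g^~ p by apply/funext => i; rewrite gg.
exact: df.
Qed.

Lemma grad_cst (a : R) : grad (fun=> a) (fun _ _ => 0).
Proof.
move=> p; have := is_diff_cst a p; congr is_diff_def.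
by apply/funext => v; rewrite lincomb2 !mulr0 addr0.
Qed.

Lemma grad_coord i : grad (fun p => p 0 i) (fun l _ => (l == i)%:R).
Proof.
move=> p; apply: (@is_diff_quadratic _ _ _ 0) => v _.
rewrite /lincomb (bigD1 i)//= eqxx mulr1 big1 ?addr0; last first.
  by move=> l /negbTE ->; rewrite mulr0.
have -> : (p + v) 0 i = p 0 i + v 0 i by rewrite mxE.
by rewrite addrAC addrK subrr normr0 mul0r.
Qed.

Lemma gradD f1 g1 f2 g2 : grad f1 g1 -> grad f2 g2 ->
  grad (fun p => f1 p + f2 p) (fun i p => g1 i p + g2 i p).
Proof.
move=> d1 d2 p; have := is_diffD (d1 p) (d2 p); congr is_diff_def.
by apply/funext => v; rewrite !fctE !lincomb2; ring.
Qed.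

Lemma gradM f1 g1 f2 g2 : grad f1 g1 -> grad f2 g2 ->
  grad (fun p => f1 p * f2 p) (fun i p => g1 i p * f2 p + f1 p * g2 i p).
Proof.
move=> d1 d2 p; have := is_diffM (d1 p) (d2 p); congr is_diff_def.
by apply/funext => v; rewrite !fctE !lincomb2 /GRing.scale /=; ring.
Qed.

Lemma gradZ (a : R) f g : grad f g -> grad (fun p => a * f p) (fun i p => a * g i p).
Proof.
move=> df; apply: (grad_ext (gradM (grad_cst a) df)) => // i p.
by rewrite mul0r add0r.
Qed.

Lemma der_is_diff (h h' : R -> R) t : der h h' -> is_diff t h (fun y => y * h' t).
Proof.
move=> dh; have [hd hv] := dh t; have hd' : differentiable h t by exact/derivable1_diffP.
by apply: DiffDef => //; rewrite diff1E//; apply/funext => y; rewrite derive1E hv.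
Qed.

Lemma grad_der (h h' : R -> R) f g : der h h' -> grad f g ->
  grad (fun p => h (f p)) (fun i p => h' (f p) * g i p).
Proof.
move=> dh df p; have := is_diff_comp (df p) (der_is_diff (f p) dh); congr is_diff_def.
by apply/funext => v; rewrite /= !lincomb2; ring.
Qed.

Lemma grad_derive f g p v : grad f g -> 'D_v f p = lincomb (g^~ p) v.
Proof. by move=> df; have [fd fv] := df p; rewrite deriveE// fv. Qed.

Lemma grad_partial f g i : grad f g -> partial i f = g i.
Proof.
move=> df; apply/funext => p; rewrite /partial (grad_derive _ _ df).
rewrite /lincomb (bigD1 i)//= big1 ?addr0 ?mxE ?eqxx ?mul1r// => l li.
by rewrite mxE eqxx (negbTE li) mul0r.
Qed.

Lemma grad_line f g p v : grad f g ->
  der (fun t => f (p + t *: v)) (fun t => lincomb (g^~ (p + t *: v)) v).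
Proof.
move=> df t; have [fd fv] := df (p + t *: v).
have dline : is_diff t (fun s : R => p + s *: v) (fun s => s *: v).
  have := is_diffD (is_diff_cst p t) (is_diff_scalel t v); congr is_diff_def.
  by apply/funext => s; rewrite !fctE add0r.
have := is_diff_comp dline (df (p + t *: v)) => -[cd cv].
split; first exact/derivable1_diffP.
by rewrite deriveE// cv /= scale1r.
Qed.

(** The mean value theorem along the segment, applied to the gradient and to [f] minus its linear
    part. The constant is explicit so that the remainders of a series can be summed. *)
Lemma grad_taylor f g (h : 'I_2 -> 'I_2 -> plane R -> R) p v B : grad f g ->
  (forall i, grad (g i) (h i)) ->
  (forall i l q, `|q| <= `|p| + 1 -> `|h i l q| <= B) -> `|v| <= 1 ->
  `|f (p + v) - f p - lincomb (g^~ p) v| <= 4 * B * `|v| ^+ 2.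
Proof.
move=> df dg hB v1.
have B0 : 0 <= B by apply: le_trans (hB 0 0 p _); rewrite ?normr_ge0 ?lerDl.
have inc (k k' : R -> R) C t : der k k' -> 0 <= t <= 1 ->
    (forall s, 0 <= s <= 1 -> `|k' s| <= C) -> `|k t - k 0| <= C * t.
  move=> dk /andP[t0 t1] kC; have [s st ->] := der_mvt t0 dk.
  rewrite subr0 normrM (ger0_norm t0) ler_wpM2r// kC//.
  by case/andP: st => -> /le_trans; apply.
have gB i s : 0 <= s <= 1 -> `|g i (p + s *: v) - g i p| <= 2 * B * `|v|.
  move=> s01; have := inc _ _ (2 * B * `|v|) s (grad_line p v (dg i)) s01.
  rewrite scale0r addr0 => H; apply: le_trans (H _) _.
    move=> u /andP[u0 u1]; apply: lincomb_le => l; apply: hB.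
    apply: le_trans (ler_normD _ _) _; rewrite lerD2l normrZ (ger0_norm u0).
    by rewrite mulr_ile1.
  by rewrite ler_piMr ?mulr_ge0//; case/andP: s01.
pose k t := f (p + t *: v) - t * lincomb (g^~ p) v.
have dk : der k (fun t => lincomb (fun i => g i (p + t *: v) - g i p) v).
  apply: (der_ext (derD (grad_line p v df) (derZ (- lincomb (g^~ p) v) (@der_id R)))) => t.
    by rewrite /k; ring.
  by rewrite !lincomb2; ring.
have := inc k _ (4 * B * `|v| ^+ 2) 1 dk; rewrite /k scale1r mul1r scale0r mul0r subr0 addr0 mulr1.
rewrite addrAC ler01 lexx; apply => // s s01.
apply: le_trans (lincomb_le _ (fun i => gB i s s01)) _.
by rewrite expr2 le_eqVlt; apply/orP; left; apply/eqP; ring.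
Qed.

(** Every iterated partial derivative stays in the class, and every member of the class is
    differentiable. *)
Lemma smooth_closed (P : set (plane R -> R)) f :
  (forall f, P f -> exists2 g, grad f g & forall i, P (g i)) -> P f -> smooth f.
Proof.
move=> Pg Pf s p.
suff {p} : P (foldr (@partial R) f s) by move=> /Pg[g gd _]; case: (gd p).
elim: s => //= i s /Pg[g gd]; by rewrite (grad_partial i gd).
Qed.

Lemma smooth_grad f : smooth f -> grad f (fun i => partial i f) /\ forall i, smooth (partial i f).
Proof.
move=> sf; split=> [p|i s p]; last by have := sf (rcons s i) p; rewrite foldr_rcons.
have fd := sf [::] p; apply: DiffDef => //; apply/funext => v.
rewrite {1}[v]row_sum_delta linear_sum; apply: eq_bigr => i _.
by rewrite linearZ /partial deriveE.
Qed.

End PlaneCalculus.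

(** * Harmonic extension of rapidly decaying Fourier series *)

Section Extension.
Variables (R : realType) (chi : nat -> R -> R).
Hypothesis chi_tower : tower chi.
Hypothesis chi_one : forall t, t <= 0 -> chi 0%N t = 1.
Hypothesis chi_flat : forall s t, t <= 0 -> chi s.+1 t = 0.
Hypothesis chi_supp : forall s t, 1 < t -> chi s t = 0.
Hypothesis chi_bounded : forall s, exists B, forall t, `|chi s t| <= B.
Implicit Types (p q v : plane R) (b c : bool) (i : 'I_2) (j k s : nat)
  (f : nat -> plane R -> R) (u : nat -> R).

Let I2_01 : (0 == 1 :> 'I_2) = false. Proof. by []. Qed.
Let I2_10 : (1 == 0 :> 'I_2) = false. Proof. by []. Qed.

(* [zpow false k] and [zpow true k] are the real and imaginary parts of [z ^ k]. *)
Fixpoint zpow c k p : R := if k is k'.+1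
  then p 0 0 * zpow c k' p + (-1) ^+ (~~ c) * (p 0 1 * zpow (~~ c) k' p) else (~~ c)%:R.

(** The second partial derivative of [z ^ k] carries a factor [i], which exchanges real and
    imaginary parts; [zsign] is the resulting sign. *)
Definition flip i c : bool := (i == 1) (+) c.
Definition zsign i c : R := (-1) ^+ ((i == 1) && ~~ c).

Definition rsq p : R := p 0 0 ^+ 2 + p 0 1 ^+ 2.

Lemma grad_zpow c k :
  grad (zpow c k) (fun i p => k%:R * (zsign i c * zpow (flip i c) k.-1 p)).
Proof.
elim: k c => [|k IH] c.
  by apply: (grad_ext (grad_cst (~~ c)%:R)) => // i p; rewrite mul0r.
apply: (grad_ext (gradD (gradM (@grad_coord R 0) (IH c))
  (gradZ ((-1) ^+ (~~ c)) (gradM (@grad_coord R 1) (IH (~~ c)))))) => // i p.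
have [->|->] := ord2_case i.
all: rewrite /zsign /flip ?eqxx ?I2_01 ?I2_10/=.
all: case: k {IH} => [|k]; case: c; rewrite /= ?expr0 ?expr1 -?natr1.
all: by ring.
Qed.

Lemma zpow_norm k p : zpow false k p ^+ 2 + zpow true k p ^+ 2 = rsq p ^+ k.
Proof.
elim: k => [|k IH]; first by rewrite /= expr1n expr0 expr0n addr0.
by rewrite [RHS]exprS -IH /rsq /= expr0 expr1; ring.
Qed.

Lemma zpow_le c k p : zpow c k p ^+ 2 <= rsq p ^+ k.
Proof. by rewrite -zpow_norm; case: c; rewrite ?lerDl ?lerDr sqr_ge0. Qed.

Lemma zpow_circle c k p t : p 0 0 = cos t -> p 0 1 = sin t ->
  zpow c k p = cos (k%:R * t - (if c then pi / 2 else 0)).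
Proof.
move=> px py.
suff [hc hs] : zpow false k p = cos (k%:R * t) /\ zpow true k p = sin (k%:R * t).
  by case: c; rewrite ?subr0// hs cosB cos_pihalf sin_pihalf mulr0 add0r mulr1.
elim: k => [|k [IHc IHs]]; first by rewrite mul0r cos0 sin0.
rewrite -natr1 mulrDl mul1r cosD sinD /= px py IHc IHs expr0 expr1; split; ring.
Qed.

Lemma zpow_euler c k p :
  k%:R * lincomb (fun i => zsign i c * zpow (flip i c) k.-1 p) p = k%:R * zpow c k p.
Proof.
case: k => [|k]; first by rewrite !mul0r.
rewrite lincomb2 /zsign /flip eqxx I2_01/=.
by case: c; rewrite ?expr0 ?expr1; congr (_ * _); ring.
Qed.

(* The cutoff is 1 on the disk and confines [z ^ k] to [|z|^2 <= 1 + 1/k], where it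
   is bounded independently of [k]. *)
Definition base b s l j p : R :=
  zpow (odd j (+) b) (freq j - s) p * chi l ((freq j)%:R * (rsq p - 1)).

(** In [base b s l], [s] counts the derivatives that fell on the power of [z], [l] those that fell
    on the cutoff, and [b] records whether real and imaginary parts were exchanged. The two terms
    are the two factors of the product rule. *)
Definition dbase i b s l j p : R :=
  (freq j - s)%:R * zsign i (odd j (+) b) * base (flip i b) s.+1 l j p +
  2 * (freq j)%:R * (p 0 i * base b s l.+1 j p).

Lemma grad_rsq : grad rsq (fun i p => 2 * p 0 i).
Proof.
apply: (grad_ext (gradD (gradM (@grad_coord R 0) (@grad_coord R 0))
  (gradM (@grad_coord R 1) (@grad_coord R 1)))) => [p|i p]; first by rewrite -!expr2.
have [->|->] := ord2_case i.
all: rewrite ?eqxx ?I2_01 ?I2_10/=; ring.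
Qed.

Lemma grad_base b s l j : grad (base b s l j) (fun i => dbase i b s l j).
Proof.
have dr : grad (fun p => (freq j)%:R * (rsq p - 1)) (fun i p => (freq j)%:R * (2 * p 0 i + 0)).
  by apply: gradZ; exact: gradD grad_rsq (grad_cst (- 1)).
apply: (grad_ext (gradM (grad_zpow (odd j (+) b) (freq j - s)) (grad_der (chi_tower l) dr))) => // i p.
by rewrite /dbase /base /flip addbCA subnS; ring.
Qed.

(* Closed under partial derivatives and polynomially bounded in [j]; hence the sum of
   such a family against rapidly decaying coefficients is smooth. *)
Inductive fam : (nat -> plane R -> R) -> Prop :=
| fam_base b s l : fam (base b s l)
| fam_scale (a : nat -> R) C d f : (forall j, `|a j| <= C * (1 + j%:R) ^+ d) -> fam f ->
    fam (fun j p => a j * f j p)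
| fam_coord i f : fam f -> fam (fun j p => p 0 i * f j p)
| fam_add f g : fam f -> fam g -> fam (fun j p => f j p + g j p).

Lemma freq_le j : (freq j)%:R <= 1 + j%:R :> R.
Proof. by rewrite addrC natr1 ler_nat /freq uphalfE -divn2 leq_div. Qed.

Lemma fam_dbase i b s l : fam (dbase i b s l).
Proof.
apply: fam_add.
  apply: (@fam_scale _ 1 1) => [j|]; last exact: fam_base.
  rewrite mul1r expr1 normrM /zsign normrX normrN1 expr1n mulr1 normr_nat.
  by apply: le_trans (freq_le j); rewrite ler_nat leq_subr.
apply: (@fam_scale _ 2 1) => [j|]; last by apply: fam_coord; exact: fam_base.
by rewrite expr1 ger0_norm ?mulr_ge0// ler_wpM2l// freq_le.
Qed.

Lemma fam_grad f : fam f -> exists g : 'I_2 -> nat -> plane R -> R,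
  (forall j, grad (f j) (fun i => g i j)) /\ forall i, fam (g i).
Proof.
elim=> {f} [b s l|a C d f aC _ [g [dg fg]]|i f ff [g [dg fg]]|f1 f2 _ [g1 [d1 F1]] _ [g2 [d2 F2]]].
- exists (fun i => dbase i b s l); split=> [j|i]; [exact: grad_base|exact: fam_dbase].
- exists (fun i j p => a j * g i j p); split=> [j|i]; first exact: gradZ.
  exact: fam_scale aC (fg i).
- exists (fun l j p => (l == i)%:R * f j p + p 0 i * g l j p); split=> [j|l].
    exact: gradM (@grad_coord R i) (dg j).
  apply: fam_add; last exact: fam_coord.
  apply: (@fam_scale _ 1 0) => // j.
  by rewrite normr_nat expr0 mulr1; case: eqP.
- exists (fun i j p => g1 i j p + g2 i j p); split=> [j|i]; first exact: gradD.
  exact: fam_add.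
Qed.

(** With [k = freq j], where the cutoff does not vanish [|z|^2 <= 1 + 1/k], hence
    [|z|^(2k) <= (1 + 1/k)^k], which is at most the base of the exponential, independently of
    [j]. *)
Lemma base_le b s l : exists B, forall j p, `|base b s l j p| <= B.
Proof.
have [B hB] := chi_bounded l.
have B0 : 0 <= B by apply: le_trans (hB 0); exact: normr_ge0.
exists (expR 1 * B) => j p; rewrite /base.
have e1 : 1 <= expR 1 :> R by rewrite -expR0 ler_expR.
have [h|h] := ltP 1 ((freq j)%:R * (rsq p - 1)).
  by rewrite (chi_supp l h) mulr0 normr0 mulr_ge0// expR_ge0.
rewrite normrM ler_pM// -(ler_pXn2r (_ : (0 < 2)%N)) ?nnegrE ?expR_ge0//.
rewrite real_normK ?num_real//.
apply: le_trans (zpow_le _ _ _) _; apply: le_trans (_ : expR 1 <= _); last first.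
  by rewrite expr2 ler_peMr ?expR_ge0.
have r0 : 0 <= rsq p by rewrite addr_ge0 ?sqr_ge0.
have [m0|m0] := posnP (freq j); first by rewrite m0 sub0n expr0.
have mp : 0 < (freq j)%:R :> R by rewrite ltr0n.
have [r1|r1] := leP (rsq p) 1; first by rewrite (le_trans _ e1)// exprn_ile1.
apply: le_trans (_ : rsq p ^+ freq j <= _); first by rewrite ler_weXn2l ?(ltW r1)// leq_subr.
have -> : expR 1 = expR ((freq j)%:R^-1) ^+ freq j :> R.
  by rewrite -[RHS]expRM_natl mulfV ?gt_eqF.
rewrite lerXn2r ?nnegrE ?expR_ge0//.
apply: le_trans (expR_ge1Dx _).
by rewrite -lerBlDl -[leRHS]mul1r ler_pdivlMr// mulrC.
Qed.

Lemma pow1_le (d e : nat) j : (d <= e)%N -> (1 + j%:R) ^+ d <= (1 + j%:R) ^+ e :> R.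
Proof. by move=> de; rewrite ler_weXn2l// lerDl. Qed.

Lemma fam_bound f r : fam f -> exists C d, 0 <= C /\
  forall j p, `|p| <= r -> `|f j p| <= C * (1 + j%:R) ^+ d.
Proof.
have j0 j : 0 <= 1 + j%:R :> R by rewrite addr_ge0.
elim=> {f} [b s l|a C d f aC _ [C' [d' [C0 fC]]]|i f _ [C [d [C0 fC]]]|
  f1 f2 _ [C1 [d1 [C0 h1]]] _ [C2 [d2 [C0' h2]]]].
- have [B hB] := base_le b s l; exists B, 0%N; split.
    by apply: le_trans (hB 0%N 0); exact: normr_ge0.
  by move=> j p _; rewrite expr0 mulr1.
- exists (C * C'), (d + d')%N; split.
    rewrite mulr_ge0//; have := aC 0%N; rewrite addr0 expr1n mulr1.
    by apply: le_trans.
  by move=> j p pr; rewrite exprD mulrACA normrM ler_pM ?fC.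
- exists (`|r| * C), d; split; first by rewrite mulr_ge0.
  move=> j p pr; rewrite normrM -mulrA ler_pM ?fC//.
  by apply: le_trans (entry_le p i) _; apply: le_trans pr (ler_norm r).
- exists (C1 + C2), (d1 + d2)%N; split; first exact: addr_ge0.
  move=> j p pr; apply: le_trans (ler_normD _ _) _; rewrite mulrDl lerD//.
    by apply: le_trans (h1 j p pr) _; rewrite ler_wpM2l// pow1_le// leq_addr.
  by apply: le_trans (h2 j p pr) _; rewrite ler_wpM2l// pow1_le// leq_addl.
Qed.

Definition rapid u := forall s, exists C, forall j, `|u j| * (1 + j%:R) ^+ s <= C.

(** [D] depends neither on [x] nor on [y]. With [y] the square of the norm of a displacement, the
    summed Taylor remainders stay quadratic. *)
Lemma rapid_summable u (a : nat -> R) C d : rapid u ->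
  exists2 D, 0 <= D & forall (x : nat -> R) (y : R), 0 <= y ->
    (forall j, `|x j| <= y * (C * (1 + j%:R) ^+ d)) ->
    sq_summable (D * y) (fun j => u j * x j).
Proof.
move=> /(_ (d + 2)%N)[D uD].
have D0 : 0 <= D by apply: le_trans (uD 0%N); rewrite mulr_ge0// exprn_ge0// addr_ge0.
exists (D * `|C|) => [|x y y0 xC j]; first exact: mulr_ge0.
have j0 : 0 < 1 + j%:R :> R by rewrite ltr_pwDl.
rewrite exprVn ler_pdivlMr ?exprn_gt0// normrM.
apply: le_trans (_ : `|u j| * (y * (`|C| * (1 + j%:R) ^+ d)) * (1 + j%:R) ^+ 2 <= _).
  rewrite ler_wpM2r ?exprn_ge0 ?(ltW j0)// ler_wpM2l// (le_trans (xC j))//.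
  by rewrite ler_wpM2l// ler_wpM2r ?exprn_ge0 ?(ltW j0)// ler_norm.
have -> : `|u j| * (y * (`|C| * (1 + j%:R) ^+ d)) * (1 + j%:R) ^+ 2 =
    `|u j| * (1 + j%:R) ^+ (d + 2) * (`|C| * y) by rewrite exprD; ring.
by rewrite -[leRHS]mulrA ler_wpM2r// mulr_ge0.
Qed.

Definition Phi u f p : R := ssum (fun j => u j * f j p).

Lemma Phi_summable u f p : rapid u -> fam f -> exists C, sq_summable C (fun j => u j * f j p).
Proof.
move=> ru ff; have [C [d [C0 fC]]] := fam_bound `|p| ff.
have [D D0 hD] := @rapid_summable u (fun=> 0) C d ru.
by exists (D * 1); apply: hD => // j; rewrite mul1r fC.
Qed.

Lemma Phi_lincomb u (f : 'I_2 -> nat -> plane R -> R) p v : rapid u -> (forall i, fam (f i)) ->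
  lincomb (fun i => Phi u (f i) p) v = ssum (fun j => u j * lincomb (fun i => f i j p) v) /\
  exists C, sq_summable C (fun j => u j * lincomb (fun i => f i j p) v).
Proof.
move=> ru ff; have [C0 h0] := Phi_summable p ru (ff 0); have [C1 h1] := Phi_summable p ru (ff 1).
have k0 := sq_summableZ (v 0 0) h0; have k1 := sq_summableZ (v 0 1) h1.
have E : (fun j => u j * lincomb (fun i => f i j p) v) =
   (fun j => v 0 0 * (u j * f 0 j p) + v 0 1 * (u j * f 1 j p)).
  by apply/funext => j; rewrite lincomb2; ring.
rewrite E lincomb2 /Phi (ssumD k0 k1) (ssumZ _ h0) (ssumZ _ h1); split=> //.
by exists (`|v 0 0| * C0 + `|v 0 1| * C1); exact: sq_summableD.
Qed.

(** Termwise differentiation through Taylor remainders: each is quadratic in the displacement with a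
    constant polynomial in [j], so their sum against rapidly decaying coefficients is again
    quadratic. *)
Lemma Phi_grad u f g : rapid u -> fam f -> (forall i, fam (g i)) ->
  (forall j, grad (f j) (fun i => g i j)) -> grad (Phi u f) (fun i => Phi u (g i)).
Proof.
move=> ru ff fg dg p.
have /choice[h hh] : forall i, exists h : 'I_2 -> nat -> plane R -> R,
    (forall j, grad (g i j) (fun l => h l j)) /\ forall l, fam (h l).
  by move=> i; exact: fam_grad.
have [C [d [C0 hB]]] : exists C d, 0 <= C /\ forall i l j q, `|q| <= `|p| + 1 ->
    `|h i l j q| <= C * (1 + j%:R) ^+ d.
  have /choice[k hk] (il : 'I_2 * 'I_2) : exists k : R * nat, 0 <= k.1 /\
      forall j q, `|q| <= `|p| + 1 -> `|h il.1 il.2 j q| <= k.1 * (1 + j%:R) ^+ k.2.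
    have [C [d hC]] := fam_bound (`|p| + 1) ((hh il.1).2 il.2).
    by exists (C, d).
  exists (\sum_il (k il).1), (\sum_il (k il).2)%N; split.
    by apply: sumr_ge0 => il _; exact: (hk il).1.
  move=> i l j q /((hk (i, l)).2 j) /le_trans; apply.
  apply: ler_pM; rewrite ?exprn_ge0 ?addr_ge0//; first exact: (hk _).1.
    by rewrite (bigD1 (i, l))//= lerDl sumr_ge0// => il _; exact: (hk il).1.
  by apply: pow1_le; rewrite (bigD1 (i, l))//= leq_addr.
have [D D0 hD] := @rapid_summable u (fun=> 0) (4 * C) d ru.
apply: (@is_diff_quadratic _ _ _ _ (2 * D)) => v v1.
have [-> [E hE]] := Phi_lincomb p v ru fg.
have [E1 h1] := Phi_summable (p + v) ru ff; have [E2 h2] := Phi_summable p ru ff.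
have k2 := sq_summableZ (-1) h2; have kE := sq_summableZ (-1) hE.
have -> : Phi u f (p + v) - Phi u f p - ssum (fun j => u j * lincomb (fun i => g i j p) v) =
    ssum (fun j => u j * (f j (p + v) - f j p - lincomb (fun i => g i j p) v)).
  rewrite -[- Phi u f p]mulN1r -[- ssum _]mulN1r /Phi -(ssumZ _ h2) -(ssumZ _ hE).
  rewrite -(ssumD h1 k2) -(ssumD (sq_summableD h1 k2) kE).
  by congr ssum; apply/funext => j; ring.
rewrite -mulrA; apply: ssum_le; apply: hD => [|j]; first exact: sqr_ge0.
have := @grad_taylor R (f j) (fun i => g i j) (fun i l => h i l j) p v (C * (1 + j%:R) ^+ d) (dg j)
  (fun i => (hh i).1 j) (fun i l q => hB i l j q) v1.
by congr (_ <= _); ring.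
Qed.

Lemma Phi_smooth u f : rapid u -> fam f -> smooth (Phi u f).
Proof.
move=> ru ff.
apply: (@smooth_closed _ [set F | exists2 g, fam g & F = Phi u g]); last by exists f.
move=> _ [g fg ->]; have [g' [dg fg']] := fam_grad fg.
by exists (fun i => Phi u (g' i)) => [|i]; [exact: Phi_grad|exists (g' i)].
Qed.

Lemma base_disk b s l j p : rsq p <= 1 -> base b s l.+1 j p = 0.
Proof. by move=> p1; rewrite /base chi_flat ?mulr0// mulr_ge0_le0// subr_le0. Qed.

(** All derivatives of the cutoff vanish on the closed disk, so the second partial derivatives are
    those of the powers of [z]; the two pure ones are opposite because [i ^ 2 = -1]. *)
Lemma Phi_harmonic u p : rapid u -> rsq p <= 1 ->
  \sum_i partial i (partial i (Phi u (base false 0 0))) p = 0.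
Proof.
move=> ru p1.
have dE i : partial i (Phi u (base false 0 0)) = Phi u (dbase i false 0 0).
  apply: (grad_partial i (g := fun i => Phi u (dbase i false 0 0))).
  by apply: Phi_grad => // [|l|j]; [exact: fam_base|exact: fam_dbase|exact: grad_base].
have d2 i : exists g : 'I_2 -> nat -> plane R -> R,
    [/\ forall l, fam (g l), forall j, grad (dbase i false 0 0 j) (fun l => g l j)
    & forall j, g i j p = (-1) ^+ (i == 1) *
      ((freq j)%:R * (freq j - 1)%:R * base false 2 0 j p)].
  have [g [dg fg]] := fam_grad (fam_dbase i false 0 0); exists g; split=> // j.
  rewrite -(grad_partial i (dg j)).
  have dd := gradD (gradZ ((freq j - 0)%:R * zsign i (odd j (+) false)) (grad_base (flip i false) 1 0 j))
    (gradZ (2 * (freq j)%:R) (gradM (@grad_coord R i) (grad_base false 0 1 j))).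
  rewrite (grad_partial i dd) /dbase !base_disk// !mulr0 !addr0 subn0 addbF /flip addbF.
  rewrite addbb /zsign; case: (i == 1) => /=; case: (odd j) => /=; rewrite ?expr0 ?expr1; ring.
rewrite sum2 !dE.
have [g0 [f0 h0 e0]] := d2 0; have [g1 [f1 h1 e1]] := d2 1.
have P i g : (forall l, fam (g l)) -> (forall j, grad (dbase i false 0 0 j) (fun l => g l j)) ->
    partial i (Phi u (dbase i false 0 0)) = Phi u (g i).
  move=> fg dg; apply: (grad_partial i (g := fun l => Phi u (g l))).
  by apply: Phi_grad => //; exact: fam_dbase.
rewrite (P 0 g0)// (P 1 g1)//.
have [C0 s0] := Phi_summable p ru (f0 0); have [C1 s1] := Phi_summable p ru (f1 1).
have <- : ssum (fun=> 0) = 0 :> R by rewrite (@ssum_finite _ _ 0) ?big_ord0.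
rewrite /Phi -(ssumD s0 s1); congr ssum; apply/funext => j; rewrite e0 e1 eqxx I2_01.
by rewrite expr0 expr1; ring.
Qed.

Lemma Phi_circle u p t : p 0 0 = cos t -> p 0 1 = sin t ->
  Phi u (base false 0 0) p = fseries u t.
Proof.
move=> px py; rewrite /Phi /fseries; congr ssum; apply/funext => j.
have p1 : rsq p = 1 by rewrite /rsq px py cos2Dsin2.
rewrite /base p1 subrr mulr0 chi_one// mulr1 subn0 addbF (zpow_circle _ _ px py).
by [].
Qed.

Lemma Phi_radial u p t : rapid u -> p 0 0 = cos t -> p 0 1 = sin t ->
  'D_p (Phi u (base false 0 0)) p = fseries (fun j => (freq j)%:R * u j) t.
Proof.
move=> ru px py.
have p1 : rsq p = 1 by rewrite /rsq px py cos2Dsin2.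
have dP : grad (Phi u (base false 0 0)) (fun i => Phi u (dbase i false 0 0)).
  by apply: Phi_grad => // [|l|j]; [exact: fam_base|exact: fam_dbase|exact: grad_base].
rewrite (grad_derive _ _ dP).
have [-> _] := Phi_lincomb p p ru (fun i => fam_dbase i false 0 0).
rewrite /fseries; congr ssum; apply/funext => j.
rewrite [(freq j)%:R * u j]mulrC -mulrA; congr (_ * _).
have -> : (fun i => dbase i false 0 0 j p) =
    (fun i => (freq j)%:R * (zsign i (odd j) * zpow (flip i (odd j)) (freq j).-1 p)).
  apply/funext => i; rewrite /dbase base_disk ?p1// !mulr0 addr0 /base p1 subrr mulr0.
  by rewrite chi_one// mulr1 subn0 addbF subn1 /flip addbF addbC mulrA.
transitivity ((freq j)%:R * lincomb (fun i => zsign i (odd j) * zpow (flip i (odd j)) (freq j).-1 p) p).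
  by rewrite !lincomb2; ring.
by rewrite zpow_euler (zpow_circle _ _ px py).
Qed.

End Extension.

Lemma harmonic_extension (R : realType) (u : nat -> R) :
  (forall s, exists C, forall j, `|u j| * (1 + j%:R) ^+ s <= C) ->
  exists phi : plane R -> R, [/\ smooth phi,
    forall p : plane R, p 0 0 ^+ 2 + p 0 1 ^+ 2 <= 1 -> \sum_i partial i (partial i phi) p = 0,
    forall (p : plane R) t, p 0 0 = cos t -> p 0 1 = sin t -> phi p = fseries u t
  & forall (p : plane R) t, p 0 0 = cos t -> p 0 1 = sin t ->
      'D_p phi p = fseries (fun j => (freq j)%:R * u j) t].
Proof.
move=> ru; have [chi [dchi c1 c0 cs cb]] := cutoff R.
exists (Phi u (base chi false 0 0)); split.
- by apply: Phi_smooth => //; exact: fam_base.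
- by move=> p p1; exact: Phi_harmonic.
- by move=> p t px py; exact: Phi_circle.
- by move=> p t px py; exact: Phi_radial.
Qed.

(** * The disk *)

Section Circle.
Variable R : realType.
Implicit Types (p q v : plane R) (t : R) (f : R -> R).

Definition gam t : plane R := delta_mx 0 0 *m rotation t.

Lemma plane_eq p q : p 0 0 = q 0 0 -> p 0 1 = q 0 1 -> p = q.
Proof. by move=> e0 e1; apply/rowP => i; case: (ord2_case i) => ->. Qed.

Lemma dotE p q : dot p q = p 0 0 * q 0 0 + p 0 1 * q 0 1.
Proof. by rewrite /dot mxE sum2 !mxE. Qed.

Lemma mul_rotation0 p t : (p *m rotation t) 0 0 = p 0 0 * cos t - p 0 1 * sin t.
Proof. by rewrite mxE sum2 !mxE /= mulrN. Qed.

Lemma mul_rotation1 p t : (p *m rotation t) 0 1 = p 0 0 * sin t + p 0 1 * cos t.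
Proof. by rewrite mxE sum2 !mxE. Qed.

Lemma gam0 t : gam t 0 0 = cos t.
Proof. by rewrite mul_rotation0 !mxE /= mul1r mul0r subr0. Qed.

Lemma gam1 t : gam t 0 1 = sin t.
Proof. by rewrite mul_rotation1 !mxE /= mul1r mul0r addr0. Qed.

Lemma gamD t u : gam t *m rotation u = gam (t + u).
Proof.
apply: plane_eq.
  by rewrite (mul_rotation0 (gam t)) !gam0 gam1 cosD.
by rewrite (mul_rotation1 (gam t)) !gam1 gam0 sinD addrC.
Qed.

Lemma gam_per t : gam (t + 2 * pi) = gam t.
Proof. rewrite mulr_natl; apply: plane_eq; first by rewrite !gam0 cosD2pi.
by rewrite !gam1 sinD2pi. Qed.

Lemma gam_circle t : circle (gam t).
Proof. by rewrite /circle /= dotE gam0 gam1 -!expr2 cos2Dsin2. Qed.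

Lemma circle_gam p : circle p -> exists t, p = gam t.
Proof.
rewrite /circle /= dotE -!expr2 => p1.
have x1 : p 0 0 ^+ 2 <= 1 by rewrite -p1 lerDl sqr_ge0.
have {}x1 : -1 <= p 0 0 <= 1 by rewrite -ler_norml -(ler_pXn2r (_ : (0 < 2)%N)) ?nnegrE// real_normK ?num_real// expr1n.
have hs : sin (acos (p 0 0)) = `|p 0 1|.
  rewrite sin_acos// (_ : 1 - _ = p 0 1 ^+ 2) ?sqrtr_sqr//.
  by rewrite -p1 addrC addKr.
have [y0|y0] := leP 0 (p 0 1).
  by exists (acos (p 0 0)); apply: plane_eq; rewrite ?gam0 ?gam1 ?acosK ?hs ?ger0_norm.
exists (- acos (p 0 0)); apply: plane_eq; rewrite ?gam0 ?gam1 ?cosN ?acosK//.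
by rewrite sinN hs ltr0_norm// opprK.
Qed.

Lemma der_gam (H : plane R -> R) : smooth H ->
  der (fun t => H (gam t))
    (fun t => - sin t * partial 0 H (gam t) + cos t * partial 1 H (gam t)).
Proof.
move=> /smooth_grad[dH _] t.
have dg : is_diff t gam (fun y => (y * - sin t) *: delta_mx 0 0 + (y * cos t) *: delta_mx 0 1).
  have := is_diffD (is_diff_comp (der_is_diff t (@der_cos R)) (is_diff_scalel (cos t) (delta_mx 0 0 : plane R)))
    (is_diff_comp (der_is_diff t (@der_sin R)) (is_diff_scalel (sin t) (delta_mx 0 1 : plane R))).
  congr is_diff_def; apply/funext => s; apply: plane_eq.
    by rewrite gam0 fctE !mxE /= mulr1 mulr0 addr0.
  by rewrite gam1 fctE !mxE /= mulr1 mulr0 add0r.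
have [cd cv] := is_diff_comp dg (dH (gam t)).
split; first exact/derivable1_diffP.
by rewrite deriveE// cv /= lincomb2 !mxE /= !mul1r !mulr1 !mulr0 addr0 add0r.
Qed.

(** A class containing the boundary density and closed under differentiation, as [class_tower]
    requires. Restrictions of all smooth functions are included because differentiating along the
    circle produces partial derivatives. *)
Inductive circ : (R -> R) -> Prop :=
| circ_cst a : circ (fun=> a)
| circ_sin : circ sin
| circ_cos : circ cos
| circ_restr (H : plane R -> R) : smooth H -> circ (fun t => H (gam t))
| circ_exp f : circ f -> circ (fun t => expR (f t))
| circ_add f g : circ f -> circ g -> circ (fun t => f t + g t)
| circ_mul f g : circ f -> circ g -> circ (fun t => f t * g t).

Lemma circ_der f : circ f -> exists2 f', circ f' & der f f'.
Proof.
have circN h : circ h -> circ (fun t => - h t).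
  move=> hh; rewrite (_ : (fun t => - h t) = (fun t => (-1) * h t)); last first.
    by apply/funext => t; rewrite mulN1r.
  by apply: circ_mul => //; exact: circ_cst.
elim=> {f} [a|||H sH|f ff [f' cf df]|f g cf [f' cf' df] cg [g' cg' dg]|
    f g cf [f' cf' df] cg [g' cg' dg]].
- by exists (fun=> 0); [exact: circ_cst|exact: der_cst].
- by exists cos; [exact: circ_cos|exact: der_sin].
- by exists (fun t => - sin t); [apply: circN; exact: circ_sin|exact: der_cos].
- have [_ sd] := smooth_grad sH.
  exists (fun t => - sin t * partial 0 H (gam t) + cos t * partial 1 H (gam t)).
    apply: circ_add; apply: circ_mul; try exact: circ_restr; last exact: circ_cos.
    by apply: circN; exact: circ_sin.
  exact: der_gam.
- exists (fun t => expR (f t) * f' t); last exact: der_comp (@der_exp R) df.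
  by apply: circ_mul => //; exact: circ_exp.
- by exists (fun t => f' t + g' t); [exact: circ_add|exact: derD].
- exists (fun t => f' t * g t + f t * g' t); last exact: derM.
  by apply: circ_add; exact: circ_mul.
Qed.

Lemma circ_ptower f : circ f -> per f -> exists2 F, F 0%N = f & ptower F.
Proof.
move=> cf pf; have [F F0 dF] := class_tower circ_der cf; exists F => //; split=> // s.
elim: s => [|s IH]; first by rewrite F0.
have dS : der (F s) (fun t => F s.+1 (t + 2 * pi)).
  have dt : der (fun t : R => t + 2 * pi) (fun=> 1 + 0) by apply: derD; [exact: der_id|exact: der_cst].
  apply: (der_ext (der_comp (dF s) dt)) => t; first exact: IH.
  by rewrite addr0 mulr1.
by move=> t; rewrite (der_uniq dS (dF s)).
Qed.

End Circle.

Section ConformalDisk.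
Variables (R : realType) (g : metric_field R) (w : plane R -> R).
Hypothesis w_smooth : smooth w.
Hypothesis g_conf : forall p, disk p -> g p = expR (2 * w p) *: 1%:M.
Implicit Types (p q v : plane R) (t : R).

Definition rho t : R := expR (w (gam t)).

Lemma inner_conf p v q : disk p -> inner g p v q = expR (2 * w p) * dot v q.
Proof. by move=> dp; rewrite /inner g_conf// -scalemxAr mulmx1 -scalemxAl mxE. Qed.

Lemma circle_disk p : circle p -> disk p.
Proof. by rewrite /circle /disk /= => ->. Qed.

Lemma tangent0 p : tangent p 0 0 = - p 0 1.
Proof. by rewrite mul_rotation0 cos_pihalf sin_pihalf mulr0 mulr1 sub0r. Qed.

Lemma tangent1 p : tangent p 0 1 = p 0 0.
Proof. by rewrite mul_rotation1 cos_pihalf sin_pihalf mulr0 mulr1 addr0. Qed.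

Lemma boundary_length_rho : boundary_length g = cint rho.
Proof.
rewrite /boundary_length /cint /=; congr Rintegral; apply/funext => t.
rewrite -/(gam t) inner_conf; last exact/circle_disk/gam_circle.
rewrite dotE tangent0 tangent1 mulrNN -!expr2 gam0 gam1 addrC cos2Dsin2 mulr1.
by rewrite expRM_natl sqrtr_sqr gtr0_norm// expR_gt0.
Qed.

Lemma rho_invariant n t : invariant_metric (@rotation_group R n) g ->
  rho (t + 2 * pi / n%:R) = rho t.
Proof.
move=> inv; have dt (s : R) : disk (gam s) by exact/circle_disk/gam_circle.
have rot1 : rotation_group n (rotation (2 * pi / n%:R) : 'M[R]_2).
  by exists 1%N; rewrite expr1.
have := inv _ rot1 (gam t) (gam t) (gam t) (dt t).
rewrite gamD !inner_conf// !(gam_circle _ : dot _ _ = 1) !mulr1 => /expR_inj/(mulfI _) e.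
by rewrite /rho e.
Qed.

(** In dimension two the square root of the determinant cancels the inverse metric, so the operator
    is the flat Laplacian up to a factor. The conformal formula holds only on the disk, and openness
    lets it be used under the outer derivative. *)
Lemma laplace_conf (f : plane R -> R) p : open_disk p ->
  \sum_i partial i (partial i f) p = 0 -> laplace_beltrami g f p = 0.
Proof.
move=> p1 f0; rewrite /laplace_beltrami.
transitivity ((Num.sqrt (\det (g p)))^-1 * \sum_i partial i (partial i f) p); last first.
  by rewrite f0 mulr0.
congr (_ * _); apply: eq_bigr => i _; apply: near_eq_derive.
have od : open (@open_disk R).
  rewrite (_ : @open_disk R = (fun q : plane R => dot q q) @^-1` [set x | x < 1])//.
  apply: open_comp => [q _|]; last exact: open_lt.
  rewrite (_ : (fun q : plane R => dot q q) = (fun q => q 0 0 * q 0 0 + q 0 1 * q 0 1)); last first.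
    by apply/funext => r; rewrite dotE.
  by apply: contD; apply: contM; exact: coord_continuous.
have := open_nbhs_nbhs (conj od p1); apply: filterS => q q1.
have qd : disk q by exact: ltW.
have e0 := expR_gt0 (2 * w q).
rewrite g_conf// scalemx1 det_scalar sqrtr_sqr gtr0_norm// invmx_scalar.
rewrite (bigD1 i)//= big1 ?addr0 => [|j ji]; last by rewrite !mxE eq_sym (negbTE ji) mul0r.
by rewrite !mxE eqxx mulVKf ?gt_eqF.
Qed.

Lemma normal_conf p v : circle p -> outward_unit_normal g p v -> v = expR (- w p) *: p.
Proof.
move=> pc [vt vv vp]; have pd := circle_disk pc.
rewrite inner_conf// in vt; rewrite inner_conf// in vv.
have e0 := expR_gt0 (2 * w p).
have {}vt : dot v (tangent p) = 0 by apply/eqP; move/eqP: vt; rewrite mulf_eq0 gt_eqF.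
rewrite dotE tangent0 tangent1 in vt.
have p1 : p 0 0 * p 0 0 + p 0 1 * p 0 1 = 1 by rewrite -dotE.
have vE : v = dot v p *: p.
  apply: plane_eq; rewrite !mxE dotE.
    rewrite -[LHS]mulr1 -p1; apply/eqP; rewrite -subr_eq0; apply/eqP.
    by transitivity (- p 0 1 * (v 0 0 * - p 0 1 + v 0 1 * p 0 0) - p 0 1 * p 0 1 * v 0 0 + p 0 1 * p 0 1 * v 0 0); [ring|rewrite vt; ring].
  rewrite -[LHS]mulr1 -p1; apply/eqP; rewrite -subr_eq0; apply/eqP.
  by transitivity (p 0 0 * (v 0 0 * - p 0 1 + v 0 1 * p 0 0)); [ring|rewrite vt; ring].
rewrite {1}vE; congr (_ *: _).
have vv' : dot v v = dot v p ^+ 2.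
  rewrite {1 2}vE dotE !mxE; transitivity (dot v p ^+ 2 * (p 0 0 * p 0 0 + p 0 1 * p 0 1)); first ring.
  by rewrite p1 mulr1.
apply/eqP; rewrite -(@eqrXn2 _ 2)// ?expR_ge0 ?(ltW vp)// -vv' -expRM_natl mulrN expRN.
by apply/eqP; apply: (mulfI (lt0r_neq0 e0)); rewrite vv mulfV// gt_eqF.
Qed.

Lemma rho_circ : circ rho.
Proof. by apply: circ_exp; exact: circ_restr. Qed.

Lemma steklov_conf n m c : invariant_metric (@rotation_group R n) g ->
  (2 < n)%N -> (0 < m %% n < n.-1)%N -> 2 * pi * m%:R < c * boundary_length g ->
  (steklov_eigenvalue g m.+1 <= c%:E)%E.
Proof.
move=> inv n2 mn; rewrite boundary_length_rho => cL.
have pr : per rho by move=> t; rewrite /rho gam_per.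
have [F F0 tF] := circ_ptower rho_circ pr.
have rho0 t : 0 < F 0%N t by rewrite F0 expR_gt0.
have rhoI t : F 0%N (t + 2 * pi / n%:R) = F 0%N t by rewrite F0 rho_invariant.
have {}cL : 2 * pi * m%:R < c * cint (F 0%N) by rewrite F0.
have [phi [e [ec rphi eqn orth]]] := steklov_on_circle tF rho0 rhoI n2 mn cL.
have /choice[Phi hPhi] := fun a => harmonic_extension (rphi a).
have PhiE a t : Phi a (gam t) = fseries (phi a) t.
  by have [_ _ h _] := hPhi a; apply: h; rewrite ?gam0 ?gam1.
have summ a : exists C, sq_summable C (phi a).
  have [C hC] := rphi a 2%N; exists C => i.
  by rewrite exprVn ler_pdivlMr ?exprn_gt0 ?ltr_pwDl//; exact: hC.
have cF a : continuous (fseries (phi a)) by have [C /cont_fseries] := summ a.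
have c0 : continuous (F 0%N) by exact: der_cont (tF.1 0%N).
(* Indexing starts at 0, so the index [m + 1] asks for [m + 2] independent eigenfunctions.
   Independence is read off on the circle, where they are orthonormal for the boundary density. *)
apply: ereal_inf_lbound; exists c => //; exists Phi.
  move=> x x0 b.
  have : cint (fun t => \sum_a x a * (F 0%N t * (fseries (phi a) t * fseries (phi b) t))) = 0.
    transitivity (cint (fun=> 0 : R)); last exact: cint0.
    congr cint; apply/funext => t.
    transitivity (F 0%N t * fseries (phi b) t * \sum_a x a * Phi a (gam t)).
      by rewrite mulr_sumr; apply: eq_bigr => a _; rewrite PhiE; ring.
    by rewrite x0 ?mulr0//; exact/circle_disk/gam_circle.
  have cc a : continuous (fun t => F 0%N t * (fseries (phi a) t * fseries (phi b) t)).
    by apply: contM => //; apply: contM.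
  rewrite cint_sum => [|a]; last exact: contZ.
  rewrite (bigD1 b)//= big1 => [|a ab]; last by rewrite cintZ// orth (negbTE ab) mulr0.
  by rewrite cintZ// orth eqxx mulr1 addr0.
move=> a; exists (e a) => //; have [sP hP _ rP] := hPhi a; split=> // [p p1|p v pc nv].
  apply: laplace_conf => //; apply: hP.
  by move: p1; rewrite /open_disk /= dotE -!expr2 => /ltW.
have [t pE] := circle_gam pc.
rewrite (normal_conf pc nv) pE PhiE.
have [dP _] := smooth_grad sP.
rewrite (grad_derive _ _ dP).
have -> : lincomb (fun i => partial i (Phi a) (gam t)) (expR (- w (gam t)) *: gam t) =
    expR (- w (gam t)) * lincomb (fun i => partial i (Phi a) (gam t)) (gam t).
  by rewrite !lincomb2 !mxE; ring.
rewrite -(grad_derive _ _ dP) (rP _ t) ?gam0 ?gam1// eqn F0 /rho expRN.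
by rewrite mulrCA; congr (_ * _); rewrite mulKf// gt_eqF// expR_gt0.
Qed.

Lemma boundary_length_gt0 : 0 < boundary_length g.
Proof.
have [f' _ dr] := circ_der rho_circ.
rewrite boundary_length_rho; apply: (@cint_gt0 _ _ 0) => [|t _||].
- exact: der_cont dr.
- exact: expR_ge0.
- by rewrite lexx ltW// twopi_gt0.
- exact: expR_gt0.
Qed.

End ConformalDisk.

Theorem corollary1p15 (R : realType) (n k : nat)
    (hn : (1 <= n)%N) (hk : (1 <= k)%N)
    (hmod : (k %% n)%N \notin [:: 0%N; 1%N]) :
  (sup_steklov_disk R n k < (2 * pi * k%:R)%:E)%E.
Proof.
have [m km] : exists m, k = m.+1 by exists k.-1; rewrite prednK.
rewrite !inE negb_or in hmod; case/andP: hmod => r0 r1.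
have rn : (k %% n < n)%N by rewrite ltn_mod.
(* A remainder other than 0 and 1 exists only for [n >= 3], which makes [tau] smaller than [pi];
   being at least 2, the remainder also drops by exactly one from [k] to [m], without wrapping
   around. *)
have n2 : (2 < n)%N by lia.
have mE : (m %% n = (k %% n).-1)%N.
  have : m = (k %/ n * n + (k %% n).-1)%N by have := divn_eq k n; lia.
  by move=> ->; rewrite modnMDl modn_small//; lia.
have mn : (0 < m %% n < n.-1)%N by rewrite mE; lia.
have p0 : 0 < 2 * pi :> R by exact: twopi_gt0.
(* A bound common to all admissible metrics, so the supremum remains strictly below [2 * pi * k].
   The half places it strictly between [2 * pi * m] and [2 * pi * k]. *)
apply: (@le_lt_trans _ _ (2 * pi * (m%:R + 2^-1))%:E); last first.
  by rewrite lte_fin ltr_pM2l// km -[m.+1]addn1 natrD ltrD2l invf_lt1// ltr1n.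
apply: ge_ereal_sup => _ [g [_ [w sw gw] inv] <-].
have L0 : 0 < boundary_length g by exact: boundary_length_gt0 gw.
rewrite /normalized_steklov_eigenvalue.
have := @steklov_conf R g w sw gw n m (2 * pi * (m%:R + 2^-1) / boundary_length g) inv n2 mn.
rewrite divfK ?gt_eqF// ltr_pM2l// ltrDl invr_gt0 ltr0n => /(_ isT) h.
rewrite km; apply: le_trans (lee_wpmul2r _ h) _; first by rewrite lee_fin ltW.
by rewrite -EFinM divfK// gt_eqF.
Qed.
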